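(* Let $C$ be an orientation of a cycle of even length $\ell$. Then $C$ is quasirandom-forcing if $\gamma_C=1$, \[\frac{\alpha_C(2)}{2^{\ell-2}}+\sum_{\substack{k\ge1,\ n_1=\cdots=n_k=1\\ 3<k+2n_1+\cdots+2n_k\le\ell}}\frac{\min\{0,\alpha_C(2n_1,\ldots,2n_k)\}}{12^{k-1}\cdot 2^{\ell-2n_1-\cdots-2n_k}}\ge 0\quad\text{and}\] \[\frac{\alpha_C(4)}{2^{\ell-4}}+\sum_{\substack{k\ge1,\ 1\le n_1\le\cdots\le n_k,\ 2\le n_k\\ 5<k+2n_1+\cdots+2n_k\le\ell}}\frac{\min\{0,\alpha_C(2n_1,\ldots,2n_k)\}}{12^{k-1}\cdot\pi^{2n_1+\cdots+2n_k-2k-2}\cdot 2^{\ell-2n_1-\cdots-2n_k}}\ge 0.\] Similarly, $C$ is quasirandom-forcing if $\gamma_C=-1$ and the two analogous inequalities hold with $\min\{0,\cdot\}$ replaced by $\max\{0,\cdot\}$ and $\ge 0$ replaced by $\le 0$: \[\frac{\alpha_C(2)}{2^{\ell-2}}+\sum_{\substack{k\ge1,\ n_1=\cdots=n_k=1\\ 3<k+2n_1+\cdots+2n_k\le\ell}}\frac{\max\{0,\alpha_C(2n_1,\ldots,2n_k)\}}{12^{k-1}\cdot 2^{\ell-2n_1-\cdots-2n_k}}\le 0\quad\text{and}\] \[\frac{\alpha_C(4)}{2^{\ell-4}}+\sum_{\substack{k\ge1,\ 1\le n_1\le\cdots\le n_k,\ 2\le n_k\\ 5<k+2n_1+\cdots+2n_k\le\ell}}\frac{\max\{0,\alpha_C(2n_1,\ldots,2n_k)\}}{12^{k-1}\cdot\pi^{2n_1+\cdots+2n_k-2k-2}\cdot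 2^{\ell-2n_1-\cdots-2n_k}}\le 0.\]
   Context: A kernel is a bounded measurable function $[0,1]^2\to\mathbb{R}$. A tournamenton is a non-negative kernel $W$ with $W(x,y)+W(y,x)=1$ for all $(x,y)$. For an oriented graph $H$ and a kernel $U$, $t(H,U)=\int_{[0,1]^{V(H)}}\prod_{vw\in E(H)}U(x_v,x_w)\,\mathrm{d}x_{V(H)}$; $\|H\|$ is the number of edges of $H$. $H$ is quasirandom-forcing if every tournamenton $W$ with $t(H,W)=2^{-\|H\|}$ equals $1/2$ almost everywhere. For a positive integer $n$, $Q_{2n}$ is the orientation of the path with $2n$ edges in which all edges are oriented away from the central vertex towards the two end vertices. For $n\ge 2$, $D_{2n}$ is the orientation of the cycle with $2n$ vertices obtained by choosing two opposite vertices and orienting all edges in the direction from one of them to the other. For an oriented cycle $C$ and $F\subseteq E(C)$, $C\langle F\rangle$ is the spanning subgraph of $C$ with edge set $F$. For positive integers $n_1,\ldots,n_k$, $\alpha_C(2n_1,\ldots,2n_k)$ is the number of sets $F\subseteq E(C)$ such that $C\langle F\rangle$ can be obtained from the vertex-disjoint union $Q_{2n_1}\cup\cdots\cup Q_{2n_k}$ by reversing an even number of edges and possibly adding isolated vertices, minus the number of sets $F\subseteq E(C)$ such that $C\langle F\rangle$ can be obtained from $Q_{2n_1}\cup\cdots\cup Q_{2n_k}$ by reversing an odd number of edges and possibly adding isolated vertices. If $C$ has even length $\ell$, $\gamma_C=+1$ if $C$ can be obtained from $D_\ell$ by reversing an even number of edges, and $\gamma_C=-1$ otherwise. *)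

(* Defs.v *)
(* MathComp / MathComp-Analysis. *)
From HB Require Import structures.
From mathcomp Require Import all_boot all_order all_algebra.
From mathcomp Require Import zify.
From mathcomp Require Import all_classical all_reals all_analysis.

Set Implicit Arguments.
Unset Strict Implicit.
Unset Printing Implicit Defensive.

Import Order.TTheory GRing.Theory Num.Theory.
Import numFieldNormedType.Exports.

Local Open Scope classical_set_scope.
Local Open Scope ring_scope.

(* Taking x = y in [arc_asym] also excludes loops. *)
Record ograph := OGraph {
  vertex :> finType;
  arc : rel vertex;
  arc_asym : forall x y, arc x y -> ~~ arc y x
}.

Definition arcs (H : ograph) : {set H * H} := [set p | arc p.1 p.2]%SET.

Definition isomorphic (G H : ograph) : Prop :=
  exists2 f : G -> H, bijective f & forall x y, arc (f x) (f y) = arc x y.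

Section Constructions.

Definition reverse_rel (H : ograph) (S : {set H * H}) : rel H :=
  fun x y => arc x y && ((x, y) \notin S) || arc y x && ((y, x) \in S).

Fact reverse_asym (H : ograph) (S : {set H * H}) (x y : H) :
  reverse_rel S x y -> ~~ reverse_rel S y x.
Proof.
rewrite /reverse_rel; have := @arc_asym H x y; have := @arc_asym H y x.
by case: (arc x y); case: (arc y x); do 2?case: (_ \in S) => //=;
  do ?move=> /(_ isT).
Qed.

Definition reverse (H : ograph) (S : {set H * H}) : ograph :=
  OGraph (@reverse_asym H S).

Definition spanning_rel (H : ograph) (F : {set H * H}) : rel H :=
  fun x y => arc x y && ((x, y) \in F).

Fact spanning_asym (H : ograph) (F : {set H * H}) (x y : H) :
  spanning_rel F x y -> ~~ spanning_rel F y x.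
Proof.
by case/andP=> axy _; rewrite negb_and (arc_asym axy).
Qed.

Definition spanning (H : ograph) (F : {set H * H}) : ograph :=
  OGraph (@spanning_asym H F).

Definition dunion_rel (G H : ograph) : rel (G + H)%type := fun u v =>
  match u, v with
  | inl x, inl y => arc x y
  | inr x, inr y => arc x y
  | _, _ => false
  end.

Fact dunion_asym (G H : ograph) (u v : G + H) :
  dunion_rel u v -> ~~ dunion_rel v u.
Proof. by case: u v => u [] v //=; exact: arc_asym. Qed.

Definition dunion (G H : ograph) : ograph := OGraph (@dunion_asym G H).

Fact edgeless_asym m (x y : 'I_m) : false -> ~~ false.
Proof. by []. Qed.

Definition edgeless (m : nat) : ograph := OGraph (@edgeless_asym m).

(* [Qpath n] is Q_{2n}: the path 0, 1, ..., 2n, whose central vertex is n. *)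
Definition Qpath_rel (n : nat) : rel 'I_(n.*2.+1) := fun i j =>
  (n <= i)%N && (j == i.+1 :> nat) || (i <= n)%N && (i == j.+1 :> nat).

Fact Qpath_asym n (i j : 'I_(n.*2.+1)) : Qpath_rel i j -> ~~ Qpath_rel j i.
Proof. by rewrite /Qpath_rel; lia. Qed.

Definition Qpath (n : nat) : ograph := OGraph (@Qpath_asym n).

(* [Dcycle n] is D_{2n}: the cycle 0, 1, ..., 2n - 1, 0, with the two directed
   paths 0 -> 1 -> ... -> n and 0 -> 2n - 1 -> 2n - 2 -> ... -> n. *)
Definition Dcycle_rel (n : nat) : rel 'I_(n.*2) := fun i j =>
  [|| (i < n)%N && (j == i.+1 :> nat),
      (n <= j)%N && (i == j.+1 :> nat)
    | (i == 0 :> nat) && (j == n.*2.-1 :> nat)].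

Fact Dcycle_asym n (i j : 'I_(n.*2)) : Dcycle_rel i j -> ~~ Dcycle_rel j i.
Proof.
rewrite /Dcycle_rel; have := ltn_ord i; have := ltn_ord j; lia.
Qed.

Definition Dcycle (n : nat) : ograph := OGraph (@Dcycle_asym n).

End Constructions.

Definition cycle_orientation (C : ograph) (l : nat) : Prop :=
  (2 < l)%N /\
  exists2 f : 'I_l -> C, bijective f &
    forall i j, arc (f i) (f j) || arc (f j) (f i) =
      (j == ordS i) || (i == ordS j).

(* The boolean [b] is the parity of the number of reversed edges. *)
Definition reversal_of (H : ograph) (b : bool) (G : ograph) : Prop :=
  exists S : {set H * H},
    [/\ S \subset arcs H, odd #|S| = b & isomorphic G (reverse S)].

Definition reversal_plus_isolated (H : ograph) (b : bool) (G : ograph) : Prop :=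
  exists (S : {set H * H}) (m : nat),
    [/\ S \subset arcs H, odd #|S| = b &
        isomorphic G (dunion (reverse S) (edgeless m))].

Definition Qunion (ns : seq nat) : ograph :=
  foldr dunion (edgeless 0) [seq Qpath n | n <- ns].

Definition alpha_count (C : ograph) (ns : seq nat) (b : bool) : nat :=
  #|[set F : {set C * C} | (F \subset arcs C) &&
      `[< reversal_plus_isolated (Qunion ns) b (spanning F) >] ]%SET|.

(* The arguments are the half-lengths:
   [alpha C [:: n_1; ...; n_k]] is alpha_C(2n_1, ..., 2n_k). *)
Definition alpha (C : ograph) (ns : seq nat) : int :=
  (alpha_count C ns false)%:Z - (alpha_count C ns true)%:Z.

(* Meaningful when [C] is an orientation of a cycle of even length [#|C|]. *)
Definition gamma (C : ograph) : int :=
  if `[< reversal_of (Dcycle #|C|./2) false C >] then 1 else -1.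

Section Densities.
Context {R : realType}.

Definition unit_square : set (R * R) := `[0, 1]%classic `*` `[0, 1]%classic.

(* A kernel is represented by a function on R * R of which only the values on
   the unit square matter. *)
Definition is_kernel (U : R * R -> R) : Prop :=
  measurable_fun unit_square U /\
  exists M : R, forall p, unit_square p -> `|U p| <= M.

Definition tournamenton (W : R * R -> R) : Prop :=
  [/\ is_kernel W,
      forall p, unit_square p -> 0 <= W p &
      forall x y, unit_square (x, y) -> W (x, y) + W (y, x) = 1].

Definition tuple_cons (n : nat)
    (p : measurableTypeR R * n.-tuple (measurableTypeR R)) :
    n.+1.-tuple (measurableTypeR R) :=
  [tuple of p.1 :: p.2].

Fact measurable_tuple_cons n : measurable_fun setT (@tuple_cons n).
Proof. exact: measurable_cons. Qed.

HB.instance Definition _ n :=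
  isMeasurableFun.Build _ _ _ _ (@tuple_cons n) (@measurable_tuple_cons n).

(* The n-fold product of the uniform probability on [0, 1] (Lebesgue measure
   restricted to [0, 1]), that is, Lebesgue measure restricted to [0, 1]^n. *)
Fixpoint cube_measure (n : nat) :
    probability (n.-tuple (measurableTypeR R)) R :=
  match n with
  | 0 => \d_[tuple]
  | m.+1 =>
      distribution (uniform_prob (@ltr01 R) \x cube_measure m)%E (@tuple_cons m)
  end.

Definition unit_cube (n : nat) : set (n.-tuple (measurableTypeR R)) :=
  [set x | forall i, 0 <= (tnth x i : R) <= 1].

Definition density (H : ograph) (U : R * R -> R) : R :=
  (\int[cube_measure #|H|]_(x in @unit_cube #|H|)
     \prod_(p in arcs H) U (tnth x (enum_rank p.1), tnth x (enum_rank p.2)))%R.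

End Densities.

Definition quasirandom_forcing (R : realType) (H : ograph) : Prop :=
  forall W : R * R -> R, tournamenton W ->
    density H W = 2 ^- #|arcs H| ->
    {ae (@lebesgue_measure R \x @lebesgue_measure R)%E,
      forall p, unit_square p -> W p = 1 / 2}.

(* Main.v *)
Require Import Defs.
From HB Require Import structures.
From mathcomp Require Import all_boot all_order all_algebra.
From mathcomp Require Import all_classical all_reals all_analysis.
From mathcomp Require Import measurable_realfun.
From mathcomp Require Import zify ring lra.

(* Write W = 1/2 + U with U antisymmetric and |U| <= 1/2, let A be the integral
   operator of U and q_n = ||A^n 1||^2. Expanding t(C, W) over the sets F of arcs,
   a proper F is a forest of paths: it contributes 0 if some path is odd, and
   +- q_{n_1} ... q_{n_k} 2^-(l - |F|) if the paths have lengths 2 n_1, ..., 2 n_k.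
   The full set contributes gamma_C ||A^(l/2)||_HS^2. Since q_1 <= 1/12 and
   q_{n+1} <= q_n / pi^2, the two assumptions make gamma_C times the sum of the
   other terms nonnegative, so t(C, W) = 2^-l forces A^(l/2) = 0, hence U = 0.

   The bound ||A|| <= 1/pi behind q_{n+1} <= q_n / pi^2 comes from
   |<A f, g>| <= 1/4 int int |f(x) g(y) - f(y) g(x)|: writing (f, g) in polar
   coordinates turns the integrand into r(x) r(y) |sin (t(x) - t(y))|, and every
   nonconstant Fourier coefficient of |sin| is negative, so that only the mean 2/pi
   contributes to the upper bound.

   The class of F is recovered from its weighted numbers of homomorphisms to
   two-vertex targets: a symmetric one detects the lengths of the paths, and an
   antisymmetric one the parity of the number of reversed arcs. *)

Set Implicit Arguments.
Unset Strict Implicit.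
Unset Printing Implicit Defensive.

Import Order.TTheory GRing.Theory Num.Theory.
Import numFieldNormedType.Exports.

Local Open Scope ring_scope.

(** * Bounded measurable functions and their expectations *)

Section BoundedExpectation.
Local Open Scope classical_set_scope.
Context {R : realType}.

(** The two assumptions owe their shape to keeping one factor of each product q_{n_1} ... q_{n_k}:
    q_1 if all parts are 1, and q_2 otherwise. The other factors are only bounded from above, so a
    term may be estimated only when its coefficient has the unfavourable sign, hence min and max;
    the terms of alpha(2) and alpha(4) consist of the kept factor alone and enter exactly. An odd
    path vanishes because <f, A f> = 0 for antisymmetric U. The full cycle gives the trace of A^l, a
    squared norm up to sign because the kernel of A^(l/2) is symmetric or antisymmetric; no spectral
    theory is needed. The combinatorial obstacle is that alpha is defined by the existence of
    isomorphisms and reversed sets, so it must be shown that F lies in at most one class, with one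
    parity. The parity is well defined because reading a path of even length from its other end
    preserves the parity of its number of backward arcs. Isomorphisms are never analysed for this:
    invariants are evaluated on both sides. *)

Definition bmfun d (T : measurableType d) (f : T -> R) :=
  measurable_fun setT f /\ exists M : R, forall x, `|f x| <= M.

Lemma bmfun_cst d (T : measurableType d) (c : R) : bmfun (fun _ : T => c).
Proof. by split; [exact: measurable_cst|exists `|c|]. Qed.

Lemma bmfunD d (T : measurableType d) (f g : T -> R) :
  bmfun f -> bmfun g -> bmfun (fun x => f x + g x).
Proof.
move=> [mf [M fM]] [mg [N gN]]; split; first exact: measurable_funD.
by exists (M + N) => x; apply: le_trans (ler_normD _ _) _; exact: lerD.
Qed.

Lemma bmfunM d (T : measurableType d) (f g : T -> R) :
  bmfun f -> bmfun g -> bmfun (fun x => f x * g x).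
Proof.
move=> [mf [M fM]] [mg [N gN]]; split; first exact: measurable_funM.
by exists (M * N) => x; rewrite normrM ler_pM.
Qed.

Lemma bmfunZ d (T : measurableType d) (c : R) (f : T -> R) :
  bmfun f -> bmfun (fun x => c * f x).
Proof. by move=> bf; apply: bmfunM => //; exact: bmfun_cst. Qed.

Lemma bmfunN d (T : measurableType d) (f : T -> R) :
  bmfun f -> bmfun (fun x => - f x).
Proof.
move=> /(bmfunZ (-1)); congr bmfun; apply/funext => x; exact: mulN1r.
Qed.

Lemma bmfunB d (T : measurableType d) (f g : T -> R) :
  bmfun f -> bmfun g -> bmfun (fun x => f x - g x).
Proof. by move=> bf bg; apply: bmfunD => //; exact: bmfunN. Qed.

Lemma bmfun_norm d (T : measurableType d) (f : T -> R) :
  bmfun f -> bmfun (fun x => `|f x|).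
Proof.
move=> [mf [M fM]]; split; first exact: measurableT_comp.
by exists M => x; rewrite normr_id.
Qed.

Lemma bmfun_sum d (T : measurableType d) I (r : seq I) (F : I -> T -> R) :
  (forall i, bmfun (F i)) -> bmfun (fun x => \sum_(i <- r) F i x).
Proof.
move=> bF; elim: r => [|i r IHr].
  have -> : (fun x => \sum_(i <- [::]) F i x) = (fun=> 0).
    by apply/funext => x; rewrite big_nil.
  exact: bmfun_cst.
have -> : (fun x => \sum_(j <- i :: r) F j x) =
          (fun x => F i x + \sum_(j <- r) F j x).
  by apply/funext => x; rewrite big_cons.
exact: bmfunD.
Qed.

Lemma bmfun_prod d (T : measurableType d) I (r : seq I) (P : pred I)
    (F : I -> T -> R) :
  (forall i, bmfun (F i)) -> bmfun (fun x => \prod_(i <- r | P i) F i x).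
Proof.
move=> bF; elim: r => [|i r IHr].
  have -> : (fun x => \prod_(i <- [::] | P i) F i x) = (fun=> 1).
    by apply/funext => x; rewrite big_nil.
  exact: bmfun_cst.
have -> : (fun x => \prod_(j <- i :: r | P j) F j x) =
          (fun x => (if P i then F i x else 1) * \prod_(j <- r | P j) F j x).
  by apply/funext => x; rewrite big_cons; case: (P i); rewrite ?mul1r.
apply: bmfunM; last exact: IHr.
by case: (P i); [exact: bF|exact: bmfun_cst].
Qed.

Lemma bmfun_comp d d' (T : measurableType d) (T' : measurableType d')
    (f : T -> R) (h : T' -> T) :
  measurable_fun setT h -> bmfun f -> bmfun (fun x => f (h x)).
Proof.
move=> mh [mf [M fM]]; split; first exact: (measurableT_comp mf mh).
by exists M.
Qed.

Lemma bmfun_indic d (T : measurableType d) (A : set T) :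
  measurable A -> bmfun (\1_A : T -> R).
Proof.
move=> mA; split; first exact: measurable_indic.
by exists 1 => x; rewrite indicE; case: (_ \in _); rewrite ?normr1 ?normr0.
Qed.

Section Expectation.
Context d (T : measurableType d) (P : probability T R).

Definition Ex (f : T -> R) : R := (\int[P]_x f x)%R.

Lemma bmfun_integrable f : bmfun f -> P.-integrable setT (EFin \o f).
Proof.
move=> [mf [M fM]]; apply: measurable_bounded_integrable => //.
  exact: fin_num_fun_lty.
exists M; split; first exact: num_real.
by move=> x Mx y _ /=; rewrite (le_trans (fM y))// ltW.
Qed.

Lemma ExE f : bmfun f -> (Ex f)%:E = (\int[P]_x (f x)%:E)%E.
Proof.
move=> bf; rewrite fineK//; apply: integrable_fin_num => //.
exact: (bmfun_integrable bf).
Qed.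

Lemma Ex_cst c : Ex (fun=> c) = c.
Proof.
rewrite /Ex Rintegral_cst//.
transitivity (c * fine (1%E : \bar R)); last exact: mulr1.
by congr (_ * fine _); exact: probability_setT.
Qed.

Lemma eq_Ex f g : f =1 g -> Ex f = Ex g.
Proof. by move=> fg; congr Ex; apply/funext. Qed.

Lemma ExD f g : bmfun f -> bmfun g -> Ex (fun x => f x + g x) = Ex f + Ex g.
Proof. by move=> bf bg; apply: RintegralD => //; exact: bmfun_integrable. Qed.

Lemma ExZ c f : bmfun f -> Ex (fun x => c * f x) = c * Ex f.
Proof. by move=> bf; apply: RintegralZl => //; exact: bmfun_integrable. Qed.

Lemma ExZr c f : bmfun f -> Ex (fun x => f x * c) = Ex f * c.
Proof. by move=> bf; apply: RintegralZr => //; exact: bmfun_integrable. Qed.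

Lemma ExB f g : bmfun f -> bmfun g -> Ex (fun x => f x - g x) = Ex f - Ex g.
Proof. by move=> bf bg; apply: RintegralB => //; exact: bmfun_integrable. Qed.

Lemma ExN f : bmfun f -> Ex (fun x => - f x) = - Ex f.
Proof.
move=> bf; rewrite -mulN1r -ExZ//; by apply: eq_Ex => x; rewrite mulN1r.
Qed.

Lemma Ex_sum I (r : seq I) (F : I -> T -> R) : (forall i, bmfun (F i)) ->
  Ex (fun x => \sum_(i <- r) F i x) = \sum_(i <- r) Ex (F i).
Proof.
move=> bF; elim: r => [|i r IHr].
  rewrite big_nil -[RHS](Ex_cst 0); by apply: eq_Ex => x; rewrite big_nil.
rewrite big_cons -IHr -ExD//; last exact: bmfun_sum.
by apply: eq_Ex => x; rewrite big_cons.
Qed.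

Lemma Ex_ge0 f : (forall x, 0 <= f x) -> 0 <= Ex f.
Proof. by move=> f0; apply: Rintegral_ge0. Qed.

Lemma le_Ex f g : bmfun f -> bmfun g -> (forall x, f x <= g x) -> Ex f <= Ex g.
Proof.
move=> bf bg fg; apply: le_Rintegral => //; exact: bmfun_integrable.
Qed.

Lemma Ex_indic A : measurable A -> Ex \1_A = fine (P A).
Proof. by move=> mA; rewrite /Ex /Rintegral integral_indic// setIT. Qed.

(** The variance is nonnegative; this is Cauchy-Schwarz against the constant 1. *)
Lemma sqr_Ex_le f : bmfun f -> Ex f ^+ 2 <= Ex (fun x => f x ^+ 2).
Proof.
move=> bf; set m := Ex f.
have bf2 : bmfun (fun x => f x ^+ 2) by exact: bmfunM.
have : 0 <= Ex (fun x => (f x - m) ^+ 2) by apply: Ex_ge0 => x; exact: sqr_ge0.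
have -> : (fun x => (f x - m) ^+ 2) =
          (fun x => (f x ^+ 2 + (-2 * m) * f x) + m ^+ 2).
  by apply/funext => x; ring.
have b2 : bmfun (fun x => (-2 * m) * f x) by exact: bmfunZ.
rewrite ExD//; [|exact: bmfunD|exact: bmfun_cst].
by rewrite ExD// ExZ// Ex_cst -/m; nra.
Qed.

End Expectation.

Section Product.
Context d1 d2 (T1 : measurableType d1) (T2 : measurableType d2).
Variables (P1 : probability T1 R) (P2 : probability T2 R).
Variables (F : T1 * T2 -> R) (bF : bmfun F).

Lemma bmfun_section1 x : bmfun (fun y => F (x, y)).
Proof. by apply: bmfun_comp bF; exact: measurable_pair1. Qed.

Lemma bmfun_section2 y : bmfun (fun x => F (x, y)).
Proof. by apply: bmfun_comp bF; exact: measurable_pair2. Qed.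

Let normEx_le d (T : measurableType d) (P : probability T R) (g : T -> R) M :
  bmfun g -> (forall x, `|g x| <= M) -> `|Ex P g| <= M.
Proof.
move=> bg gM; rewrite ler_norml -[M in - M](Ex_cst P) -[M in _ && (_ <= M)](Ex_cst P).
rewrite -ExN; last exact: bmfun_cst.
by apply/andP; split; apply: le_Ex => //; do ?exact: bmfun_cst; move=> x;
  move: (gM x); rewrite ler_norml => /andP[].
Qed.

Lemma bmfun_Ex1 : bmfun (fun x => Ex P2 (fun y => F (x, y))).
Proof.
split; last first.
  have [_ [M FM]] := bF; exists M => x.
  by apply: normEx_le => //; exact: bmfun_section1.
apply/measurable_EFinP.
have -> : EFin \o (fun x => Ex P2 (fun y => F (x, y))) =
          (fun x => \int[P2]_y (EFin \o F) (x, y))%E.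
  by apply/funext => x /=; rewrite ExE//; exact: bmfun_section1.
apply: (@measurable_fubini_F _ _ _ _ _ P1 P2 (EFin \o F)).
exact: (bmfun_integrable (P1 \x P2)%E bF).
Qed.

Lemma bmfun_Ex2 : bmfun (fun y => Ex P1 (fun x => F (x, y))).
Proof.
split; last first.
  have [_ [M FM]] := bF; exists M => y.
  by apply: normEx_le => //; exact: bmfun_section2.
apply/measurable_EFinP.
have -> : EFin \o (fun y => Ex P1 (fun x => F (x, y))) =
          (fun y => \int[P1]_x (EFin \o F) (x, y))%E.
  by apply/funext => y /=; rewrite ExE//; exact: bmfun_section2.
apply: (@measurable_fubini_G _ _ _ _ _ P1 P2 (EFin \o F)).
exact: (bmfun_integrable (P1 \x P2)%E bF).
Qed.

Lemma Ex_prod1 :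
  Ex (P1 \x P2)%E F = Ex P1 (fun x => Ex P2 (fun y => F (x, y))).
Proof.
apply: EFin_inj; rewrite !ExE//; last exact: bmfun_Ex1.
rewrite -(@integral12_prod_meas1 _ _ _ _ _ P1 P2 (EFin \o F)); last first.
  exact: (bmfun_integrable (P1 \x P2)%E bF).
by apply: eq_integral => x _ /=; rewrite ExE//; exact: bmfun_section1.
Qed.

Lemma Ex_prod2 :
  Ex (P1 \x P2)%E F = Ex P2 (fun y => Ex P1 (fun x => F (x, y))).
Proof.
apply: EFin_inj; rewrite !ExE//; last exact: bmfun_Ex2.
rewrite -(@integral21_prod_meas1 _ _ _ _ _ P1 P2 (EFin \o F)); last first.
  exact: (bmfun_integrable (P1 \x P2)%E bF).
by apply: eq_integral => x _ /=; rewrite ExE//; exact: bmfun_section2.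
Qed.

Lemma Ex_swap : Ex P1 (fun x => Ex P2 (fun y => F (x, y))) =
  Ex P2 (fun y => Ex P1 (fun x => F (x, y))).
Proof. by rewrite -Ex_prod1 Ex_prod2. Qed.

End Product.

Lemma Ex_distribution d d' (T : measurableType d) (T' : measurableType d')
    (P : probability T R) (X : {RV P >-> T'}) (f : T' -> R) :
  bmfun f -> Ex (distribution P X) f = Ex P (fun x => f (X x)).
Proof.
move=> bf.
have bfX : bmfun (fun x => f (X x)) by apply: bmfun_comp.
apply: EFin_inj; rewrite !ExE// integral_distribution//.
  by apply/measurable_EFinP; case: bf.
exact: (bmfun_integrable P bfX).
Qed.

End BoundedExpectation.

(** * The uniform measure on the cube and permutations of its coordinates *)

Section Cube.
Local Open Scope classical_set_scope.
Context {R : realType}.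

Definition unif : probability (measurableTypeR R) R := uniform_prob (@ltr01 R).

Lemma Ex_cubeS n (F : n.+1.-tuple (measurableTypeR R) -> R) : bmfun F ->
  Ex (cube_measure n.+1) F =
  Ex unif (fun x => Ex (cube_measure n) (fun t => F (tuple_cons (x, t)))).
Proof.
move=> bF; rewrite /= Ex_distribution// Ex_prod1//.
by apply: bmfun_comp bF; exact: measurable_tuple_cons.
Qed.

Definition box n (B : 'I_n -> set R) : set (n.-tuple (measurableTypeR R)) :=
  [set t | forall i, B i (tnth t i)].

Lemma measurable_box n (B : 'I_n -> set R) :
  (forall i, measurable (B i : set (measurableTypeR R))) -> measurable (box B).
Proof.
move=> mB.
have -> : box B = \bigcap_(i in setT)
    ((fun t : n.-tuple (measurableTypeR R) => tnth t i) @^-1` B i).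
  by apply/seteqP; split=> t /=; [move=> h i _|move=> h i]; apply: h.
apply: fin_bigcap_measurable; first exact: finite_finset.
by move=> i _; rewrite -[X in measurable X]setTI; apply: measurable_tnth.
Qed.

Lemma cube_measure_box n (B : 'I_n -> set R) :
  (forall i, measurable (B i : set (measurableTypeR R))) ->
  cube_measure n (box B) = (\prod_(i < n) unif (B i))%E.
Proof.
elim: n B => [|n IHn] B mB.
  rewrite big_ord0 /=.
  have -> : box B = setT by apply/seteqP; split=> // t _ [].
  exact: probability_setT.
rewrite big_ord_recl -IHn //=.
rewrite /distribution /pushforward /=.
have -> : @tuple_cons R n @^-1` box B =
    (B ord0 : set (measurableTypeR R)) `*` box (fun i => B (lift ord0 i)).
  apply/seteqP; split=> [[x t] h|[x t] [h1 h2] i] /=.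
    by split=> [|i] /=; [have := h ord0|have := h (lift ord0 i)];
      rewrite /= ?tnth0 ?tnthS.
  by case: (unliftP ord0 i) => [j ->|->]; rewrite ?tnth0 ?tnthS //; apply: h2.
by rewrite product_measure1E//; exact: measurable_box.
Qed.

Definition tuple_perm n (s : 'I_n -> 'I_n) (t : n.-tuple (measurableTypeR R)) :
  n.-tuple (measurableTypeR R) := [tuple tnth t (s i) | i < n].

Lemma measurable_tuple_map n m (s : 'I_m -> 'I_n) : measurable_fun setT
  (fun t : n.-tuple (measurableTypeR R) =>
     [tuple tnth t (s i) | i < m] : m.-tuple (measurableTypeR R)).
Proof.
apply/measurable_fun_tnthP => i.
apply: (eq_measurable_fun (fun t => tnth t (s i))) => [t _|].
  by rewrite /= tnth_mktuple.
exact: measurable_tnth.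
Qed.

HB.instance Definition _ n s :=
  isMeasurableFun.Build _ _ _ _ (@tuple_perm n s) (measurable_tuple_map s).

Lemma box_generates n : (@measurable _ (n.-tuple (measurableTypeR R))) =
  <<s [set A | exists2 B : 'I_n -> set R,
    (forall i, measurable (B i : set (measurableTypeR R))) & A = box B] >>.
Proof.
apply/seteqP; split; last first.
  apply: smallest_sub; first exact: sigma_algebra_measurable.
  by move=> _ [B mB ->]; exact: measurable_box.
apply: smallest_sub; first exact: smallest_sigma_algebra.
move=> A; rewrite -bigcup_seq /= => -[i _ [B mB <-]].
(* The preimage of [B] under one coordinate is a box whose other sides are everything. *)
apply: sub_sigma_algebra; exists (fun j => if j == i then B else setT).
  by move=> j; case: eqP.
apply/seteqP; split=> t /=.
  by move=> [_ Bt] j; case: eqP => // ->.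
by move=> /(_ i); rewrite eqxx; split.
Qed.

(** [cube_measure] is built one coordinate at a time, so its symmetry is not definitional. Boxes
    form a generating family closed under intersection, and permuting the sides of a box keeps the
    product of their measures. *)
Lemma distribution_tuple_perm n (s : 'I_n -> 'I_n) (A : set (n.-tuple (measurableTypeR R))) :
  injective s -> measurable A ->
  distribution (cube_measure n) (@tuple_perm n s) A = cube_measure n A.
Proof.
move=> s_inj mA.
apply: (measure_unique _ (fun _ => setT) (box_generates n)) => //.
- move=> _ _ [B mB ->] [B' mB' ->]; exists (fun i => B i `&` B' i).
    by move=> i; exact: measurableI.
  apply/seteqP; split=> t /=; first by move=> [h h'] i; split.
  by move=> h; split=> i; case: (h i).
- move=> _; exists (fun=> setT) => //; by apply/seteqP; split.
- by rewrite bigcup_const.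
- move=> _ [B mB ->]; rewrite [RHS](cube_measure_box mB).
  pose s' := invF s_inj.
  transitivity (cube_measure n (box (fun i => B (s' i)))).
    congr (cube_measure n _); apply/seteqP; split=> t /= h i.
      by have := h (s' i); rewrite /= tnth_mktuple f_invF.
    by rewrite tnth_mktuple; have := h (s i); rewrite /s' invF_f.
  rewrite cube_measure_box// [RHS](reindex s')//.
  by exists s => i _; [exact: f_invF|exact: invF_f].
- by move=> _; apply: fin_num_fun_lty.
Qed.

(** [density] numbers the vertices by [enum_rank], whereas the transfer argument needs them in
    cyclic order. *)
Lemma Ex_cube_relabel l n (s : 'I_l -> 'I_n)
    (F : l.-tuple (measurableTypeR R) -> R) : bijective s -> bmfun F ->
  Ex (cube_measure n) (fun t => F [tuple tnth t (s i) | i < l]) =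
  Ex (cube_measure l) F.
Proof.
move=> bs bF; have := bij_eq_card bs; rewrite !card_ord => ln.
subst n; rewrite -(@Ex_distribution _ _ _ _ _ (cube_measure l) (@tuple_perm l s))//.
rewrite /Ex /Rintegral; congr fine; apply: eq_measure_integral => A mA _.
by apply: distribution_tuple_perm => //; exact: bij_inj.
Qed.

Lemma unif_unit_interval : unif `[0, 1] = 1%E.
Proof. by rewrite /unif /= /uniform_prob integral_uniform_pdf1. Qed.

Lemma cube_measure_unit_cube n : cube_measure n (@unit_cube R n) = 1%E.
Proof.
have -> : @unit_cube R n = box (fun=> `[0, 1]).
  by apply/seteqP; split=> t /= h i; have := h i; rewrite /= ?in_itv.
rewrite (@cube_measure_box n (fun=> `[0, 1])); last first.
  by move=> i; exact: measurable_itv.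
by rewrite big1// => i _; exact: unif_unit_interval.
Qed.

Lemma measurable_unit_cube n : measurable (@unit_cube R n).
Proof.
have -> : @unit_cube R n = box (fun=> `[0, 1]).
  by apply/seteqP; split=> t /= h i; have := h i; rewrite /= ?in_itv.
by apply: measurable_box => i; exact: measurable_itv.
Qed.

Lemma Rintegral_unit_cube n (F : n.-tuple (measurableTypeR R) -> R) : bmfun F ->
  (\int[cube_measure n]_(x in @unit_cube R n) F x)%R = Ex (cube_measure n) F.
Proof.
move=> bF; rewrite /Ex /Rintegral; congr fine.
have mu := @measurable_unit_cube n.
rewrite [RHS](@negligible_integral _ _ _ _ _ (~` @unit_cube R n)) => //.
- by rewrite setTD setCK.
- exact: measurableC.
- exact: (bmfun_integrable (cube_measure n) bF).
- apply: etrans (probability_setC (cube_measure n) mu) _.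
  by have -> := cube_measure_unit_cube n; rewrite subee.
Qed.

End Cube.

(** * Powers of an antisymmetric integral operator *)

Section AntisymmetricOperator.
Local Open Scope classical_set_scope.
Context {R : realType}.
Local Notation I := (measurableTypeR R).
Local Notation E := (Ex (@unif R)).

Definition kernel_op (U : I * I -> R) (f : I -> R) : I -> R :=
  fun x => E (fun y => U (x, y) * f y).

Fixpoint kernel_pow (U : I * I -> R) (k : nat) : I * I -> R :=
  if k is j.+1 then fun p => E (fun z => U (p.1, z) * kernel_pow U j (z, p.2))
  else U.

Definition walk (U : I * I -> R) (k : nat) : R :=
  E (iter k (kernel_op U) (fun=> 1)).

Definition qval (U : I * I -> R) (n : nat) : R :=
  E (fun x => iter n (kernel_op U) (fun=> 1) x ^+ 2).

Variable U : I * I -> R.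
Hypothesis bU : bmfun U.

Lemma bmfun_fst (f : I -> R) : bmfun f -> bmfun (fun p : I * I => f p.1).
Proof. by apply: bmfun_comp; exact: measurable_fst. Qed.

Lemma bmfun_snd (f : I -> R) : bmfun f -> bmfun (fun p : I * I => f p.2).
Proof. by apply: bmfun_comp; exact: measurable_snd. Qed.

Lemma bmfun_swap (F : I * I -> R) : bmfun F -> bmfun (fun p => F (p.2, p.1)).
Proof. by apply: bmfun_comp; exact: measurable_swap. Qed.

Lemma bmfun_kernel_op f : bmfun f -> bmfun (kernel_op U f).
Proof.
move=> bf; have b := bmfunM bU (bmfun_snd bf).
exact: (bmfun_Ex1 (@unif R) (@unif R) b).
Qed.

Lemma bmfun_iter_op k f : bmfun f -> bmfun (iter k (kernel_op U) f).
Proof. by move=> bf; elim: k => //= k IHk; exact: bmfun_kernel_op. Qed.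

Lemma bmfun_kernel_pow k : bmfun (kernel_pow U k).
Proof.
elim: k => //= k IHk.
pose F (q : (I * I) * I) := U (q.1.1, q.2) * kernel_pow U k (q.2, q.1.2).
have bF : bmfun F.
  have m11 : measurable_fun setT (fun q : (I * I) * I => q.1.1).
    by apply: measurableT_comp => //.
  have m12 : measurable_fun setT (fun q : (I * I) * I => q.1.2).
    by apply: measurableT_comp => //.
  apply: bmfunM.
    apply: (@bmfun_comp _ _ _ _ _ U (fun q : (I * I) * I => (q.1.1, q.2))) => //.
    exact: measurable_fun_pair.
  apply: (@bmfun_comp _ _ _ _ _ _ (fun q : (I * I) * I => (q.2, q.1.2))) => //.
  exact: measurable_fun_pair.
exact: (bmfun_Ex1 (@unif R \x @unif R)%E (@unif R) bF).
Qed.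

Lemma bmfun_pow1 k x : bmfun (fun y => kernel_pow U k (x, y)).
Proof. exact: (bmfun_section1 (bmfun_kernel_pow k)). Qed.

Lemma bmfun_pow2 k y : bmfun (fun x => kernel_pow U k (x, y)).
Proof. exact: (bmfun_section2 (bmfun_kernel_pow k)). Qed.

Lemma kernel_pow_comp a b x y :
  E (fun z => kernel_pow U a (x, z) * kernel_pow U b (z, y)) =
  kernel_pow U (a + b).+1 (x, y).
Proof.
elim: a x => [|a IHa] x //=.
transitivity (E (fun z => E (fun w =>
    U (x, w) * kernel_pow U a (w, z) * kernel_pow U b (z, y)))).
  apply: eq_Ex => z; rewrite -ExZr//.
  by apply: bmfunM; [exact: (bmfun_pow1 0)|exact: bmfun_pow2].
rewrite (@Ex_swap _ _ _ _ _ _ _ (fun p : I * I =>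
  U (x, p.2) * kernel_pow U a (p.2, p.1) * kernel_pow U b (p.1, y))); last first.
  apply: bmfunM; last by apply: (@bmfun_fst (fun z => kernel_pow U b (z, y))); exact: bmfun_pow2.
  apply: bmfunM; first by apply: (@bmfun_snd (fun z => U (x, z))); exact: (bmfun_pow1 0).
  exact: (bmfun_swap (bmfun_kernel_pow a)).
apply: eq_Ex => w; transitivity (U (x, w) * kernel_pow U (a + b).+1 (w, y)) => //.
rewrite -IHa -ExZ; first by apply: eq_Ex => z; rewrite mulrA.
by apply: bmfunM; [exact: bmfun_pow1|exact: bmfun_pow2].
Qed.

Lemma iter_op_section k y x :
  iter k (kernel_op U) (fun z => U (z, y)) x = kernel_pow U k (x, y).
Proof. by elim: k x => //= k IHk x; apply: eq_Ex => z; rewrite IHk. Qed.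

Lemma iter_op_pow k f x : bmfun f ->
  iter k.+1 (kernel_op U) f x = E (fun y => kernel_pow U k (x, y) * f y).
Proof.
move=> bf; elim: k x => [|k IHk] x //.
rewrite iterS [LHS]/kernel_op.
transitivity (E (fun z => E (fun y => U (x, z) * kernel_pow U k (z, y) * f y))).
  apply: eq_Ex => z; rewrite IHk -ExZ//.
    by apply: eq_Ex => y; rewrite mulrA.
  by apply: bmfunM => //; exact: bmfun_pow1.
rewrite (@Ex_swap _ _ _ _ _ _ _ (fun p : I * I =>
  U (x, p.1) * kernel_pow U k p * f p.2)) /=; last first.
  apply: bmfunM; last exact: bmfun_snd.
  apply: bmfunM; last exact: bmfun_kernel_pow.
  by apply: (@bmfun_fst (fun z => U (x, z))); exact: (bmfun_pow1 0).
apply: eq_Ex => y; rewrite ExZr//.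
by apply: bmfunM; [exact: (bmfun_pow1 0)|exact: bmfun_pow2].
Qed.

Lemma Ex_op_mul f g : bmfun f -> bmfun g ->
  E (fun x => g x * kernel_op U f x) =
  Ex (@unif R \x @unif R)%E (fun p => U p * g p.1 * f p.2).
Proof.
move=> bf bg; rewrite Ex_prod1 /=; last first.
  by apply: bmfunM; [apply: bmfunM|]; [|exact: bmfun_fst|exact: bmfun_snd].
apply: eq_Ex => x; rewrite -ExZ.
  by apply: eq_Ex => y; rewrite mulrA (mulrC (g x)).
by apply: bmfunM => //; exact: (bmfun_pow1 0).
Qed.

Hypothesis aU : forall x y, U (y, x) = - U (x, y).

Lemma kernel_pow_swap k x y :
  kernel_pow U k (y, x) = (-1) ^+ k.+1 * kernel_pow U k (x, y).
Proof.
elim: k x y => [|k IHk] x y; first by rewrite expr1 mulN1r /= aU.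
have -> : kernel_pow U k.+1 (x, y) = E (fun z => kernel_pow U k (x, z) * U (z, y)).
  by rewrite -[RHS]/(E (fun z => _ * kernel_pow U 0 (z, y))) kernel_pow_comp addn0.
rewrite -ExZ; last by apply: bmfunM; [exact: bmfun_pow1|exact: (bmfun_pow2 0)].
transitivity (E (fun z => U (y, z) * kernel_pow U k (z, x))) => //.
apply: eq_Ex => z; rewrite (IHk x z) (aU z y) (exprS _ k.+1);
  move: (U (z, y)) (kernel_pow U k (x, z)) ((-1) ^+ k.+1) => a b c; ring.
Qed.

(** The left side is the trace of A^(2a+2), the double integral of K(x,z) K(z,x) for the kernel K of
    A^(a+1), and swapping the arguments of K costs (-1)^(a+1). *)
Lemma trace_kernel_pow a :
  E (fun x => kernel_pow U (a + a).+1 (x, x)) =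
  (-1) ^+ a.+1 * Ex (@unif R \x @unif R)%E (fun p => kernel_pow U a p ^+ 2).
Proof.
have b2 : bmfun (fun p => kernel_pow U a p ^+ 2).
  by apply: bmfunM; exact: bmfun_kernel_pow.
rewrite Ex_prod1// -ExZ; last exact: (bmfun_Ex1 (@unif R) (@unif R) b2).
apply: eq_Ex => x; rewrite -kernel_pow_comp -ExZ; last exact: bmfun_section1 b2 _.
by apply: eq_Ex => z; rewrite (kernel_pow_swap a x z); ring.
Qed.

Lemma kernel_op_adjoint f g : bmfun f -> bmfun g ->
  E (fun x => g x * kernel_op U f x) = - E (fun x => f x * kernel_op U g x).
Proof.
move=> bf bg; rewrite !Ex_op_mul//.
have b1 : bmfun (fun p : I * I => U p * g p.1 * f p.2).
  by apply: bmfunM; [apply: bmfunM|]; [|exact: bmfun_fst|exact: bmfun_snd].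
have b2 : bmfun (fun p : I * I => U p * f p.1 * g p.2).
  by apply: bmfunM; [apply: bmfunM|]; [|exact: bmfun_fst|exact: bmfun_snd].
rewrite -ExN// Ex_prod1// Ex_prod2; last exact: bmfunN.
by apply: eq_Ex => x; apply: eq_Ex => y /=; rewrite aU; ring.
Qed.

Lemma Ex_iter_op a b :
  E (iter (a + b) (kernel_op U) (fun=> 1)) =
  (-1) ^+ a * E (fun x => iter a (kernel_op U) (fun=> 1) x *
                          iter b (kernel_op U) (fun=> 1) x).
Proof.
have b1 : bmfun (fun _ : I => 1 : R) by exact: bmfun_cst.
elim: a b => [|a IHa] b.
  by rewrite mul1r; apply: eq_Ex => x; rewrite mul1r.
rewrite addSnnS IHa iterS kernel_op_adjoint; try exact: bmfun_iter_op.
rewrite exprS !mulN1r mulrN mulNr; congr (- (_ * _)).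
by apply: eq_Ex => x; rewrite mulrC.
Qed.

Lemma walk_even n : walk U n.*2 = (-1) ^+ n * qval U n.
Proof. by rewrite /walk -addnn Ex_iter_op. Qed.

(** For n = 2j + 1 and f = A^j 1 the walk is <f, A f> up to sign, which skew-adjointness makes equal
    to its own negative. *)
Lemma walk_odd n : odd n -> walk U n = 0.
Proof.
move=> on; have -> : n = (n./2 + n./2.+1)%N by lia.
rewrite /walk Ex_iter_op iterS.
set f := iter _ _ _; have bf : bmfun f by apply: bmfun_iter_op; exact: bmfun_cst.
by rewrite [X in _ * X](_ : _ = 0) ?mulr0//; have := kernel_op_adjoint bf bf; lra.
Qed.

Lemma walk0 : walk U 0 = 1.
Proof. exact: Ex_cst. Qed.

Lemma qval_ge0 n : 0 <= qval U n.
Proof. by apply: Ex_ge0 => x; exact: sqr_ge0. Qed.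

Let sq_null f g : bmfun f -> bmfun g -> E (fun x => f x ^+ 2) = 0 ->
  E (fun x => g x * f x) = 0.
Proof.
move=> bf bg f0.
have bgf : bmfun (fun x => g x * f x) by exact: bmfunM.
have [_ [M gM]] := bg.
have := sqr_Ex_le (@unif R) bgf => h.
have : E (fun x => (g x * f x) ^+ 2) <= M ^+ 2 * E (fun x => f x ^+ 2).
  rewrite -ExZ; last exact: bmfunM.
  apply: le_Ex; [exact: bmfunM|by apply: bmfunZ; exact: bmfunM|move=> x].
  rewrite exprMn ler_wpM2r ?sqr_ge0// -real_normK ?num_real//.
  by rewrite lerXn2r ?nnegrE ?normr_ge0// (le_trans _ (gM x)).
rewrite f0 mulr0 => h'; apply/eqP; rewrite -sqrf_eq0 eq_le sqr_ge0 andbT.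
exact: le_trans h h'.
Qed.

(* ||A^k f||^2 = - <A^(k-1) f, A^(k+1) f>, so the vanishing of a power of A
   descends to A itself. *)
Lemma kernel_pow_null a :
  Ex (@unif R \x @unif R)%E (fun p => kernel_pow U a p ^+ 2) = 0 ->
  forall f g, bmfun f -> bmfun g ->
  Ex (@unif R \x @unif R)%E (fun p => U p * g p.1 * f p.2) = 0.
Proof.
move=> K0 f g bf bg; rewrite -Ex_op_mul//.
apply: sq_null => //; first exact: bmfun_kernel_op.
have b2 : bmfun (fun p => kernel_pow U a p ^+ 2).
  by apply: bmfunM; exact: bmfun_kernel_pow.
(* The kernel of A^(a+1) is null in L^2 and f is bounded by M, so Jensen in the inner variable makes
   A^(a+1) f null. *)
have : E (fun x => iter a.+1 (kernel_op U) f x ^+ 2) = 0.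
  apply/eqP; rewrite eq_le (Ex_ge0 _ (fun=> sqr_ge0 _)) andbT.
  have [_ [M fM]] := bf.
  apply: (@le_trans _ _ (M ^+ 2 * Ex (@unif R \x @unif R)%E (fun p => kernel_pow U a p ^+ 2))); last by rewrite K0 mulr0.
  rewrite Ex_prod1// -ExZ; last exact: (bmfun_Ex1 (@unif R) (@unif R) b2).
  have bi := bmfun_iter_op a.+1 bf.
  apply: le_Ex; first exact: bmfunM.
    by apply: bmfunZ; exact: (bmfun_Ex1 (@unif R) (@unif R) b2).
  move=> x; rewrite iter_op_pow//.
  have bKf : bmfun (fun y => kernel_pow U a (x, y) * f y).
    by apply: bmfunM => //; exact: bmfun_pow1.
  apply: le_trans (sqr_Ex_le _ bKf) _.
  rewrite -ExZ; last exact: bmfun_section1 b2 _.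
  apply: le_Ex; [exact: bmfunM|by apply: bmfunZ; exact: (bmfun_section1 b2)|move=> y].
  rewrite exprMn mulrC ler_wpM2r ?sqr_ge0// -real_normK ?num_real//.
  by rewrite lerXn2r ?nnegrE ?normr_ge0// (le_trans _ (fM y)).
elim: a {K0 b2} => [//|a IHa] h; apply: IHa.
have bi k := bmfun_iter_op k bf.
transitivity (E (fun x => iter a.+1 (kernel_op U) f x * kernel_op U (iter a (kernel_op U) f) x)).
  by apply: eq_Ex => x; rewrite expr2.
rewrite kernel_op_adjoint// -iterS.
by rewrite (sq_null (bi a.+2) (bi a) h) oppr0.
Qed.

Hypothesis hU : forall p, `|U p| <= 1 / 2.

(* Symmetrising over three points: -(ab + bc + ca) <= 1/4 for a, b, c in
   [-1/2, 1/2]. *)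
Lemma qval1_le : qval U 1 <= 1 / 12.
Proof.
pose d := kernel_op U (fun=> 1).
have b1 : bmfun (fun _ : I => 1 : R) by exact: bmfun_cst.
have bd : bmfun d by exact: bmfun_kernel_op.
pose c (p : I * I) := E (fun z => U (z, p.1) * U (z, p.2)).
have dE x : d x = E (fun y => U (x, y)) by apply: eq_Ex => y; rewrite mulr1.
have bc : bmfun c.
  pose F (q : (I * I) * I) := U (q.2, q.1.1) * U (q.2, q.1.2).
  have bF : bmfun F.
    have m11 : measurable_fun setT (fun q : (I * I) * I => q.1.1).
      by apply: measurableT_comp => //.
    have m12 : measurable_fun setT (fun q : (I * I) * I => q.1.2).
      by apply: measurableT_comp => //.
    apply: bmfunM.
      apply: (@bmfun_comp _ _ _ _ _ U (fun q : (I * I) * I => (q.2, q.1.1))) => //.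
      exact: measurable_fun_pair.
    apply: (@bmfun_comp _ _ _ _ _ _ (fun q : (I * I) * I => (q.2, q.1.2))) => //.
    exact: measurable_fun_pair.
  exact: (bmfun_Ex1 (@unif R \x @unif R)%E (@unif R) bF).
have bUs x : bmfun (fun z => U (x, z)) by exact: (bmfun_pow1 0).
have bUs' x : bmfun (fun z => U (z, x)) by exact: (bmfun_pow2 0).
(* With z as third point, each summand is the product of the two values of U leaving one of x, y, z.
   Averaged over all three points each gives q_1, whence 3 q_1 <= 1/4. *)
have pw x y : U (x, y) * d x + U (y, x) * d y + c (x, y) <= 1 / 4.
  rewrite !dE -!ExZ// -ExD//; try exact: bmfunZ.
  rewrite -ExD//; [|by apply: bmfunD; exact: bmfunZ|exact: bmfunM].
  rewrite -[leRHS](Ex_cst (@unif R)); apply: le_Ex.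
  - by apply: bmfunD; [apply: bmfunD; exact: bmfunZ|exact: bmfunM].
  - exact: bmfun_cst.
  move=> z /=; rewrite (aU x y) (aU x z) (aU y z).
  have := hU (x, y); have := hU (x, z); have := hU (y, z).
  rewrite !ler_norml; set u := U (x, y); set v := U (x, z); set w := U (y, z).
  move=> /andP[w1 w2] /andP[v1 v2] /andP[u1 u2].
  (* The sum is u (v - w) + v w, linear in u: the extreme case is u = 1/2 if w <= v and u = -1/2
     otherwise. *)
  have [s0|/ltW s0] := leP w v.
    have : 0 <= (1 / 2 - u) * (v - w) by apply: mulr_ge0; lra.
    have : 0 <= (1 / 2 - v) * (1 / 2 + w) by apply: mulr_ge0; lra.
    by nra.
  have : 0 <= (1 / 2 + u) * (w - v) by apply: mulr_ge0; lra.
  have : 0 <= (1 / 2 + v) * (1 / 2 - w) by apply: mulr_ge0; lra.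
  by nra.
have bu1 : bmfun (fun p : I * I => U p * d p.1).
  by apply: bmfunM => //; exact: bmfun_fst.
have bu2 : bmfun (fun p : I * I => U (p.2, p.1) * d p.2).
  by apply: bmfunM; [exact: bmfun_swap|exact: bmfun_snd].
pose E2 := Ex (@unif R \x @unif R)%E.
have : E2 (fun p => U p * d p.1 + U (p.2, p.1) * d p.2 + c p) <= 1 / 4.
  rewrite -[leRHS](Ex_cst (@unif R \x @unif R)%E); apply: le_Ex.
  - by apply: bmfunD => //; exact: bmfunD.
  - exact: bmfun_cst.
  - by move=> [x y]; exact: pw.
rewrite /E2 !ExD//; last exact: bmfunD.
have -> : Ex (@unif R \x @unif R)%E (fun p => U p * d p.1) = qval U 1.
  rewrite Ex_prod1//; apply: eq_Ex => x /=.
  by rewrite ExZr// -dE expr2.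
have -> : Ex (@unif R \x @unif R)%E (fun p => U (p.2, p.1) * d p.2) = qval U 1.
  rewrite Ex_prod2//; apply: eq_Ex => x /=.
  by rewrite ExZr// -dE expr2.
have -> : Ex (@unif R \x @unif R)%E c = qval U 1.
  have b3 z : bmfun (fun p : I * I => U (z, p.1) * U (z, p.2)).
    by apply: bmfunM; [exact: (bmfun_fst (bUs z))|exact: (bmfun_snd (bUs z))].
  transitivity (E (fun x => E (fun z => U (z, x) * d z))).
    rewrite (Ex_prod1 _ _ bc); apply: eq_Ex => x.
    rewrite (@Ex_swap _ _ _ _ _ _ _ (fun p : I * I => U (p.2, x) * U (p.2, p.1))) /=.
      by apply: eq_Ex => z; rewrite dE -ExZ.
    apply: bmfunM; last exact: bmfun_swap.
    exact: (bmfun_snd (bUs' x)).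
  rewrite (@Ex_swap _ _ _ _ _ _ _ (fun p : I * I => U (p.2, p.1) * d p.2)) //=.
  by apply: eq_Ex => z; rewrite ExZr// -dE expr2.
by move=> h; lra.
Qed.

End AntisymmetricOperator.

(** * One-sided approximation of |sin| by its Fourier sums *)

Section FourierAbsSin.
Context {R : realType}.
Implicit Types (t : R) (K : nat).

Local Notation freq K := (K.+1.*2%:R : R).
Local Notation coef K := (freq K ^+ 2 - 1).

(* The partial Fourier sums S_K of |sin|, and their antiderivatives. *)
Fixpoint abs_sin_sum K t : R :=
  if K is j.+1 then abs_sin_sum j t - 4 / pi * (cos (freq j * t) / coef j)
  else 2 / pi.

Fixpoint abs_sin_prim K t : R :=
  if K is j.+1 then
    abs_sin_prim j t - 4 / pi * (sin (freq j * t) / (freq j * coef j))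
  else 2 / pi * t.

Lemma coef_gt0 K : 0 < coef K.
Proof.
have : (2 : R) <= freq K by rewrite ler_nat.
by move=> h; nra.
Qed.

Let freqE K : freq K = 2 * K%:R + 2.
Proof. by rewrite -muln2 natrM -natr1; ring. Qed.

Let oddE K : K.*2.+1%:R = 2 * K%:R + 1 :> R.
Proof. by rewrite -natr1 -muln2 natrM; ring. Qed.

Let oddSE K : K.+1.*2.+1%:R = 2 * K%:R + 3 :> R.
Proof. by rewrite oddE -natr1; ring. Qed.

Let nat_ge0 K : 0 <= K%:R :> R. Proof. by []. Qed.

Let pi_neq0 : (pi : R) != 0. Proof. exact: lt0r_neq0 (pi_gt0 R). Qed.

(** The coefficients 1/(4 k^2 - 1) telescope. This value at 0, where |sin| vanishes, becomes the
    error [err K] in all later bounds. *)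
Lemma abs_sin_sum0 K : abs_sin_sum K 0 = 2 / pi / K.*2.+1%:R.
Proof.
elim: K => [|K IHK] /=; first by rewrite divr1.
rewrite IHK mulr0 cos0 oddSE oddE freqE.
have k0 := nat_ge0 K; move: pi_neq0; generalize (pi : R) => p p0.
by field; rewrite p0 /=; do ?[apply/andP; split]; apply/lt0r_neq0; nra.
Qed.

Lemma abs_sin_sumN K t : abs_sin_sum K (- t) = abs_sin_sum K t.
Proof. by elim: K => //= K ->; rewrite mulrN cosN. Qed.

Lemma is_derive_prim K t : is_derive t (1 : R) (abs_sin_prim K) (abs_sin_sum K t).
Proof.
elim: K => [|K IHK] /=.
  by apply: is_derive_eq; rewrite /GRing.scale /=; ring.
have f0 : freq K != 0 by rewrite pnatr_eq0.
have c0 := lt0r_neq0 (coef_gt0 K).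
apply: is_derive_eq; rewrite /GRing.scale /=.
move: pi_neq0; generalize (pi : R) => p p0.
by field; rewrite p0 c0 f0.
Qed.

(* (S_K / sin)' telescopes to a single cosine term. *)
Lemma is_derive_quot K t : sin t != 0 ->
  is_derive t (1 : R) (fun u => abs_sin_sum K u / sin u)
    (- (2 / pi / K.*2.+1%:R) * cos (K.*2.+1%:R * t) / sin t ^+ 2).
Proof.
move=> st; have dV : is_derive t (1 : R) (fun u => (sin u)^-1) (- sin t ^- 2 *: cos t).
  exact: is_deriveV.
elim: K => [|K IHK] /=.
  have -> : (fun u => 2 / pi / sin u) = (2 / pi) *: (fun u : R => (sin u)^-1) by [].
  have -> : 0.*2.+1%:R = 1 :> R by [].
  apply: is_derive_eq; rewrite /GRing.scale /= mul1r.
  by move: pi_neq0; generalize (pi : R) => p p0; field; rewrite p0 st.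
have -> : (fun u => (abs_sin_sum K u - 4 / pi * (cos (freq K * u) / coef K)) / sin u) =
   (fun u => abs_sin_sum K u / sin u) -
   (4 / pi / coef K) *: ((fun u => cos (freq K * u)) * (fun u => (sin u)^-1)).
  by apply/funext => u; rewrite !fctE /GRing.scale /=; ring.
apply: is_derive_eq; rewrite /GRing.scale /=.
have -> : K.+1.*2.+1%:R * t = freq K * t + t by rewrite oddSE freqE; ring.
have -> : K.*2.+1%:R * t = freq K * t - t by rewrite oddE freqE; ring.
rewrite cosB cosD oddSE oddE freqE; have k0 := nat_ge0 K.
move: pi_neq0; generalize (pi : R) => p p0; field; rewrite p0 st /=.
by do ?[apply/andP; split]; apply/lt0r_neq0; nra.
Qed.

Local Notation err K := (2 / pi / K.*2.+1%:R : R).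

Lemma is_derive_cot t : sin t != 0 ->
  is_derive t (1 : R) (fun u => cos u / sin u) (- (sin t ^- 2)).
Proof.
move=> st; have dV : is_derive t (1 : R) (fun u => (sin u)^-1) (- sin t ^- 2 *: cos t).
  exact: is_deriveV.
have -> : (fun u => cos u / sin u) = cos * (fun u : R => (sin u)^-1) by [].
apply: is_derive_eq; rewrite /GRing.scale /=.
have h : cos t ^+ 2 = 1 - sin t ^+ 2 by rewrite -(cos2Dsin2 t); ring.
transitivity (- (cos t ^+ 2) / sin t ^+ 2 - sin t / sin t); first by ring.
by rewrite h; field.
Qed.

Let cos_bound t : -1 <= cos t <= 1.
Proof. by rewrite cos_geN1 cos_le1. Qed.

Let sin_pos t : 0 < t < pi -> 0 < sin t.
Proof. by move=> h; apply: sin_gt0_pi. Qed.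

Lemma homo_of_is_derive (f df : R -> R) (a b : R) :
  (forall x, a <= x <= b -> is_derive x (1 : R) f (df x)) ->
  (forall x, a <= x <= b -> 0 <= df x) -> a <= b -> f a <= f b.
Proof.
move=> fd df0 ab.
have h := @ger0_derive1_ndecr R f a b; apply: h => //.
- move=> x; rewrite in_itv /= => /andP[ax xb].
  by have [] := fd x (_ : a <= x <= b); [rewrite !ltW|].
- move=> x; rewrite in_itv /= => /andP[ax xb].
  have axb : a <= x <= b by rewrite !ltW.
  by rewrite derive1E; have [_ ->] := fd x axb; exact: df0.
- apply: derivable_within_continuous => x; rewrite in_itv /= => axb.
  by have [] := fd x axb.
Qed.

Lemma err_gt0 K : 0 < err K.
Proof. by rewrite !divr_gt0 ?pi_gt0 ?ltr0n. Qed.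

(** The derivative of S_K / sin is at most [err K] / sin^2 in absolute value, and -1 / sin^2 is the
    derivative of cot. Adding [err K] cot therefore makes the quotient decreasing, and subtracting
    it makes it increasing. *)
Lemma quot_decr K a b : 0 < a -> a <= b -> b < pi ->
  abs_sin_sum K b / sin b + err K * (cos b / sin b) <=
  abs_sin_sum K a / sin a + err K * (cos a / sin a).
Proof.
move=> a0 ab bpi.
pose f u := - err K * (cos u / sin u) - abs_sin_sum K u / sin u.
pose df u := err K * (cos (K.*2.+1%:R * u) + 1) / sin u ^+ 2.
suff : f a <= f b by rewrite /f !mulNr -!opprD lerN2 ![err K * _ + _]addrC.
apply: (@homo_of_is_derive f df a b _ _ ab) => x /andP[ax xb].
  have st : sin x != 0 by apply/lt0r_neq0/sin_pos; lra.
  have -> : f = (- err K) *: (fun u => cos u / sin u) - (fun u => abs_sin_sum K u / sin u) by [].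
  have d1 := is_derive_quot K st; have d2 := is_derive_cot st.
  by apply: is_derive_eq; rewrite /df /GRing.scale /=; ring.
rewrite /df; apply: divr_ge0; last exact: sqr_ge0.
apply: mulr_ge0; first exact/ltW/err_gt0.
by have := cos_bound (K.*2.+1%:R * x); lra.
Qed.

Lemma quot_incr K a b : 0 < a -> a <= b -> b < pi ->
  abs_sin_sum K a / sin a - err K * (cos a / sin a) <=
  abs_sin_sum K b / sin b - err K * (cos b / sin b).
Proof.
move=> a0 ab bpi.
pose f u := abs_sin_sum K u / sin u - err K * (cos u / sin u).
pose df u := err K * (1 - cos (K.*2.+1%:R * u)) / sin u ^+ 2.
apply: (@homo_of_is_derive f df a b _ _ ab) => x /andP[ax xb].
  have st : sin x != 0 by apply/lt0r_neq0/sin_pos; lra.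
  have -> : f = (fun u => abs_sin_sum K u / sin u) - err K *: (fun u => cos u / sin u) by [].
  have d1 := is_derive_quot K st; have d2 := is_derive_cot st.
  by apply: is_derive_eq; rewrite /df /GRing.scale /=; ring.
rewrite /df; apply: divr_ge0; last exact: sqr_ge0.
apply: mulr_ge0; first exact/ltW/err_gt0.
by have := cos_bound (K.*2.+1%:R * x); lra.
Qed.

Let mid K : R := abs_sin_sum K (pi / 2).

Let quot_mid K : abs_sin_sum K (pi / 2) / sin (pi / 2) = mid K.
Proof. by rewrite sin_pihalf divr1. Qed.

Let cot_mid : cos (pi / 2) / sin (pi / 2 : R) = 0.
Proof. by rewrite cos_pihalf mul0r. Qed.

Let cos_even_pi n : cos (n.*2%:R * pi) = 1 :> R.
Proof.
elim: n => [|n IHn]; first by rewrite mul0r cos0.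
by rewrite -[RHS]IHn -[RHS]cosD2pi doubleS -!natr1; congr cos; rewrite mulr2n; ring.
Qed.

Let sin_nat_pi n : sin (n%:R * pi) = 0 :> R.
Proof.
elim: n => [|n IHn]; first by rewrite mul0r sin0.
by rewrite -natr1 mulrDl mul1r sinDpi IHn oppr0.
Qed.

Let clear_quot (a e c s : R) : s != 0 -> (a / s + e * (c / s)) * s = a + e * c.
Proof. by move=> s0; field. Qed.

Let err_cos K t : - err K <= err K * cos t <= err K.
Proof.
have := ltW (err_gt0 K); have /andP[] := cos_bound t.
by move: (err K) (cos t) => e c c1 c2 e0; apply/andP; split; nra.
Qed.

(** The monotone quotients are compared with their value at pi/2, where cot vanishes; multiplying
    back by sin t leaves an error [err K] |cos t|. The end points, where the quotient is undefined,
    use the explicit value of S_K. *)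
Lemma abs_sin_sum_lower K t : 0 <= t <= pi ->
  mid K * sin t <= abs_sin_sum K t + err K.
Proof.
move=> /andP[]; rewrite le_eqVlt => /predU1P[<- _|t0].
  rewrite sin0 mulr0 abs_sin_sum0; by apply: addr_ge0; exact/ltW/err_gt0.
rewrite le_eqVlt => /predU1P[->|tpi].
  have -> : abs_sin_sum K pi = err K.
    rewrite -abs_sin_sum0; elim: (K) => //= k ->.
    by rewrite cos_even_pi mulr0 cos0.
  by rewrite sinpi mulr0; apply: addr_ge0; exact/ltW/err_gt0.
have p0 := pi_gt0 R; have st := sin_pos (introT andP (conj t0 tpi)).
have /andP[e1 e2] := err_cos K t.
have [th|/ltW th] := leP t (pi / 2).
  have h2 : pi / 2 < pi :> R by lra.
  have := @quot_decr K t (pi / 2) t0 th h2; rewrite quot_mid cot_mid mulr0 addr0.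
  move=> /(ler_wpM2r (ltW st)); rewrite clear_quot ?lt0r_neq0// => /le_trans; apply.
  by rewrite lerD2l.
have h2 : 0 < pi / 2 :> R by lra.
have := @quot_incr K (pi / 2) t h2 th tpi.
rewrite quot_mid cot_mid mulr0 subr0 -mulNr => /(ler_wpM2r (ltW st)).
rewrite clear_quot ?lt0r_neq0// => /le_trans; apply.
by rewrite lerD2l mulNr lerNl.
Qed.

Lemma abs_sin_sum_upper K t : 0 <= t <= pi / 2 ->
  abs_sin_sum K t <= mid K * sin t + err K.
Proof.
move=> /andP[]; rewrite le_eqVlt => /predU1P[<- _|t0 th].
  by rewrite sin0 mulr0 abs_sin_sum0 add0r.
have p0 := pi_gt0 R; have h2 : pi / 2 < pi :> R by lra.
have st : 0 < sin t by apply: sin_pos; rewrite t0 (le_lt_trans th).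
have /andP[e1 e2] := err_cos K t.
have := @quot_incr K t (pi / 2) t0 th h2; rewrite quot_mid cot_mid mulr0 subr0.
rewrite -mulNr => /(ler_wpM2r (ltW st)); rewrite clear_quot ?lt0r_neq0// mulNr.
by rewrite lerBlDr => /le_trans; apply; rewrite lerD2l.
Qed.

(* Integrating over [0, pi/2], where S_K has integral 1. *)
Lemma mid_lower K : 1 - K.*2.+1%:R^-1 <= mid K.
Proof.
(* The increment of f over [0, pi/2] is mid K + 1/(2K+1) - 1, since [err K] times pi/2 is
   1/(2K+1). *)
pose f u := - mid K * cos u + err K * u - abs_sin_prim K u.
pose df u := mid K * sin u + err K - abs_sin_sum K u.
have p0 := pi_gt0 R.
have : f 0 <= f (pi / 2).
  apply: (@homo_of_is_derive f df); last by lra.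
    move=> x _.
    have -> : f = (- mid K) *: cos + (fun u => err K * u) - abs_sin_prim K by [].
    have d1 := is_derive_prim K x.
    by apply: is_derive_eq; rewrite /df /GRing.scale /=; ring.
  by move=> x hx; rewrite /df subr_ge0; exact: abs_sin_sum_upper.
have -> : f 0 = - mid K.
  rewrite /f cos0; suff -> : abs_sin_prim K 0 = 0 by ring.
  by elim: (K) => /= [|k ->]; rewrite mulr0// sin0; ring.
have -> : f (pi / 2) = K.*2.+1%:R^-1 - 1.
  rewrite /f cos_pihalf; suff -> : abs_sin_prim K (pi / 2) = 1.
    rewrite mulr0 add0r; congr (_ - _).
    have e (p m : R) : p != 0 -> m != 0 -> 2 / p / m * (p / 2) = m^-1.
      by move=> p0' m0; field; rewrite ?p0' ?m0.
    by apply: e => //; rewrite pnatr_eq0.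
  elim: (K) => /= [|k ->]; first by move: pi_neq0; generalize (pi : R) => p p0'; field.
  suff -> : freq k * (pi / 2) = k.+1%:R * pi by rewrite sin_nat_pi; ring.
  by rewrite freqE -natr1; field.
by move=> h; rewrite -(opprB _ 1) lerNl.
Qed.

(** An explicit one-sided error replaces the convergence of the Fourier series. The range |t| <= pi
    is enough for the difference of two angles in (-pi/2, pi/2]. *)
Lemma abs_sin_le K t : `|t| <= pi ->
  (1 - K.*2.+1%:R^-1) * `|sin t| <= abs_sin_sum K t + err K.
Proof.
have p0 := pi_gt0 R.
have pos u : 0 <= u <= pi -> (1 - K.*2.+1%:R^-1) * `|sin u| <= abs_sin_sum K u + err K.
  move=> hu; have su : 0 <= sin u by apply: sin_ge0_pi.
  apply: le_trans (abs_sin_sum_lower K hu); rewrite ger0_norm//.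
  by apply: ler_wpM2r => //; exact: mid_lower.
have [t0|/ltW t0] := leP 0 t; first by rewrite ger0_norm// => tp; apply: pos; lra.
rewrite ler0_norm// => tp; rewrite -abs_sin_sumN -normrN -sinN; apply: pos; lra.
Qed.

End FourierAbsSin.

(** * The L^1 norm of a determinant in two functions *)

Section Isoperimetric.
Local Open Scope classical_set_scope.
Context {R : realType}.
Local Notation I := (measurableTypeR R).
Local Notation E := (Ex (@unif R)).
Local Notation E2 := (Ex (@unif R \x @unif R)%E).

Lemma measurable_inv : measurable_fun setT (fun x : R => x^-1).
Proof.
have m0 : measurable [set x : R | x != 0].
  have -> : [set x : R | x != 0] = ~` [set 0].
    by apply/seteqP; split=> x /= /eqP.
  by apply: measurableC; exact: measurable_set1.
have -> : setT = [set x : R | x != 0] `|` [set 0].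
  by apply/seteqP; split=> x //= _; case: (eqVneq x 0) => h; [right|left].
apply/measurable_funU => //; split; last exact: measurable_fun_set1.
apply: open_continuous_measurable_fun.
  have -> : [set x : R | x != 0] = ~` [set 0].
    by apply/seteqP; split=> x /= /eqP.
  exact/closed_openC/closed_eq.
by move=> x; rewrite inE /= => x0; apply: inv_continuous.
Qed.

(* The angle of the line spanned by (f, g), in (-pi/2, pi/2]. *)
Definition line_angle (u v : R) : R := if u == 0 then pi / 2 else atan (v / u).

(** A line fixes the vector (u, v) only up to the sign s, which is harmless because only absolute
    values of determinants are used. *)
Lemma line_angleP u v : exists s : R, `|s| = 1 /\
  u = s * Num.sqrt (u ^+ 2 + v ^+ 2) * cos (line_angle u v) /\
  v = s * Num.sqrt (u ^+ 2 + v ^+ 2) * sin (line_angle u v).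
Proof.
rewrite /line_angle; case: (eqVneq u 0) => [->|u0].
  rewrite cos_pihalf sin_pihalf expr0n /= add0r sqrtr_sqr.
  have [v0|v0] := leP 0 v; [exists 1|exists (-1)]; rewrite ?normrN normr1 !mulr0 !mulr1; split=> //; split=> //.
    by rewrite ger0_norm// mul1r.
  by rewrite ltr0_norm// mulN1r opprK.
have c0 := cos_atan (v / u); have t0 := atanK (v / u).
have h : 1 + (v / u) ^+ 2 = (u ^+ 2 + v ^+ 2) / u ^+ 2 by field.
have r0 : 0 < u ^+ 2 + v ^+ 2 by rewrite ltr_wpDr ?sqr_ge0// exprn_even_gt0.
set r := Num.sqrt (u ^+ 2 + v ^+ 2).
have rp : 0 < r by rewrite sqrtr_gt0.
have cE : cos (atan (v / u)) = `|u| / r.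
  rewrite c0 h sqrtrM ?ltW// sqrtrV ?sqr_ge0// sqrtr_sqr -/r invfM invrK mulrC.
  by [].
have un : 0 < `|u| by rewrite normr_gt0.
have sE : sin (atan (v / u)) = v / u * (`|u| / r).
  rewrite -cE -{2}t0 /tan divfK// cE; apply: lt0r_neq0; exact: divr_gt0.
exists (Num.sg u); rewrite normr_sg u0; split=> //; rewrite cE sE.
have e : Num.sg u * `|u| = u by rewrite -numEsg.
split.
  by rewrite -[LHS]e; field; rewrite lt0r_neq0.
transitivity (v / u * (Num.sg u * `|u|)); first by rewrite e divfK.
by field; rewrite u0 lt0r_neq0.
Qed.

Lemma line_angle_bound u v : - (pi / 2) < line_angle u v <= pi / 2.
Proof.
have p0 := pi_gt0 R; rewrite /line_angle; case: eqP => _; first by lra.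
by rewrite atan_gtNpi2/= ltW// atan_ltpi2.
Qed.

Lemma abs_det_le K (u v u' v' : R) :
  (1 - K.*2.+1%:R^-1) * `|u * v' - u' * v| <=
  Num.sqrt (u ^+ 2 + v ^+ 2) * Num.sqrt (u' ^+ 2 + v' ^+ 2) *
  (abs_sin_sum K (line_angle u v - line_angle u' v') + 2 / pi / K.*2.+1%:R).
Proof.
have [s [s1 [uE vE]]] := line_angleP u v.
have [s' [s1' [uE' vE']]] := line_angleP u' v'.
have b := line_angle_bound u v; have b' := line_angle_bound u' v'.
have -> : `|u * v' - u' * v| = Num.sqrt (u ^+ 2 + v ^+ 2) *
    Num.sqrt (u' ^+ 2 + v' ^+ 2) * `|sin (line_angle u v - line_angle u' v')|.
  have key (r r' t t' : R) : 0 <= r -> 0 <= r' ->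
      `|s * r * cos t * (s' * r' * sin t') - s' * r' * cos t' * (s * r * sin t)| =
      r * r' * `|sin (t - t')|.
    move=> r0 r'0; rewrite sinB -[in RHS](ger0_norm r0) -[in RHS](ger0_norm r'0).
    rewrite -[RHS]mul1r -{1}s1 -[RHS]mul1r -{1}s1' -!normrM -normrN.
    by congr (`| _ |); ring.
  rewrite -key ?sqrtr_ge0//.
  by rewrite -uE -vE -uE' -vE'.
rewrite mulrCA ler_wpM2l ?mulr_ge0 ?sqrtr_ge0//.
apply: abs_sin_le; have p0 := pi_gt0 R.
by rewrite ler_norml; apply/andP; split; lra.
Qed.

Lemma bmfun_sqrt d (T : measurableType d) (f : T -> R) :
  bmfun f -> bmfun (fun x => Num.sqrt (f x)).
Proof.
move=> [mf [M fM]]; split.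
  apply: (@measurableT_comp _ _ _ _ _ _ (Num.sqrt : R -> R)) => //.
  by apply: continuous_measurable_fun; exact: sqrt_continuous.
exists (Num.sqrt M) => x; rewrite ger0_norm ?sqrtr_ge0// ler_wsqrtr//.
exact: le_trans (ler_norm _) (fM x).
Qed.

Variables f g : I -> R.
Hypotheses (bf : bmfun f) (bg : bmfun g).

Let a x := Num.sqrt (f x ^+ 2 + g x ^+ 2).
Let th x := line_angle (f x) (g x).

Let ba : bmfun a.
Proof. by apply: bmfun_sqrt; apply: bmfunD; exact: bmfunM. Qed.

Let mth : measurable_fun setT th.
Proof.
have mf := bf.1; have mg := bg.1; rewrite /th /line_angle.
apply: measurable_fun_ifT.
- exact: measurable_fun_eqr.
- exact: measurable_cst.
- apply: measurableT_comp; last first.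
    apply: measurable_funM => //.
    exact: (measurableT_comp measurable_inv).
  by apply: continuous_measurable_fun; exact: continuous_atan.
Qed.

Let mcos : measurable_fun setT (cos : R -> R).
Proof. by apply: continuous_measurable_fun; exact: continuous_cos. Qed.

Let msin : measurable_fun setT (sin : R -> R).
Proof. by apply: continuous_measurable_fun; exact: continuous_sin. Qed.

Let mmth m : measurable_fun setT (fun x => m * th x).
Proof. by apply: measurable_funM => //; exact: measurable_cst. Qed.

Let bcos m : bmfun (fun x => a x * cos (m * th x)).
Proof.
apply: bmfunM => //; split; last by exists 1 => x; rewrite ler_norml cos_geN1 cos_le1.
exact: (measurableT_comp mcos (mmth m)).
Qed.

Let bsin m : bmfun (fun x => a x * sin (m * th x)).
Proof.
apply: bmfunM => //; split; last by exists 1 => x; rewrite ler_norml sin_geN1 sin_le1.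
exact: (measurableT_comp msin (mmth m)).
Qed.

Let b12 (h k : I -> R) : bmfun h -> bmfun k ->
  bmfun (fun p : I * I => h p.1 * k p.2).
Proof. by move=> bh bk; apply: bmfunM; [exact: bmfun_fst|exact: bmfun_snd]. Qed.

Let Ex12 (h k : I -> R) : bmfun h -> bmfun k ->
  E2 (fun p => h p.1 * k p.2) = E h * E k.
Proof.
move=> bh bk; rewrite Ex_prod1 /=; last exact: b12.
by rewrite -ExZr//; apply: eq_Ex => x; rewrite ExZ.
Qed.

(* cos (m (s - t)) is a positive semidefinite kernel. *)
Let Ex_abs_sin_sum K :
  bmfun (fun p => a p.1 * a p.2 * abs_sin_sum K (th p.1 - th p.2)) /\
  E2 (fun p => a p.1 * a p.2 * abs_sin_sum K (th p.1 - th p.2)) <=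
  2 / pi * E a ^+ 2.
Proof.
elim: K => [|K [bK IHK]] /=.
  split; first by apply: bmfunM; [exact: b12|exact: bmfun_cst].
  by rewrite ExZr ?Ex12//; [rewrite -expr2 mulrC|exact: b12].
set m : R := K.+1.*2%:R.
pose h (p : I * I) := a p.1 * cos (m * th p.1) * (a p.2 * cos (m * th p.2)) +
                      a p.1 * sin (m * th p.1) * (a p.2 * sin (m * th p.2)).
have bh : bmfun h.
  by apply: bmfunD; [exact: (b12 (bcos m) (bcos m))|exact: (b12 (bsin m) (bsin m))].
have hE : (fun p : I * I => a p.1 * a p.2 * (abs_sin_sum K (th p.1 - th p.2) -
    4 / pi * (cos (m * (th p.1 - th p.2)) / (m ^+ 2 - 1)))) =
  (fun p => a p.1 * a p.2 * abs_sin_sum K (th p.1 - th p.2) -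
            4 / pi / (m ^+ 2 - 1) * h p).
  apply/funext => p; rewrite /h (mulrBr m) cosB.
  by move: (cos _) (cos _) (sin _) (sin _) => c c' s s'; ring.
rewrite hE; split; first by apply: bmfunB => //; exact: bmfunZ.
rewrite ExB//; last exact: bmfunZ.
apply: le_trans IHK; rewrite gerBl ExZ// mulr_ge0//.
  by rewrite !divr_ge0 ?pi_ge0 ?ltW ?coef_gt0.
rewrite /h ExD; [|exact: (b12 (bcos m) (bcos m))|exact: (b12 (bsin m) (bsin m))].
rewrite (Ex12 (bcos m) (bcos m)) (Ex12 (bsin m) (bsin m)) -!expr2.
by rewrite addr_ge0 ?sqr_ge0.
Qed.

Lemma Ex_abs_det_le :
  E2 (fun p => `|f p.1 * g p.2 - f p.2 * g p.1|) <=
  2 / pi * (E (fun x => f x ^+ 2) + E (fun x => g x ^+ 2)).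
Proof.
have bf2 : bmfun (fun x => f x ^+ 2) by exact: bmfunM.
have bg2 : bmfun (fun x => g x ^+ 2) by exact: bmfunM.
rewrite -ExD//; set N := E (fun x => _ + _).
have aN : E a ^+ 2 <= N.
  apply: le_trans (sqr_Ex_le _ ba) _; apply: le_Ex; [exact: bmfunM|exact: bmfunD|move=> x].
  by rewrite sqr_sqrtr// addr_ge0 ?sqr_ge0.
have N0 : 0 <= N by apply: Ex_ge0 => x; rewrite addr_ge0 ?sqr_ge0.
have bd : bmfun (fun p : I * I => `|f p.1 * g p.2 - f p.2 * g p.1|).
  apply: bmfun_norm; apply: bmfunB; first exact: b12.
  exact: (bmfunM (bmfun_snd bf) (bmfun_fst bg)).
set D := E2 _.
have D0 : 0 <= D by apply: Ex_ge0 => p.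
(* Integrating [abs_det_le] for fixed K: the cosine terms only lower the bound, and (E a)^2 is at
   most N. *)
have step K : (1 - K.*2.+1%:R^-1) * D <= 2 / pi * (1 + K.*2.+1%:R^-1) * N.
  have [bK hK] := Ex_abs_sin_sum K.
  rewrite -ExZ//; apply: (@le_trans _ _ (E2 (fun p =>
    a p.1 * a p.2 * abs_sin_sum K (th p.1 - th p.2) +
    a p.1 * a p.2 * (2 / pi / K.*2.+1%:R)))).
    apply: le_Ex; first exact: bmfunZ.
      by apply: bmfunD => //; apply: bmfunM; [exact: b12|exact: bmfun_cst].
    by move=> p; rewrite -mulrDr; exact: abs_det_le.
  rewrite ExD//; last by apply: bmfunM; [exact: b12|exact: bmfun_cst].
  rewrite ExZr ?Ex12//; last exact: b12.
  apply: (@le_trans _ _ (2 / pi * N + N * (2 / pi / K.*2.+1%:R))); last by rewrite le_eqVlt; apply/orP; left; apply/eqP; ring.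
  apply: lerD.
    by apply: le_trans hK _; rewrite ler_wpM2l// divr_ge0 ?pi_ge0.
  by rewrite -expr2 ler_wpM2r// !divr_ge0 ?pi_ge0.
apply/ler_addgt0Pr => e e0.
have p0 := pi_gt0 R.
set c := D + 2 / pi * N.
have c0 : 0 <= c by rewrite addr_ge0// mulr_ge0// divr_ge0 ?pi_ge0.
(* The total error is c / (2K + 1), which this K brings below e. *)
have [K hK] : exists K : nat, c / e <= K.*2.+1%:R.
  exists (Num.Def.archi_bound (c / e)); apply: ltW.
  apply: lt_le_trans (archi_boundP _) _; first by apply: divr_ge0 => //; exact: ltW.
  by rewrite ler_nat; lia.
have := step K; set k : R := K.*2.+1%:R in hK *.
have k0 : 0 < k by rewrite ltr0n.
have ck : c * k^-1 <= e by rewrite ler_pdivrMr// mulrC -ler_pdivrMr.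
have fin (q h : R) : (1 - h) * D <= q * (1 + h) * N -> (D + q * N) * h <= e ->
    D <= q * N + e by move=> h1 h2; nra.
by move=> /fin; apply.
Qed.

End Isoperimetric.

(** * The norm bound 1/pi *)

Section OperatorNorm.
Local Open Scope classical_set_scope.
Context {R : realType}.
Local Notation I := (measurableTypeR R).
Local Notation E := (Ex (@unif R)).
Local Notation E2 := (Ex (@unif R \x @unif R)%E).
Variable U : I * I -> R.
Hypothesis bU : bmfun U.
Hypothesis aU : forall x y, U (y, x) = - U (x, y).
Hypothesis hU : forall p, `|U p| <= 1 / 2.

(** By skew-adjointness, twice the form is the integral of U against a determinant in f and g. Since
    |U| <= 1/2, the form is at most 1/4 of the L^1 norm of that determinant, and 1/4 times 2/pi is
    1/(2 pi). *)
Lemma kernel_op_form_le f g : bmfun f -> bmfun g ->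
  E (fun x => g x * kernel_op U f x) <=
  (2 * pi)^-1 * (E (fun x => f x ^+ 2) + E (fun x => g x ^+ 2)).
Proof.
move=> bf bg; have p0 := pi_gt0 R.
have adj := kernel_op_adjoint bU aU bf bg.
have bd : bmfun (fun p : I * I => f p.1 * g p.2 - f p.2 * g p.1).
  apply: bmfunB; first exact: (bmfunM (bmfun_fst bf) (bmfun_snd bg)).
  exact: (bmfunM (bmfun_snd bf) (bmfun_fst bg)).
have b1 : bmfun (fun p : I * I => U p * g p.1 * f p.2).
  by apply: bmfunM; [apply: bmfunM|]; [|exact: bmfun_fst|exact: bmfun_snd].
have b2 : bmfun (fun p : I * I => U p * f p.1 * g p.2).
  by apply: bmfunM; [apply: bmfunM|]; [|exact: bmfun_fst|exact: bmfun_snd].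
have h : 2 * E (fun x => g x * kernel_op U f x) <=
         1 / 2 * E2 (fun p => `|f p.1 * g p.2 - f p.2 * g p.1|).
  have -> : 2 * E (fun x => g x * kernel_op U f x) =
            E2 (fun p => U p * g p.1 * f p.2 - U p * f p.1 * g p.2).
    by rewrite ExB// -!(Ex_op_mul bU)//; lra.
  rewrite -ExZ; last exact: bmfun_norm.
  apply: le_Ex; [exact: bmfunB|by apply: bmfunZ; exact: bmfun_norm|move=> p].
  apply: le_trans (ler_norm _) _.
  have -> : U p * g p.1 * f p.2 - U p * f p.1 * g p.2 =
            - (U p * (f p.1 * g p.2 - f p.2 * g p.1)) by ring.
  by rewrite normrN normrM ler_wpM2r.
have := Ex_abs_det_le bf bg; move: h.
set A := E _; set D := E2 _; set N := _ + _ => h1 h2.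
have e (p : R) : p != 0 -> (2 * p)^-1 * N = 1 / 4 * (2 / p * N) by move=> ?; field.
rewrite (e _ (lt0r_neq0 p0)).
lra.
Qed.

(* Apply the bilinear bound to f = A^n 1 and g = pi A f. *)
Lemma qvalS_le n : qval U n.+1 <= qval U n / pi ^+ 2.
Proof.
have p0 := pi_gt0 R.
pose f := iter n (kernel_op U) (fun=> 1 : R).
have bf : bmfun f by apply: bmfun_iter_op => //; exact: bmfun_cst.
have bAf : bmfun (kernel_op U f) by exact: bmfun_kernel_op.
(* The factor pi balances the two squares: pi q' <= (q + pi^2 q') / (2 pi) is exactly pi^2 q' <=
   q. *)
have bg : bmfun (fun x => pi * kernel_op U f x) by exact: bmfunZ.
have b2 : bmfun (fun x => kernel_op U f x ^+ 2) by exact: bmfunM.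
have := kernel_op_form_le bf bg.
have -> : E (fun x => pi * kernel_op U f x * kernel_op U f x) = pi * qval U n.+1.
  by rewrite /qval -ExZ//; apply: eq_Ex => x; rewrite -mulrA.
have -> : E (fun x => (pi * kernel_op U f x) ^+ 2) = pi ^+ 2 * qval U n.+1.
  by rewrite /qval -ExZ//; apply: eq_Ex => x; rewrite exprMn.
have -> : E (fun x => f x ^+ 2) = qval U n by [].
move: (qval U n.+1) (qval U n) => q' q h.
rewrite ler_pdivlMr ?exprn_gt0//.
have : 2 * pi * (pi * q') <= q + pi ^+ 2 * q'.
  by move: h; rewrite [leRHS]mulrC ler_pdivlMr ?mulr_gt0// mulrC.
by move: p0; generalize (pi : R) => p p0; nra.
Qed.

End OperatorNorm.

(** * Block lengths of a sequence of present and missing edges *)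

Section Runs.

(* Lengths of the maximal blocks of [true], with a (possibly empty) block
   before, between and after the entries [false]. *)
Fixpoint runs (s : seq bool) : seq nat :=
  match s with
  | [::] => [:: 0%N]
  | true :: s' => (head 0%N (runs s')).+1 :: behead (runs s')
  | false :: s' => 0%N :: runs s'
  end.

Lemma runs_cons s : runs s = head 0%N (runs s) :: behead (runs s).
Proof. by case: s => [|[] s]. Qed.

Lemma runs_nseq k : runs (nseq k true) = [:: k].
Proof. by elim: k => //= k ->. Qed.

Lemma runs_cat_false k s : runs (nseq k true ++ false :: s) = k :: runs s.
Proof. by elim: k => //= k ->. Qed.

Lemma sumn_runs s : sumn (runs s) = count id s.
Proof.
elim: s => //= -[] s IHs /=; last by rewrite IHs.
by rewrite -IHs {3}(runs_cons s) /=; lia.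
Qed.

Lemma size_runs s : (size (runs s) + count id s)%N = (size s).+1.
Proof.
elim: s => //= -[] s IHs /=; last lia.
by rewrite -IHs {2}(runs_cons s) /=; lia.
Qed.

End Runs.

(** * Transfer operators along a path *)

Section Transfer.
Variables (A : comPzRingType) (X : Type) (M : X -> X -> A).

(* The weight of the walk x, t_1, t_2, ..., where the steps marked [false]
   are free and the end point is weighted by [h]. *)
Fixpoint path_weight (h : X -> A) (s : seq bool) (x : X) (t : seq X) : A :=
  match s, t with
  | b :: s', y :: t' => (if b then M x y else 1) * path_weight h s' y t'
  | _, _ => h x
  end.

Variable Iv : (X -> A) -> A.

(** [Iv] is abstract so that one recursion serves both the expectation over [0, 1] and the finite
    weighted sums of homomorphism counts. *)
Definition step_op (f : X -> A) : X -> A := fun x => Iv (fun y => M x y * f y).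

Fixpoint transfer (h : X -> A) (s : seq bool) : X -> A :=
  match s with
  | [::] => h
  | true :: s' => step_op (transfer h s')
  | false :: s' => fun=> Iv (transfer h s')
  end.

Lemma transfer_nseq h k : transfer h (nseq k true) = iter k step_op h.
Proof. by elim: k => //= k ->. Qed.

(** A missing edge restarts the walk from the constant 1, which splits the weight into one factor
    per run. Homogeneity is required only on multiples of iterates of 1, because for expectations it
    is proved only for bounded measurable functions. *)
Lemma transfer_runs s :
  (forall c k, Iv (fun x => c * iter k step_op (fun=> 1) x) =
     c * Iv (iter k step_op (fun=> 1))) ->
  (forall c k x, step_op (fun x => c * iter k step_op (fun=> 1) x) x =
     c * iter k.+1 step_op (fun=> 1) x) ->
  transfer (fun=> 1) s =
    (fun x => (\prod_(k <- behead (runs s)) Iv (iter k step_op (fun=> 1))) *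
              iter (head 0%N (runs s)) step_op (fun=> 1) x).
Proof.
move=> IvZ opZ; elim: s => [|[] s IHs] /=.
- by apply/funext => x; rewrite big_nil mul1r.
- by rewrite IHs; apply/funext => x; rewrite opZ.
- rewrite IHs IvZ; apply/funext => x.
  by rewrite [in RHS]runs_cons big_cons mulr1 mulrC.
Qed.

Lemma Iv_transfer_runs s :
  (forall c k, Iv (fun x => c * iter k step_op (fun=> 1) x) =
     c * Iv (iter k step_op (fun=> 1))) ->
  (forall c k x, step_op (fun x => c * iter k step_op (fun=> 1) x) x =
     c * iter k.+1 step_op (fun=> 1) x) ->
  Iv (transfer (fun=> 1) s) = \prod_(k <- runs s) Iv (iter k step_op (fun=> 1)).
Proof.
move=> IvZ opZ; rewrite transfer_runs// IvZ [in RHS]runs_cons big_cons.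
exact: mulrC.
Qed.

End Transfer.

(** * Subgraphs of a cycle in cyclic order *)

Section Labelling.

(* Adjacency of [H] is that of the cycle of length [l] on the vertices [g i],
   keeping only the edges between [g i] and [g (ordS i)] with [bs i]. *)
Definition labelled (H : ograph) l (g : 'I_l -> H) (bs : pred 'I_l) : Prop :=
  bijective g /\ forall i j, Defs.arc (g i) (g j) || Defs.arc (g j) (g i) =
    (bs i && (j == ordS i)) || (bs j && (i == ordS j)).

Definition backward (H : ograph) l (g : 'I_l -> H) (bs : pred 'I_l) : nat :=
  #|[pred i | bs i && ~~ Defs.arc (g i) (g (ordS i))]|.

Definition label_edge (H : ograph) l (g : 'I_l -> H) (i : 'I_l) : H * H :=
  if Defs.arc (g i) (g (ordS i)) then (g i, g (ordS i)) else (g (ordS i), g i).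

Lemma ordS_mod l (i : 'I_l) :
  (i.+1 %% l)%N = if i.+1 == l then 0%N else i.+1.
Proof.
case: eqP => [->|h]; first by rewrite modnn.
by rewrite modn_small //; have := ltn_ord i; lia.
Qed.

Lemma ordS_val l (i : 'I_l) : val (ordS i) = if i.+1 == l then 0%N else i.+1.
Proof. exact: ordS_mod. Qed.

Lemma ordS2_neq l (i : 'I_l) : (2 < l)%N -> ordS (ordS i) != i.
Proof.
move=> l2; apply/eqP => /(congr1 val); rewrite !ordS_val /=.
by have := ltn_ord i; do 2?case: eqP; lia.
Qed.

Section Fixed.
Variables (H : ograph) (l : nat) (g : 'I_l -> H) (bs : pred 'I_l).
Hypotheses (l2 : (2 < l)%N) (lab : labelled g bs).

Let g_inj : injective g. Proof. exact: bij_inj lab.1. Qed.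

Lemma label_edge_inj : injective (label_edge g).
Proof.
move=> i j; rewrite /label_edge.
case: ifP => _; case: ifP => _ [] /g_inj e1 /g_inj e2 //.
- by have := ordS2_neq j l2; rewrite -e1 e2 eqxx.
- by have := ordS2_neq i l2; rewrite e1 e2 eqxx.
Qed.

Lemma arcs_label_edge : arcs H = [set label_edge g i | i in bs]%SET.
Proof.
have [[g' gK g'K] adj] := lab.
have edge_arc i : bs i -> Defs.arc (label_edge g i).1 (label_edge g i).2.
  move=> bi; rewrite /label_edge; case: ifP => //= h.
  by have := adj i (ordS i); rewrite h bi eqxx.
apply/setP => -[x y]; rewrite inE /=; apply/idP/imsetP; last first.
  by case=> i bi e; have := edge_arc i bi; rewrite -e.
rewrite -(g'K x) -(g'K y); move: (g' x) (g' y) => i j axy.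
have := adj i j; rewrite axy => /esym/orP[] /andP[bi /eqP e].
- by exists i => //; rewrite /label_edge -e axy.
- exists j => //; rewrite /label_edge -e.
  by rewrite (negbTE (Defs.arc_asym axy)).
Qed.

Lemma card_arcs_labelled : #|arcs H| = #|bs|.
Proof. by rewrite arcs_label_edge card_imset//; exact: label_edge_inj. Qed.

(** The constant c is -1 for antisymmetric kernels and 1 for symmetric ones; each arc against the
    cyclic order costs one factor c. *)
Lemma prod_arcs_labelled (A : comPzRingType) (c : A) (M : H -> H -> A) :
  (forall x y, M y x = c * M x y) ->
  \prod_(p in arcs H) M p.1 p.2 =
  c ^+ backward g bs * \prod_(i < l | bs i) M (g i) (g (ordS i)).
Proof.
move=> Mc; rewrite arcs_label_edge big_imset /=; last first.
  by move=> i j _ _; exact: label_edge_inj.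
rewrite /backward -prodr_const.
transitivity (\prod_(i < l | bs i)
   ((if Defs.arc (g i) (g (ordS i)) then 1 else c) * M (g i) (g (ordS i)))).
  by apply: eq_bigr => i _; rewrite /label_edge; case: ifP; rewrite /= ?mul1r.
rewrite big_split /=; congr (_ * _).
rewrite big_mkcond [RHS]big_mkcond /=; apply: eq_bigr => i _.
by rewrite !inE; case: (bs i) => //=; case: ifP.
Qed.

Lemma labelled_ordS : labelled (g \o @ordS l) (bs \o @ordS l).
Proof.
have [bg adj] := lab; have bS : bijective (@ordS l) by exact: injF_bij (@ordS_inj l).
split; first exact: bij_comp.
by move=> i j; rewrite /= adj !(inj_eq (@ordS_inj l)).
Qed.

End Fixed.

Lemma labelled_iter_ordS (H : ograph) l (g : 'I_l -> H) (bs : pred 'I_l) k :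
  labelled g bs ->
  labelled (fun i => g (iter k (@ordS l) i)) (fun i => bs (iter k (@ordS l) i)).
Proof.
elim: k g bs => //= k IHk g bs lab.
exact: (IHk (g \o @ordS l) (bs \o @ordS l) (labelled_ordS lab)).
Qed.

Lemma path_weightE (A : comPzRingType) (X : Type) (M : X -> X -> A) h s x0 x t :
  size t = size s ->
  path_weight M h s x t = (\prod_(i < size s)
     (if nth false s i then M (nth x0 (x :: t) i) (nth x0 t i) else 1)) *
   h (last x t).
Proof.
elim: s x t => [|b s IHs] x [|y t] //=; first by rewrite big_ord0 mul1r.
by case=> /IHs ->; rewrite big_ord_recl /= mulrA.
Qed.

(** The cycle is cut open at its first vertex, and the edge closing it becomes the end weight of a
    walk with m steps. *)
Lemma prod_cycle_path (A : comPzRingType) (X : Type) (M : X -> X -> A) m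
    (bs : pred 'I_m.+1) (t : m.+1.-tuple X) :
  \prod_(i < m.+1 | bs i) M (tnth t i) (tnth t (ordS i)) =
  path_weight M (fun z => if bs ord_max then M z (thead t) else 1)
    [seq bs (widen_ord (leqnSn m) i) | i <- enum 'I_m] (thead t) (behead t).
Proof.
have st : size (behead t) = m by rewrite size_behead size_tuple.
rewrite (path_weightE _ _ (thead t)); last by rewrite size_map size_enum_ord.
rewrite big_mkcond big_ord_recr /= size_map size_enum_ord.
have tE : val t = thead t :: behead t by rewrite {1}(tuple_eta t).
congr (_ * _).
  apply: eq_bigr => i _; rewrite (nth_map i) ?size_enum_ord// nth_ord_enum.
  case: ifP => // _; rewrite !(tnth_nth (thead t)) -tE ordS_val /=.
  rewrite eqSS; have := ltn_ord i; case: eqP => [->|_ im]; first by rewrite ltnn.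
  by congr (M _ _); rewrite {1}tE.
case: ifP => // _; rewrite !(tnth_nth (thead t)) ordS_val /= eqxx.
rewrite (last_nth (thead t)) st -tE; congr (M _ _).
by rewrite {1}tE.
Qed.

End Labelling.

(** * Weighted homomorphism counts *)

Section WeightedHom.
Variables (A : comPzRingType) (X : finType) (w : X -> A) (M : X -> X -> A).

(** An isomorphism invariant that is multiplicative over disjoint unions: evaluating it on both
    sides of an isomorphism gives an identity without inspecting the isomorphism. *)
Definition hom_count (H : ograph) : A :=
  \sum_(phi : {ffun H -> X}) (\prod_x w (phi x)) *
    \prod_(p in arcs H) M (phi p.1) (phi p.2).

Lemma prod_arcs2 (H : ograph) (F : H -> H -> A) :
  \prod_(p in arcs H) F p.1 p.2 = \prod_x \prod_(y | Defs.arc x y) F x y.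
Proof. by rewrite pair_big_dep /=; apply: eq_bigl => p; rewrite inE. Qed.

Lemma hom_count_iso (G H : ograph) : isomorphic G H -> hom_count G = hom_count H.
Proof.
case=> f bf fE; rewrite /hom_count.
have [f' fK f'K] := bf.
rewrite (reindex (fun phi : {ffun H -> X} => [ffun x => phi (f x)])); last first.
  exists (fun psi : {ffun G -> X} => [ffun y => psi (f' y)]) => phi _;
    by apply/ffunP => x; rewrite !ffunE ?fK ?f'K.
apply: eq_bigr => phi _; congr (_ * _).
  rewrite [RHS](reindex f); last exact: onW_bij.
  by apply: eq_bigr => x _; rewrite ffunE.
rewrite (prod_arcs2 (fun x y => M ([ffun x => phi (f x)] x) ([ffun x => phi (f x)] y))).
rewrite (prod_arcs2 (fun x y => M (phi x) (phi y))).
rewrite [RHS](reindex f); last exact: onW_bij.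
apply: eq_bigr => x _; rewrite [RHS](reindex f); last exact: onW_bij.
by apply: eq_big => [y|y _]; rewrite ?fE// !ffunE.
Qed.

Lemma hom_count_dunion (G H : ograph) :
  hom_count (dunion G H) = hom_count G * hom_count H.
Proof.
rewrite /hom_count big_distrlr pair_big /=.
rewrite (reindex (fun p : {ffun G -> X} * {ffun H -> X} =>
  [ffun z : G + H => match z with inl x => p.1 x | inr y => p.2 y end])); last first.
  exists (fun phi : {ffun G + H -> X} =>
            ([ffun x => phi (inl x)], [ffun y => phi (inr y)])) => [[p q]|phi] _.
    by congr pair; apply/ffunP => x; rewrite !ffunE.
  by apply/ffunP => -[] x; rewrite !ffunE.
apply: eq_bigr => -[p q] _; set phi := finfun _.
rewrite (prod_arcs2 (fun x y => M (p x) (p y))) (prod_arcs2 (fun x y => M (q x) (q y))).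
rewrite (prod_arcs2 (H := dunion G H) (fun x y => M (phi x) (phi y))).
rewrite !big_sumType /= mulrACA; congr (_ * _); congr (_ * _).
- by apply: eq_bigr => x _; rewrite ffunE.
- apply: eq_bigr => x _; rewrite big_sumType /= [X in _ * X]big1// mulr1.
  by apply: eq_bigr => y _; rewrite !ffunE.
- by apply: eq_bigr => x _; rewrite ffunE.
- apply: eq_bigr => x _; rewrite big_sumType /= [X in X * _]big1// mul1r.
  by apply: eq_bigr => y _; rewrite !ffunE.
Qed.

Lemma hom_count_edgeless m : hom_count (edgeless m) = (\sum_x w x) ^+ m.
Proof.
transitivity (\sum_(phi : {ffun 'I_m -> X}) \prod_x w (phi x)).
  apply: eq_bigr => phi _; rewrite [X in _ * X]big1 ?mulr1// => p.
  by rewrite inE.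
rewrite -(bigA_distr_bigA (fun (_ : 'I_m) x => w x)).
by rewrite prodr_const card_ord.
Qed.

Variable c : A.
Hypothesis Mc : forall x y, M y x = c * M x y.

Lemma hom_count_reverse (H : ograph) (S : {set H * H}) : S \subset arcs H ->
  hom_count (reverse S) = c ^+ #|S| * hom_count H.
Proof.
move=> SH; rewrite /hom_count mulr_sumr; apply: eq_bigr => phi _.
rewrite mulrCA; congr (_ * _).
(* Flipping the pairs of S is injective on arcs because no arc has its reverse as another arc. *)
pose r (p : H * H) := if p \in S then (p.2, p.1) else p.
have -> : arcs (reverse S) = [set r p | p in arcs H]%SET.
  apply/setP => -[x y]; rewrite inE /= /reverse_rel; apply/idP/imsetP.
    case/orP => /andP[a h].
      by exists (x, y); rewrite ?inE// /r (negbTE h).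
    by exists (y, x); rewrite ?inE// /r h.
  case=> -[u v]; rewrite inE /= /r => a; case: ifP => h [-> ->].
    by rewrite a h orbT.
  by rewrite a h.
have r_inj : {in arcs H &, injective r}.
  move=> [x y] [u v]; rewrite !inE /= /r => a b; case: ifP => h; case: ifP => k [] e1 e2;
    subst => //.
    by have := Defs.arc_asym a; rewrite b.
  by have := Defs.arc_asym a; rewrite b.
rewrite big_imset//= -prodr_const [X in X * _]big_mkcond [RHS]mulrC.
rewrite [LHS]big_mkcond [X in _ = X * _]big_mkcond -big_split /=.
apply: eq_bigr => p _; rewrite /r; case: ifP => pH; case: ifP => pS; rewrite ?mulr1//=.
  by rewrite Mc mulrC.
by rewrite (fintype.subsetP SH _ pS) in pH.
Qed.

Local Notation Iv := (fun f : X -> A => \sum_x w x * f x).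
Local Notation op := (step_op M Iv).

Lemma sum_tupleS n (F : n.+1.-tuple X -> A) :
  \sum_t F t = \sum_x \sum_(t : n.-tuple X) F [tuple of x :: t].
Proof.
rewrite pair_big /= (reindex (fun p : X * n.-tuple X => [tuple of p.1 :: p.2])) //.
exists (fun t : n.+1.-tuple X => (thead t, [tuple of behead t])) => [[x t]|t] _.
  by congr pair; apply/val_inj.
by rewrite [RHS]tuple_eta; apply/val_inj.
Qed.

Lemma sum_path_weight n (s : seq bool) (h : X -> A) x : size s = n ->
  \sum_(t : n.-tuple X) (\prod_(y <- t) w y) * path_weight M h s x t =
  transfer M Iv h s x.
Proof.
elim: n s x => [|n IHn] [|b s] x //.
  move=> _; rewrite (eq_bigr (fun=> h x)) => [|t _].
    by rewrite sumr_const card_tuple expn0.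
  by rewrite tuple0 /= big_nil mul1r.
case=> sn; rewrite sum_tupleS.
transitivity (\sum_y w y * ((if b then M x y else 1) * transfer M Iv h s y)).
  apply: eq_bigr => y _; rewrite -(IHn s y sn) !mulr_sumr.
  by apply: eq_bigr => t _; rewrite /= big_cons; ring.
by case: b => //=; apply: eq_bigr => y _; rewrite mul1r.
Qed.

Lemma hom_count_labelled (H : ograph) m (g : 'I_m.+1 -> H) (bs : pred 'I_m.+1) :
  (2 < m.+1)%N -> labelled g bs ->
  hom_count H = c ^+ backward g bs * \sum_x w x *
    transfer M Iv (fun z => if bs ord_max then M z x else 1)
      [seq bs (widen_ord (leqnSn m) i) | i <- enum 'I_m] x.
Proof.
move=> m2 lab; have [g' gK g'K] := lab.1.
rewrite /hom_count (reindex (fun t : m.+1.-tuple X => [ffun x => tnth t (g' x)])); last first.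
  exists (fun phi : {ffun H -> X} => [tuple phi (g i) | i < m.+1]) => t _.
    by apply/eq_from_tnth => i; rewrite tnth_mktuple ffunE gK.
  by apply/ffunP => x; rewrite ffunE tnth_mktuple g'K.
transitivity (\sum_(t : m.+1.-tuple X) c ^+ backward g bs *
  ((\prod_(y <- t) w y) * path_weight M (fun z => if bs ord_max then M z (thead t) else 1)
    [seq bs (widen_ord (leqnSn m) i) | i <- enum 'I_m] (thead t) (behead t))).
  apply: eq_bigr => t _; rewrite -prod_cycle_path mulrCA; congr (_ * _).
    rewrite (reindex g) /=; last by apply: onW_bij; exists g'.
    rewrite [RHS]big_tuple; by apply: eq_bigr => i _; rewrite ffunE gK.
  pose N x y := M (tnth t (g' x)) (tnth t (g' y)).
  transitivity (\prod_(p in arcs H) N p.1 p.2).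
    by apply: eq_bigr => p _; rewrite !ffunE.
  rewrite (prod_arcs_labelled m2 lab (c := c)); last by move=> x y; exact: Mc.
  by congr (_ * _); apply: eq_bigr => i _; rewrite /N !gK.
rewrite -mulr_sumr sum_tupleS; congr (_ * _); apply: eq_bigr => x _.
rewrite -(@sum_path_weight m); last by rewrite size_map size_enum_ord.
rewrite mulr_sumr; apply: eq_bigr => t _.
by rewrite theadE /= big_cons mulrA.
Qed.

Definition hom_walk k : A := Iv (iter k op (fun=> 1)).

Lemma hom_count_linear (H : ograph) m (g : 'I_m.+1 -> H) (bs : pred 'I_m.+1) :
  (2 < m.+1)%N -> labelled g bs -> ~~ bs ord_max ->
  hom_count H = c ^+ backward g bs *
    \prod_(k <- runs [seq bs (widen_ord (leqnSn m) i) | i <- enum 'I_m]) hom_walk k.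
Proof.
move=> m2 lab /negbTE b0; rewrite (hom_count_labelled m2 lab); congr (_ * _).
rewrite b0 -(Iv_transfer_runs (M := M) (Iv := Iv))//.
  move=> d k; rewrite mulr_sumr; apply: eq_bigr => x _; ring.
move=> d k x; rewrite /step_op /= /step_op mulr_sumr.
apply: eq_bigr => y _; ring.
Qed.

End WeightedHom.

(** A path is a cycle whose closing edge, the one starting at [ord_max], is missing. The backward
    edges are the n edges before the centre. *)
Lemma labelled_Qpath n (bs := [pred i : 'I_(n.*2.+1) | i != ord_max]) :
  (0 < n)%N -> labelled (H := Qpath n) (id : 'I_(n.*2.+1) -> _) bs /\
  backward (H := Qpath n) (id : 'I_(n.*2.+1) -> _) bs = n.
Proof.
move=> n0; split.
  split; first by exists id.
  move=> i j; rewrite /= /Qpath_rel /bs /= -!val_eqE /= !ordS_mod.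
  have := ltn_ord i; have := ltn_ord j.
  by case: (boolP (i.+1 == _)) => hi; case: (boolP (j.+1 == _)) => hj; lia.
rewrite /backward /=.
transitivity #|[pred i : 'I_(n.*2.+1) | (i < n)%N]|; last first.
  rewrite -sum1_card (eq_bigl (fun i : 'I_(n.*2.+1) => (i < n)%N)) //.
  rewrite -(big_ord_widen _ (fun=> 1%N)); last by lia.
  by rewrite sum1_card card_ord.
apply: eq_card => i; rewrite !inE /Qpath_rel /bs /= -!val_eqE /= !ordS_mod.
have := ltn_ord i; case: (boolP (i.+1 == _)) => hi; lia.
Qed.

Lemma Qpath_runs n (bs := [pred i : 'I_(n.*2.+1) | i != ord_max]) :
  runs [seq bs (widen_ord (leqnSn n.*2) i) | i <- enum 'I_n.*2] = [:: n.*2].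
Proof.
rewrite -[RHS]runs_nseq; congr runs.
apply: (@eq_from_nth _ true); first by rewrite size_map size_enum_ord size_nseq.
rewrite size_map size_enum_ord => i im; rewrite nth_nseq im.
have [q qE] : exists q : 'I_n.*2, nat_of_ord q = i by exists (Ordinal im).
rewrite -qE (nth_map q) ?size_enum_ord// nth_ord_enum /bs /= -val_eqE /=.
by have := ltn_ord q; lia.
Qed.

Lemma hom_count_Qpath (A : comPzRingType) (X : finType) (w : X -> A) M c n :
  (forall x y, M y x = c * M x y) -> (0 < n)%N ->
  hom_count w M (Qpath n) = c ^+ n * hom_walk w M n.*2.
Proof.
move=> Mc n0; have [lab back] := labelled_Qpath n0.
rewrite (hom_count_linear w Mc _ lab); [|lia|by rewrite /= eqxx].
by rewrite back Qpath_runs big_seq1.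
Qed.

Lemma hom_count_Qunion (A : comPzRingType) (X : finType) (w : X -> A) M ns :
  hom_count w M (Qunion ns) = \prod_(n <- ns) hom_count w M (Qpath n).
Proof.
rewrite /Qunion; elim: ns => [|n ns IHns]; first by rewrite big_nil hom_count_edgeless.
by rewrite /= hom_count_dunion IHns big_cons.
Qed.


(** * The two-vertex targets *)

Section BoolModels.

(* A_true = J and A_false = -J for J = [[0, 1], [-1, 0]], so J^2 = -1. *)
Definition rot_kernel (x y : bool) : int :=
  if x == y then 0 else if y then 1 else -1.

Lemma rot_kernelC x y : rot_kernel y x = -1 * rot_kernel x y.
Proof. by case: x; case: y. Qed.

Local Notation Jop := (step_op rot_kernel (fun f => \sum_(x : bool) 1 * f x)).

Lemma rot_op2 f : Jop (Jop f) = (fun x => - f x).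
Proof.
apply/funext => x; rewrite /step_op !big_bool /= /rot_kernel /=.
by case: x => /=; ring.
Qed.

Lemma iter_rot_double n f : iter n.*2 Jop f = (fun x => (-1) ^+ n * f x).
Proof.
elim: n => [|n IHn]; first by apply/funext => x; rewrite mul1r.
rewrite doubleS 2!iterS IHn rot_op2; apply/funext => x.
by rewrite exprS -mulrA mulN1r.
Qed.

Lemma rot_walk n : hom_walk (fun=> 1) rot_kernel n.*2 = (-1) ^+ n * 2.
Proof. by rewrite /hom_walk iter_rot_double big_bool /=; ring. Qed.

(* Chosen so that a path with k edges weighs 'X^k ('X - 2^k): the lengths of the
   paths of a forest are then read off the roots of its weight. *)
Definition size_weight (x : bool) : {poly rat} := if x then -1 else 'X.
Definition size_kernel (x y : bool) : {poly rat} :=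
  if x == y then if x then -2 * 'X else 1 else 0.

Lemma size_walk k :
  hom_walk size_weight size_kernel k = 'X^k * ('X - (2 ^ k)%:R%:P).
Proof.
pose Sop := step_op size_kernel (fun f => \sum_(x : bool) size_weight x * f x).
have it : iter k Sop (fun=> 1) = (fun x : bool => if x then (2 * 'X) ^+ k else 'X^k).
  elim: k => [|k IHk]; first by apply/funext => -[]; rewrite !expr0.
  rewrite iterS IHk /Sop /step_op; apply/funext => x.
  by rewrite big_bool /= /size_weight /size_kernel; case: x => /=; rewrite exprS; ring.
rewrite /hom_walk -/Sop it big_bool /= /size_weight exprMn.
by rewrite polyC_natr natrX; ring.
Qed.

End BoolModels.

(** * Uniqueness of the class and of the parity *)

Section ClassInvariants.

Definition in_class (ns : seq nat) (b : bool) (G : ograph) :=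
  reversal_plus_isolated (Qunion ns) b G.

Variables (G : ograph) (m : nat) (g : 'I_m.+1 -> G) (bs : pred 'I_m.+1).
Hypotheses (m2 : (2 < m.+1)%N) (lab : labelled g bs) (b0 : ~~ bs ord_max).

Definition label_runs : seq nat :=
  runs [seq bs (widen_ord (leqnSn m) i) | i <- enum 'I_m].

Lemma prod_XsubC_pow (s : seq nat) :
  \prod_(k <- s) ('X^k * ('X - (2 ^ k)%:R%:P)) =
  \prod_(x <- nseq (sumn s) 0 ++ [seq (2 ^ k)%:R | k <- s]) ('X - x%:P) :> {poly rat}.
Proof.
rewrite big_cat big_map big_split /=; congr (_ * _).
elim: s => [|k s IHs]; first by rewrite !big_nil.
rewrite big_cons IHs /= nseqD big_cat; congr (_ * _).
by rewrite big_nseq /= subr0 iter_mulr_1.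
Qed.

(** The nonzero roots, with multiplicity, are the numbers 2^k; even a path without edges is visible,
    as the root 1. *)
Lemma prod_XsubC_pow_inj (s t : seq nat) :
  \prod_(k <- s) ('X^k * ('X - (2 ^ k)%:R%:P)) =
  \prod_(k <- t) ('X^k * ('X - (2 ^ k)%:R%:P)) :> {poly rat} -> perm_eq s t.
Proof.
rewrite !prod_XsubC_pow => /prod_XsubC_eq /(perm_filter (predC1 0)).
have f0 n : [seq x <- nseq n (0 : rat) | predC1 0 x] = [::] by elim: n.
have fm (u : seq nat) : [seq x <- [seq (2 ^ k)%:R | k <- u] | predC1 (0 : rat) x] =
    [seq (2 ^ k)%:R | k <- u].
  apply/all_filterP/allP => x /mapP[k _ ->] /=.
  by rewrite pnatr_eq0 expn_eq0.
rewrite !filter_cat !f0 !fm /=; apply: perm_map_inj => i j /eqP.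
by rewrite eqr_nat eqn_exp2l// => /eqP.
Qed.

Lemma class_runs ns b : all (leq 1) ns -> in_class ns b G ->
  (exists k, perm_eq label_runs ([seq n.*2 | n <- ns] ++ nseq k 0%N)) /\
  b = odd (backward g bs + sumn ns).
Proof.
move=> ns1 [S [k [SH <- iso]]].
pose t := [seq n.*2 | n <- ns] ++ nseq k 0%N.
have E (A : comPzRingType) (X : finType) (w : X -> A) M c :
    (forall x y, M y x = c * M x y) ->
    c ^+ backward g bs * \prod_(j <- label_runs) hom_walk w M j =
    c ^+ (#|S| + sumn ns) * \prod_(j <- t) hom_walk w M j.
  move=> Mc; have P us : all (leq 1) us -> \prod_(n <- us) hom_count w M (Qpath n) =
      c ^+ sumn us * \prod_(n <- us) hom_walk w M n.*2.
    elim: us => [|n us IHus] /=; first by rewrite !big_nil mulr1.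
    case/andP=> n1 /IHus; rewrite !big_cons => ->.
    by rewrite (hom_count_Qpath w Mc n1) exprD; ring.
  rewrite -(hom_count_linear w Mc m2 lab b0).
  rewrite (hom_count_iso w M iso) hom_count_dunion hom_count_edgeless.
  rewrite (hom_count_reverse w Mc SH) hom_count_Qunion.
  rewrite big_cat big_map big_nseq /= iter_mulr_1 exprD mulrA; congr (_ * _).
    by rewrite P// mulrA.
  by congr (_ ^+ k); apply: eq_bigr => x _; rewrite /= mulr1.
have perm : perm_eq label_runs t.
  apply: prod_XsubC_pow_inj.
  have := E _ _ size_weight size_kernel 1.
  have sK x y : size_kernel y x = 1 * size_kernel x y.
    by rewrite mul1r /size_kernel eq_sym; case: eqP => // ->.
  move=> /(_ sK); rewrite !expr1n !mul1r.
  under eq_bigr do rewrite size_walk.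
  by under [in RHS]eq_bigr do rewrite size_walk.
split; first by exists k.
(* All lengths are now even, so their weights under [rot_kernel] are nonzero and cancel, leaving an
   identity of signs. *)
have := E _ _ (fun=> 1) rot_kernel (-1) rot_kernelC.
rewrite (perm_big _ perm) /=; move=> /mulIf.
have -> : \prod_(j <- t) hom_walk (fun=> 1) rot_kernel j != 0.
  rewrite prodf_seq_neq0; apply/allP => j; rewrite mem_cat => jt.
  have [n ->] : exists n, j = n.*2.
    case/orP: jt => [/mapP[n _ ->]|]; first by exists n.
    by rewrite mem_nseq => /andP[_ /eqP ->]; exists 0%N.
  by rewrite rot_walk mulf_neq0// expf_neq0.
move=> /(_ isT); rewrite -signr_odd -[RHS]signr_odd => /signr_inj.
by rewrite !oddD => ->; rewrite -addbA addbb addbF.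
Qed.

End ClassInvariants.

(** * Existence of a class, by isomorphism of underlying graphs *)

Section UndirectedIso.

Definition adjacent (G : ograph) (x y : G) : bool := Defs.arc x y || Defs.arc y x.

(** Since arbitrary arcs may be reversed, membership in the class of some parity depends only on the
    underlying undirected graph. *)
Definition uiso (G H : ograph) : Prop :=
  exists2 f : G -> H, bijective f & forall x y, adjacent (f x) (f y) = adjacent x y.

Lemma uiso_refl G : uiso G G.
Proof. by exists id => //; exists id. Qed.

Lemma uiso_trans G H K : uiso G H -> uiso H K -> uiso G K.
Proof.
move=> [f bf fE] [h bh hE]; exists (h \o f); first exact: bij_comp.
by move=> x y; rewrite /= hE fE.
Qed.

Lemma uiso_sym G H : uiso G H -> uiso H G.
Proof.
move=> [f [f' fK f'K] fE]; exists f'; first by exists f.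
by move=> x y; rewrite -fE !f'K.
Qed.

Lemma uiso_dunion G G' H H' :
  uiso G G' -> uiso H H' -> uiso (dunion G H) (dunion G' H').
Proof.
move=> [f [f' fK f'K] fE] [h [h' hK h'K] hE].
exists (fun z : dunion G H => match z with inl x => inl (f x) | inr y => inr (h y) end
         : dunion G' H').
  exists (fun z : dunion G' H' => match z with inl x => inl (f' x) | inr y => inr (h' y) end
         : dunion G H).
    by case=> x; rewrite ?fK ?hK.
  by case=> x; rewrite ?f'K ?h'K.
by move=> [x|x] [y|y]; [exact: fE| | |exact: hE].
Qed.

Lemma uiso_dunionA G H K : uiso (dunion (dunion G H) K) (dunion G (dunion H K)).
Proof.
exists (fun z : dunion (dunion G H) K => match z with
   inl (inl x) => inl x | inl (inr y) => inr (inl y) | inr u => inr (inr u) end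
   : dunion G (dunion H K)).
  exists (fun z : dunion G (dunion H K) => match z with
   inl x => inl (inl x) | inr (inl y) => inl (inr y) | inr (inr u) => inr u end
   : dunion (dunion G H) K).
    by move=> [[x|x]|x].
  by move=> [x|[x|x]].
by move=> [[x|x]|x] [[y|y]|y].
Qed.

Lemma uiso_dunionCA G H K : uiso (dunion G (dunion H K)) (dunion H (dunion G K)).
Proof.
exists (fun z : dunion G (dunion H K) => match z with
   inl x => inr (inl x) | inr (inl y) => inl y | inr (inr u) => inr (inr u) end
   : dunion H (dunion G K)).
  exists (fun z : dunion H (dunion G K) => match z with
   inl x => inr (inl x) | inr (inl y) => inl y | inr (inr u) => inr (inr u) end
   : dunion G (dunion H K)).
    by move=> [x|[x|x]].
  by move=> [x|[x|x]].
by move=> [x|[x|x]] [y|[y|y]].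
Qed.

Lemma reversal_exists G H : uiso G H ->
  exists2 S : {set H * H}, S \subset arcs H & isomorphic G (reverse S).
Proof.
move=> [f [f' fK f'K] fE].
exists [set p in arcs H | Defs.arc (f' p.2) (f' p.1)]%SET.
  by apply/fintype.subsetP => p; rewrite inE => /andP[].
exists f; first by exists f'.
move=> x y; rewrite /= /reverse_rel !inE /= !fK.
have := fE x y; rewrite /adjacent.
have := @Defs.arc_asym H (f x) (f y); have := @Defs.arc_asym G x y.
by case: (Defs.arc x y); case: (Defs.arc y x); case: (Defs.arc (f x) (f y));
  case: (Defs.arc (f y) (f x)) => //=; do ?[move/(_ isT)].
Qed.

Lemma dpath_asym k (i j : 'I_k.+1) : (j == i.+1 :> nat) -> ~~ (i == j.+1 :> nat).
Proof. lia. Qed.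

Definition dpath k : ograph := OGraph (@dpath_asym k).

Definition path_forest (ks : seq nat) : ograph :=
  foldr dunion (edgeless 0) [seq dpath k | k <- ks].

Lemma path_forest_perm s t : perm_eq s t -> uiso (path_forest s) (path_forest t).
Proof.
have rm x u : x \in u -> uiso (path_forest u) (path_forest (x :: rem x u)).
  elim: u => //= y u IHu; rewrite inE eq_sym.
  case: (eqVneq y x) => [-> _|_ /= xu]; first exact: uiso_refl.
  apply: uiso_trans (uiso_dunionCA _ _ _).
  by apply: uiso_dunion (IHu xu); exact: uiso_refl.
elim: s t => [|x s IHs] t st.
  by move: st; rewrite perm_sym => /perm_nilP ->; exact: uiso_refl.
have xt : x \in t by rewrite -(perm_mem st) mem_head.
apply: uiso_trans (uiso_sym (rm _ _ xt)); apply: uiso_dunion; first exact: uiso_refl.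
apply: IHs; rewrite -(perm_cons x); apply: perm_trans st _; exact: perm_to_rem.
Qed.

Lemma uiso_edgeless0 G : uiso (dunion (edgeless 0) G) G.
Proof.
exists (fun z : dunion (edgeless 0) G => match z with
  inl x => False_rect G (notF (valP x)) | inr y => y end).
  by exists (inr : G -> dunion (edgeless 0) G) => // -[[]|].
by move=> [[]|x] // [[]|y].
Qed.

Lemma uiso_edgelessS m : uiso (dunion (dpath 0) (edgeless m)) (edgeless m.+1).
Proof.
pose f (z : dunion (dpath 0) (edgeless m)) : edgeless m.+1 :=
  match z with inl x => ord0 | inr y => lift ord0 y end.
exists f.
  apply: inj_card_bij.
    move=> [x|x] [y|y] /= e; try by case/(congr1 val): e.
      by congr inl; apply/val_inj; case: x y {e} => [[]// ?] [[]].
    by congr inr; exact: lift_inj e.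
  by rewrite card_sum !card_ord.
by move=> [[[|x] hx]|x] [[[|y] hy]|y].
Qed.

Lemma path_forest_nseq m : uiso (path_forest (nseq m 0%N)) (edgeless m).
Proof.
elim: m => [|m IHm]; first exact: uiso_refl.
apply: uiso_trans (uiso_edgelessS m).
by apply: uiso_dunion IHm; exact: uiso_refl.
Qed.

Lemma path_forest_cat s t :
  uiso (path_forest (s ++ t)) (dunion (path_forest s) (path_forest t)).
Proof.
elim: s => [|k s IHs] /=; first exact/uiso_sym/uiso_edgeless0.
apply: uiso_trans (uiso_sym (uiso_dunionA _ _ _)).
by apply: uiso_dunion IHs; exact: uiso_refl.
Qed.

Lemma Qunion_path_forest ns :
  uiso (path_forest [seq n.*2 | n <- ns]) (Qunion ns).
Proof.
rewrite /path_forest /Qunion; elim: ns => [|n ns IHns] /=; first exact: uiso_refl.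
apply: uiso_dunion IHns; exists (fun i : dpath n.*2 => i : Qpath n).
  by exists (fun i : Qpath n => i : dpath n.*2).
by move=> i j; rewrite /adjacent /= /Qpath_rel; lia.
Qed.

Lemma linear_asym s (i j : 'I_(size s).+1) :
  (j == i.+1 :> nat) && nth false s i -> ~~ ((i == j.+1 :> nat) && nth false s j).
Proof. by case/andP=> /eqP ji _; apply/negP => /andP[/eqP ij _]; lia. Qed.

Definition linear s : ograph := OGraph (@linear_asym s).

Lemma linear_split k s :
  uiso (dunion (dpath k) (linear s)) (linear (nseq k true ++ false :: s)).
Proof.
have sz : size (nseq k true ++ false :: s) = (k + (size s).+1)%N.
  by rewrite size_cat size_nseq.
have h1 (i : 'I_k.+1) : (i < (size (nseq k true ++ false :: s)).+1)%N.
  by rewrite sz; have := ltn_ord i; lia.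
have h2 (i : 'I_(size s).+1) : (k.+1 + i < (size (nseq k true ++ false :: s)).+1)%N.
  by rewrite sz; have := ltn_ord i; lia.
pose f (z : dunion (dpath k) (linear s)) : linear (nseq k true ++ false :: s) :=
  match z with inl i => Ordinal (h1 i) | inr i => Ordinal (h2 i) end.
have n1 i : (i < k)%N -> nth false (nseq k true ++ false :: s) i.
  by move=> ik; rewrite nth_cat size_nseq ik nth_nseq ik.
have n2 : nth false (nseq k true ++ false :: s) k = false.
  by rewrite nth_cat size_nseq ltnn subnn.
have n3 i : nth false (nseq k true ++ false :: s) (k.+1 + i) = nth false s i.
  by rewrite nth_cat size_nseq ifF; [rewrite addSn subSn ?addKn ?leq_addr|lia].
exists f.
  apply: inj_card_bij; last by rewrite card_sum !card_ord sz; lia.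
  move=> [i|i] [j|j] /(congr1 val) /= e.
  - by congr inl; exact: val_inj.
  - by have := ltn_ord i; lia.
  - by have := ltn_ord j; lia.
  - by congr inr; apply: val_inj => /=; lia.
move=> [i|i] [j|j]; rewrite /adjacent /=.
- have := ltn_ord i; have := ltn_ord j => hj hi.
  by have [e|e] := eqVneq (j : nat) i.+1; have [e'|e'] := eqVneq (i : nat) j.+1 => //=;
    rewrite n1; lia.
- have := ltn_ord i => hi.
  have -> : (nat_of_ord i == (k.+1 + j).+1) = false by lia.
  have [e|//] := eqVneq (k.+1 + j)%N i.+1.
  have -> : nat_of_ord i = k by lia.
  by rewrite n2.
- have := ltn_ord j => hj.
  have -> : (nat_of_ord j == (k.+1 + i).+1) = false by lia.
  have [e|//] := eqVneq (k.+1 + i)%N j.+1.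
  have -> : nat_of_ord j = k by lia.
  by rewrite n2.
- by rewrite !n3 !addSn !eqSS -!addnS !eqn_add2l.
Qed.

Lemma linear_nseq k : uiso (linear (nseq k true)) (dpath k).
Proof.
have sz : size (nseq k true) = k by rewrite size_nseq.
have h (i : 'I_(size (nseq k true)).+1) : (i < k.+1)%N.
  by rewrite -[X in (_ < X.+1)%N]sz ltn_ord.
pose f (i : linear (nseq k true)) : dpath k := Ordinal (h i).
exists f.
  apply: inj_card_bij; last by rewrite !card_ord sz.
  by move=> i j /(congr1 val) /= e; exact: val_inj.
move=> i j; rewrite /adjacent /=; rewrite !nth_nseq.
have := h i; have := h j; case: ifP; case: ifP; lia.
Qed.

Lemma linear_runs s : uiso (linear s) (path_forest (runs s)).
Proof.
(* The induction removes one entry at a time, so the block of k marked edges read so far has to be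
   carried along. *)
suff gen k : uiso (linear (nseq k true ++ s)) (path_forest (runs (nseq k true ++ s))).
  exact: (gen 0%N).
elim: s k => [|[] s IHs] k.
- rewrite cats0 runs_nseq /path_forest /=.
  apply: uiso_trans (linear_nseq k) _.
  apply: uiso_trans (uiso_sym (uiso_edgeless0 _)) _.
  exists (fun z : dunion (edgeless 0) (dpath k) => match z with
    inl x => inr x | inr x => inl x end : dunion (dpath k) (edgeless 0)).
    by exists (fun z : dunion (dpath k) (edgeless 0) => match z with
      inl x => inr x | inr x => inl x end : dunion (edgeless 0) (dpath k)) => -[].
  by move=> [x|x] [y|y].
- have -> : nseq k true ++ true :: s = nseq k.+1 true ++ s.
    rewrite -cat_rcons; congr (_ ++ _); by elim: (k) => //= q ->.
  exact: IHs.
- rewrite runs_cat_false; apply: uiso_trans (uiso_sym (linear_split k s)) _.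
  by apply: uiso_dunion (IHs 0%N); exact: uiso_refl.
Qed.

Variables (G : ograph) (m : nat) (g : 'I_m.+1 -> G) (bs : pred 'I_m.+1).
Hypotheses (m2 : (2 < m.+1)%N) (lab : labelled g bs) (b0 : ~~ bs ord_max).

Lemma labelled_uiso_forest : uiso G (path_forest (label_runs bs)).
Proof.
apply: uiso_trans (linear_runs _); apply: uiso_sym.
set s := [seq _ | i <- enum 'I_m].
have sz : size s = m by rewrite size_map size_enum_ord.
have [bg adj] := lab.
exists (fun i : linear s => g (cast_ord (congr1 S sz) i)).
  apply: bij_comp bg _; exists (cast_ord (esym (congr1 S sz))) => i;
    by [exact: cast_ordK|exact: cast_ordKV].
have nE (i : 'I_m.+1) : nth false s i = bs i.
  have [im|im] := ltnP i m; last first.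
    rewrite nth_default ?sz//; apply/esym/negbTE.
    by have -> : i = ord_max by apply/val_inj => /=; have := ltn_ord i; lia.
  rewrite (nth_map (Ordinal im)) ?size_enum_ord//.
  have -> : nth (Ordinal im) (enum 'I_m) i = Ordinal im.
    by rewrite (nth_ord_enum _ (Ordinal im)).
  by congr bs; exact: val_inj.
move=> i j; rewrite /adjacent adj /=.
set i' := cast_ord _ i; set j' := cast_ord _ j.
have -> : nat_of_ord i = i' by []. have -> : nat_of_ord j = j' by [].
rewrite !nE -!val_eqE !ordS_val /=.
have := ltn_ord i'; have := ltn_ord j'.
case: (boolP (i' == ord_max)) => [/eqP->|hi]; first rewrite (negbTE b0);
  case: (boolP (j' == ord_max)) => [/eqP->|hj]; rewrite ?(negbTE b0) /=; try move: hi; try move: hj;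
  rewrite -?val_eqE /=; by move: (bs i') (bs j'); do 2?case; rewrite /= ?eqxx; do ?case: ifP; lia.
Qed.

Lemma class_exists ns : all (leq 1) ns ->
  perm_eq [seq n.*2 | n <- ns] [seq k <- label_runs bs | k != 0%N] ->
  exists b, in_class ns b G.
Proof.
move=> ns1 p.
pose k := count (pred1 0%N) (label_runs bs).
have h : uiso G (dunion (Qunion ns) (edgeless k)).
  apply: uiso_trans labelled_uiso_forest _.
  apply: uiso_trans (_ : uiso _ (path_forest ([seq n.*2 | n <- ns] ++ nseq k 0%N))) _.
    apply: path_forest_perm.
    rewrite -(perm_filterC (fun j => j != 0%N)).
    rewrite perm_sym; apply: perm_cat => //.
    have -> : [seq x <- label_runs bs | predC (fun j => j != 0%N) x] = nseq k 0%N.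
      by rewrite /k; elim: (label_runs bs) => //= -[|x] u ->.
    exact: perm_refl.
  apply: uiso_trans (path_forest_cat _ _) _.
  by apply: uiso_dunion; [exact: Qunion_path_forest|exact: path_forest_nseq].
have [S' S'H [f bf fE]] := reversal_exists h.
(* A class reverses arcs before isolated vertices are added; this loses nothing, since all arcs of
   the union lie in its first summand. *)
pose S := [set p : Qunion ns * Qunion ns |
  ((inl p.1, inl p.2) : dunion (Qunion ns) (edgeless k) * dunion (Qunion ns) (edgeless k)) \in S']%SET.
exists (odd #|S|), S, k; split=> //.
  apply/fintype.subsetP => q; rewrite inE => /(fintype.subsetP S'H).
  by rewrite !inE.
exists f => // x y; rewrite -fE.
case: (f x) (f y) => [u|u] [v|v] //=; by rewrite /reverse_rel /= !inE.
Qed.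

End UndirectedIso.

Lemma arcs_spanning (C : ograph) (F : {set C * C}) : F \subset arcs C -> arcs (spanning F) = F.
Proof.
move=> FC; apply/setP => -[x y]; rewrite inE /= /spanning_rel /=.
case: (boolP ((x, y) \in F)) => h; rewrite ?andbF ?andbT//.
by have := fintype.subsetP FC _ h; rewrite inE.
Qed.

(** * Means of products of kernel values over the arcs of a graph *)

Section ArcMeans.
Local Open Scope classical_set_scope.
Context {R : realType}.
Local Notation I := (measurableTypeR R).
Local Notation E := (Ex (@unif R)).
Variable U : I * I -> R.
Hypothesis bU : bmfun U.
Let M (x y : I) : R := U (x, y).

Definition arc_mean (H : ograph) : R := Ex (cube_measure #|H|) (fun t =>
  \prod_(p in arcs H) U (tnth t (enum_rank p.1), tnth t (enum_rank p.2))).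

Lemma bmfun_tnth2 n (i j : 'I_n) : bmfun (fun t : n.-tuple I => U (tnth t i, tnth t j)).
Proof.
apply: (@bmfun_comp _ _ _ _ _ U (fun t : n.-tuple I => (tnth t i, tnth t j))) => //.
by apply: measurable_fun_pair; exact: measurable_tnth.
Qed.

(** Stated along maps f and g from an arbitrary space because the induction replaces them by the
    head and the tail of g. *)
Lemma bmfun_path_weight (h : I -> R) d (T : measurableType d) n (s : seq bool)
    (f : T -> I) (g : T -> n.-tuple I) : bmfun h -> size s = n ->
  measurable_fun setT f -> measurable_fun setT g ->
  bmfun (fun z => path_weight M h s (f z) (g z)).
Proof.
move=> bh; elim: n s f g => [|n IHn] [|b s] f g // => [_ mf mg|[sn] mf mg].
  by apply: (@bmfun_comp _ _ _ _ _ h f).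
have m1 : measurable_fun setT (fun z => thead (g z)).
  exact: (measurableT_comp (@measurable_tnth _ _ _ ord0) mg).
have m2 : measurable_fun setT (fun z => [tuple of behead (g z)]).
  exact: (measurableT_comp (@measurable_behead _ _ n) mg).
have -> : (fun z => path_weight M h (b :: s) (f z) (g z)) =
  (fun z => (if b then U (f z, thead (g z)) else 1) *
            path_weight M h s (thead (g z)) [tuple of behead (g z)]).
  by apply/funext => z; rewrite {1}(tuple_eta (g z)).
apply: bmfunM; last exact: IHn.
case: b; last exact: bmfun_cst.
apply: (@bmfun_comp _ _ _ _ _ U (fun z => (f z, thead (g z)))) => //.
exact: measurable_fun_pair.
Qed.

Lemma Ex_path_weight (h : I -> R) n (s : seq bool) x : bmfun h -> size s = n ->
  Ex (cube_measure n) (fun t => path_weight M h s x t) = transfer M E h s x.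
Proof.
move=> bh; elim: n s x => [|n IHn] [|b s] x // => [_|[sn]].
  exact: Ex_cst.
rewrite Ex_cubeS; last first.
  by apply: bmfun_path_weight => //=; rewrite ?sn//; exact: measurable_cst.
transitivity (E (fun y => (if b then U (x, y) else 1) * transfer M E h s y)).
  apply: eq_Ex => y; rewrite -(IHn s y sn) -ExZ//.
  by apply: bmfun_path_weight => //; exact: measurable_cst.
by case: b => //=; apply: eq_Ex => y; rewrite mul1r.
Qed.

Hypothesis aU : forall x y, U (y, x) = - U (x, y).

Section Labelled.
Variables (H : ograph) (m : nat) (g : 'I_m.+1 -> H) (bs : pred 'I_m.+1).
Hypotheses (m2 : (2 < m.+1)%N) (lab : labelled g bs).

Lemma arc_mean_labelled : arc_mean H = (-1) ^+ backward g bs *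
  E (fun x => transfer M E (fun z => if bs ord_max then U (z, x) else 1)
      [seq bs (widen_ord (leqnSn m) i) | i <- enum 'I_m] x).
Proof.
pose F (t : m.+1.-tuple I) := \prod_(i < m.+1 | bs i) U (tnth t i, tnth t (ordS i)).
have bF : bmfun F by apply: bmfun_prod => i; exact: bmfun_tnth2.
have brank : bijective (fun i => enum_rank (g i)).
  by apply: bij_comp lab.1; exact: enum_rank_bij.
transitivity ((-1) ^+ backward g bs * Ex (cube_measure m.+1) F).
  rewrite -(Ex_cube_relabel brank bF) -ExZ; last first.
    apply: (@bmfun_comp _ _ _ _ _ F (fun t : #|H|.-tuple I =>
      [tuple tnth t (enum_rank (g i)) | i < m.+1])) => //.
    exact: (measurable_tuple_map (fun i => enum_rank (g i))).
  apply: eq_Ex => t.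
  rewrite (prod_arcs_labelled m2 lab (c := -1)
    (M := fun x y => U (tnth t (enum_rank x), tnth t (enum_rank y)))); last first.
    by move=> x y; rewrite aU mulN1r.
  by congr (_ * _); apply: eq_bigr => i _; rewrite !tnth_mktuple.
congr (_ * _); rewrite Ex_cubeS//; apply: eq_Ex => x.
rewrite -(@Ex_path_weight _ m); last 2 first.
- case: (bs ord_max); last exact: bmfun_cst.
  exact: (bmfun_section2 bU).
- by rewrite size_map size_enum_ord.
apply: eq_Ex => t; rewrite /F (prod_cycle_path M) theadE /=.
by congr path_weight.
Qed.

Lemma arc_mean_linear : ~~ bs ord_max ->
  arc_mean H = (-1) ^+ backward g bs * \prod_(k <- label_runs bs) walk U k.
Proof.
move=> /negbTE b0; rewrite arc_mean_labelled b0; congr (_ * _).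
have b1 k : bmfun (iter k (kernel_op U) (fun=> 1)).
  by apply: bmfun_iter_op => //; exact: bmfun_cst.
rewrite -[RHS](Iv_transfer_runs (M := M) (Iv := E))//.
  by move=> c k; rewrite ExZ//; exact: b1.
move=> c k x; rewrite /step_op /= -ExZ; last first.
  by apply: bmfunM; [exact: (bmfun_section1 bU)|exact: b1].
by apply: eq_Ex => y; rewrite mulrCA.
Qed.

(** The closing edge is the end weight z -> U (z, x), so m steps produce the diagonal of the
    operator power m + 1 = 2 (a + 1). *)
Lemma arc_mean_cycle a : m = (a + a).+1 -> bs =1 xpredT ->
  arc_mean H = (-1) ^+ (backward g bs + a.+1) *
    Ex (@unif R \x @unif R)%E (fun p => kernel_pow U a p ^+ 2).
Proof.
move=> ma bsT; rewrite arc_mean_labelled exprD -mulrA -trace_kernel_pow//.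
congr (_ * _); apply: eq_Ex => x; rewrite bsT.
have -> : [seq bs (widen_ord (leqnSn m) i) | i <- enum 'I_m] = nseq m true.
  rewrite (eq_map (g := fun=> true)) => [|i]; last exact: bsT.
  rewrite -[in RHS](size_enum_ord m); by elim: (enum 'I_m) => //= ? ? ->.
by rewrite transfer_nseq -[step_op M E]/(kernel_op U) iter_op_section ma.
Qed.

End Labelled.

Lemma arc_mean_expand (H : ograph) :
  Ex (cube_measure #|H|) (fun t => \prod_(p in arcs H)
     (1 / 2 + U (tnth t (enum_rank p.1), tnth t (enum_rank p.2)))) =
  \sum_(F : {set H * H} | F \subset arcs H)
     (1 / 2) ^+ (#|arcs H| - #|F|) * arc_mean (spanning F).
Proof.
pose u (t : #|H|.-tuple I) (p : H * H) := U (tnth t (enum_rank p.1), tnth t (enum_rank p.2)).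
have bprod (F : {set H * H}) : bmfun (fun t => \prod_(p in F) u t p).
  by apply: bmfun_prod => p; exact: bmfun_tnth2.
transitivity (Ex (cube_measure #|H|) (fun t => \sum_(F : {set H * H})
   (if F \subset arcs H then (1 / 2) ^+ (#|arcs H| - #|F|) else 0) * \prod_(p in F) u t p)).
  apply: eq_Ex => t.
  (* Pairs that are not arcs get the factor 0 + 1, so the product over all pairs can be distributed
     and only subsets of the arcs survive. *)
  transitivity (\prod_(p : H * H) ((if p \in arcs H then u t p else 0) +
                                   (if p \in arcs H then 1 / 2 else 1))).
    rewrite big_mkcond; apply: eq_bigr => p _.
    by case: ifP => _; rewrite ?add0r// addrC.
  rewrite bigA_distr; apply: eq_bigr => F _; case: ifP => FH; last first.
    rewrite mul0r; have /subsetPn[p pF pH] := negbT FH.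
    by rewrite (bigD1 p) //= pF (negbTE pH) mul0r.
  have -> : \prod_(p in F) u t p = \prod_p (if p \in F then u t p else 1) by rewrite -big_mkcond.
  have -> : (#|arcs H| - #|F|)%N = #|arcs H :\: F| by rewrite cardsD (finset.setIidPr FH).
  rewrite -prodr_const [X in _ = X * _]big_mkcond -big_split /=.
  apply: eq_bigr => p _; rewrite finset.in_setD; case: (boolP (p \in F)) => pF /=.
    by have := fintype.subsetP FH _ pF => ->; rewrite mul1r.
  by rewrite mulr1.
rewrite Ex_sum => [|F]; last exact: bmfunZ.
rewrite [RHS]big_mkcond; apply: eq_bigr => F _; rewrite ExZ//.
case: ifP => FH; last exact: mul0r.
congr (_ * _); rewrite /arc_mean; apply: eq_Ex => t.
by rewrite (arcs_spanning FH).
Qed.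

End ArcMeans.

(** * A kernel with zero integral over all rectangles is null *)

Section Forcing.
Local Open Scope classical_set_scope.
Context {R : realType}.
Local Notation I := (measurableTypeR R).
Local Notation E := (Ex (@unif R)).
Local Notation P2 := (@unif R \x @unif R)%E.
Variable U : I * I -> R.
Hypothesis bU : bmfun U.
Hypothesis hU : forall p, `|U p| <= 1 / 2.

(* If U integrates to 0 over every rectangle, the measure with density 1 + 2 U is
   the uniform one, by uniqueness of the product measure. *)
Definition tilt (A : set (I * I)) : \bar R := (\int[P2]_(p in A) (1 + 2 * U p)%:E)%E.

Let tilt_density_ge0 p : 0 <= 1 + 2 * U p.
Proof. by have := hU p; rewrite ler_norml => /andP[h _]; lra. Qed.

Let btilt : bmfun (fun p => 1 + 2 * U p).
Proof. by apply: bmfunD; [exact: bmfun_cst|exact: bmfunZ]. Qed.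

Let tilt0 : tilt set0 = 0%E.
Proof. by rewrite /tilt integral_set0. Qed.

Let tilt_ge0 A : (0 <= tilt A)%E.
Proof. by apply: integral_ge0 => p _; rewrite lee_fin. Qed.

Let tilt_sigma_additive : semi_sigma_additive tilt.
Proof.
move=> /= F mF tF mUF; rewrite /tilt; apply: cvg_toP.
  apply: ereal_nondecreasing_is_cvgn => m n mn.
  apply: lee_sum_nneg_natr => // k _ _.
  by apply: integral_ge0 => /= x Fkx; rewrite lee_fin.
rewrite ge0_integral_bigcup//=.
- by apply: measurable_funTS; apply/measurable_EFinP; exact: btilt.1.
- by move=> x _; rewrite lee_fin.
Qed.

HB.instance Definition _ := isMeasure.Build _ _ _ tilt tilt0 tilt_ge0 tilt_sigma_additive.

Hypothesis U0 : forall f g : I -> R, bmfun f -> bmfun g ->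
  Ex P2 (fun p => U p * g p.1 * f p.2) = 0.

Let tilt_rectangle (A B : set I) : measurable A -> measurable B ->
  tilt (A `*` B) = (@unif R A * @unif R B)%E.
Proof.
move=> mA mB.
have bA := @bmfun_indic R _ _ A mA; have bB := @bmfun_indic R _ _ B mB.
have bAB : bmfun (fun p : I * I => (\1_A p.1 : R) * \1_B p.2).
  by apply: bmfunM; [exact: (bmfun_fst bA)|exact: (bmfun_snd bB)].
have bU2 : bmfun (fun p : I * I => U p * \1_A p.1 * (\1_B p.2 : R)).
  apply: bmfunM; last exact: (bmfun_snd bB).
  by apply: bmfunM => //; exact: (bmfun_fst bA).
rewrite /tilt integral_mkcond.
transitivity (\int[P2]_p ((\1_A p.1 : R) * \1_B p.2 + 2 * (U p * \1_A p.1 * \1_B p.2))%:E)%E.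
  apply: eq_integral => -[x y] _; rewrite patchE !indicE /=.
  case: (boolP ((x, y) \in A `*` B)); rewrite in_setX /=.
    by case/andP=> -> -> /=; congr EFin; ring.
  by rewrite negb_and; case: (x \in A); case: (y \in B) => //= _; congr EFin; ring.
rewrite -(ExE P2); last by apply: bmfunD => //; exact: bmfunZ.
rewrite ExD//; last exact: bmfunZ.
rewrite ExZ// U0// mulr0 addr0 Ex_prod1//=.
transitivity ((E \1_A * E \1_B)%:E).
  congr EFin; rewrite -ExZr//; apply: eq_Ex => x; exact: ExZ.
by rewrite !Ex_indic// EFinM !fineK// fin_num_measure.
Qed.

Lemma null_of_rectangles : P2 [set p | U p != 0] = 0%E.
Proof.
have tE X : measurable X -> P2 X = tilt X.
  by move=> mX; apply: product_measure_unique => // A B mA mB; exact: tilt_rectangle.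
have mU : measurable [set p | U p != 0].
  have -> : [set p | U p != 0] = ~` (U @^-1` [set 0]).
    by apply/seteqP; split=> p /= /eqP.
  by apply: measurableC; rewrite -[X in measurable X]setTI; exact: bU.1.
have : ae_eq P2 setT (fun p => (1 + 2 * U p)%:E) (fun=> 1%E).
  apply: integral_ae_eq => //.
    exact: (bmfun_integrable P2 btilt).
  move=> A _ mA; rewrite -[LHS]/(tilt A) -tE// integral_cst//.
  by rewrite mul1e.
case=> N [mN N0 sN]; apply/eqP; rewrite -measure_le0 -N0.
apply: le_measure; rewrite ?inE//.
move=> p /= /eqP Up; apply: sN => /= /(_ Logic.I).
move=> h; have := EFin_inj h; move: (U p) Up => u Up hu; apply: Up; lra.
Qed.

End Forcing.

(** * From the uniform measure to Lebesgue measure *)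

Section Lebesgue.
Local Open Scope classical_set_scope.
Context {R : realType}.
Local Notation I := (measurableTypeR R).
Local Notation leb := (@lebesgue_measure R).

Lemma unif_lebesgue (B : set I) : measurable B -> B `<=` `[0, 1] -> @unif R B = leb B.
Proof.
move=> mB B01; rewrite /unif /= /uniform_prob.
transitivity (\int[leb]_(x in B) 1)%E; last by rewrite integral_cst// mul1e.
apply: eq_integral => x /[!inE] /B01; rewrite /= in_itv /= => h.
by rewrite /uniform_pdf h subr0 invr1.
Qed.

(** [quasirandom_forcing] speaks of Lebesgue measure on the plane. On subsets of [0, 1] it agrees
    with [unif], and the sections of N over points outside [0, 1] are empty. *)
Lemma lebesgue_null_square (N : set (I * I)) : measurable N -> N `<=` unit_square ->
  (@unif R \x @unif R)%E N = 0%E -> (leb \x leb)%E N = 0%E.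
Proof.
move=> mN Nsq; rewrite /product_measure1 /=.
have sec x : xsection N x `<=` `[0, 1].
  by move=> y; rewrite /xsection /= inE => /Nsq [].
have secE x : @unif R (xsection N x) = leb (xsection N x).
  by apply: unif_lebesgue (sec x); exact: measurable_xsection.
have mf : measurable_fun setT (leb \o xsection N) by exact: measurable_fun_xsection.
have -> : (\int[uniform_prob (@ltr01 R)]_x (uniform_prob (@ltr01 R) (xsection N x)))%E =
    (\int[uniform_prob (@ltr01 R)]_x (leb \o xsection N) x)%E.
  by apply: eq_integral => x _; exact: secE.
rewrite (integral_uniform (@ltr01 R) mf)// subr0 invr1 mul1e => h.
rewrite -[RHS]h [RHS]integral_mkcond; apply: eq_integral => x _.
rewrite patchE; case: ifPn => //; rewrite notin_setE => xn.
suff -> : xsection N x = set0 by rewrite measure0.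
apply/seteqP; split=> // y; rewrite /xsection /= inE => /Nsq [] //.
Qed.

End Lebesgue.

(** * The full cycle, its sign, and subgraphs missing an edge *)

Section CycleClasses.

(* 2^(V - E) is 1 for a cycle and at least 2 for a nonempty forest. *)
Lemma cycle_no_class (H : ograph) ns b : #|arcs H| = #|H| -> ns <> [::] ->
  all (leq 1) ns -> ~ in_class ns b H.
Proof.
move=> HE ns0 ns1 [S [k [SH _ iso]]].
pose w (x : unit) : rat := 2; pose M (x y : unit) : rat := 2^-1.
have Mc x y : M y x = 1 * M x y by rewrite mul1r.
have sumU (F : unit -> rat) : \sum_x F x = F tt by rewrite (big_pred1 tt)//; case.
have walkE j : hom_walk w M j = 2.
  suff h : iter j (step_op M (fun f => \sum_x w x * f x)) (fun=> 1) = fun=> 1.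
    by rewrite /hom_walk h sumU mulr1.
  by elim: j => //= j ->; apply/funext => x; rewrite /step_op sumU.
have : hom_count w M H = 1.
  rewrite /hom_count (eq_bigr (fun=> 1)) => [|phi _].
    by rewrite sumr_const card_ffun card_unit exp1n.
  by rewrite !prodr_const HE -exprMn mulfV// expr1n.
rewrite (hom_count_iso w M iso) hom_count_dunion hom_count_edgeless.
rewrite (hom_count_reverse w Mc SH) hom_count_Qunion expr1n mul1r.
have -> : \prod_(n <- ns) hom_count w M (Qpath n) = 2 ^+ size ns.
  elim: ns ns1 {ns0 S SH iso} => [|n ns IHns] /=; first by rewrite big_nil.
  by case/andP=> n1 /IHns; rewrite big_cons => ->;
    rewrite (hom_count_Qpath w Mc n1) expr1n mul1r walkE exprS.
rewrite sumU -exprD; case: ns ns0 {ns1 S SH iso} => // n ns _ /=.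
have : 1 <= 2 ^+ (size ns + k) :> rat by apply: exprn_ege1.
have big (z : rat) : 1 <= z -> 2 * z = 1 -> False by lra.
by rewrite addSn exprS; exact: big.
Qed.

Lemma labelled_Dcycle n : (1 < n)%N ->
  labelled (H := Dcycle n) (id : 'I_n.*2 -> _) xpredT /\
  backward (H := Dcycle n) (id : 'I_n.*2 -> _) xpredT = n.
Proof.
move=> n1; split.
  split; first by exists id.
  move=> i j; rewrite /= /Dcycle_rel /= -!val_eqE /= !ordS_mod.
  have := ltn_ord i; have := ltn_ord j.
  by case: (boolP (i.+1 == _)) => hi; case: (boolP (j.+1 == _)) => hj; lia.
rewrite /backward /=.
have e : forall i : 'I_n.*2, ~~ Dcycle_rel i (ordS i) = ~~ (i < n)%N.
  move=> i; rewrite /Dcycle_rel /= !ordS_mod.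
  have := ltn_ord i; case: (boolP (i.+1 == _)) => hi; lia.
have c : #|[pred i : 'I_n.*2 | (i < n)%N]| = n.
  rewrite -sum1_card (eq_bigl (fun i : 'I_(n.*2) => (i < n)%N)) //.
  rewrite -(big_ord_widen _ (fun=> 1%N)); last by lia.
  by rewrite sum1_card card_ord.
have := cardC [pred i : 'I_n.*2 | (i < n)%N]; rewrite c card_ord => h.
apply: (@addnI n); rewrite addnn; apply: etrans h; congr (_ + _)%N.
by apply: eq_card => i; rewrite !inE /= e.
Qed.

(** The factor (-1)^a * -2 is the trace of J^(2a+2) for the rotation J; being nonzero, it can be
    cancelled between two cycles. *)
Lemma hom_count_rot_cycle (H : ograph) a (g : 'I_a.*2.+2 -> H) : (0 < a)%N ->
  labelled g xpredT ->
  hom_count (fun=> 1) rot_kernel H = (-1) ^+ backward g xpredT * ((-1) ^+ a * -2).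
Proof.
move=> a0 lab; rewrite (hom_count_labelled (fun=> 1) rot_kernelC _ lab); last by lia.
congr (_ * _).
have -> : [seq true | _ <- enum 'I_a.*2.+1] = nseq a.*2.+1 true.
  by rewrite -[in RHS](size_enum_ord a.*2.+1); elim: (enum _) => //= ? ? ->.
under eq_bigr do rewrite transfer_nseq iterSr iter_rot_double.
by rewrite big_bool /= /step_op !big_bool /rot_kernel /=; ring.
Qed.

(** [Dcycle n] has n backward edges and every reversal changes the sign of the antisymmetric count.
    Hence any reversal of [Dcycle n] isomorphic to C has the parity of the backward edges of C plus
    n, whatever the isomorphism. *)
Lemma gamma_backward (C : ograph) n (f : 'I_n.*2 -> C) : (1 < n)%N ->
  labelled f xpredT ->
  (gamma C = 1 -> odd (backward f xpredT) = odd n) /\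
  (gamma C = -1 -> odd (backward f xpredT) = ~~ odd n).
Proof.
move=> n1 lab; have [labD backD] := labelled_Dcycle n1.
have cardC : #|C| = n.*2.
  by rewrite -(bij_eq_card lab.1) card_ord.
have key (S : {set Dcycle n * Dcycle n}) : S \subset arcs (Dcycle n) ->
    isomorphic C (reverse S) -> odd (backward f xpredT) = odd #|S| (+) odd n.
  move=> SD iso; have := hom_count_iso (fun=> 1 : int) rot_kernel iso.
  rewrite (hom_count_reverse (fun=> 1) rot_kernelC SD).
  have -> : odd n = odd (backward (H := Dcycle n) (id : 'I_n.*2 -> _) xpredT) by rewrite backD.
  move: #|S| => s; case: n n1 f lab labD {backD cardC S SD iso} => [//|a] n1 f lab labD.
  rewrite (hom_count_rot_cycle (g := f))//.
  rewrite (hom_count_rot_cycle (H := Dcycle a.+1) (g := id))//.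
  set T := (-1) ^+ a * -2 => E; have T0 : T != 0 by rewrite mulf_neq0 ?expf_neq0.
  move: E; rewrite [X in _ = X -> _]mulrA -exprD => /(mulIf T0); rewrite -signr_odd -[RHS]signr_odd => /signr_inj ->.
  by rewrite oddD.
have half : #|C|./2 = n by rewrite cardC doubleK.
rewrite /gamma half; split.
  by case: asboolP => // -[S [SD oS iso]] _; rewrite (key S SD iso) oS.
case: asboolP => // nrev _.
(* Some reversal always works, because the underlying cycles agree; for gamma = -1 it cannot be
   even. *)
have [S SD iso] : exists2 S : {set Dcycle n * Dcycle n}, S \subset arcs (Dcycle n) &
    isomorphic C (reverse S).
  apply: reversal_exists; apply: uiso_sym; exists f; first exact: lab.1.
  by move=> i j; rewrite /adjacent lab.2; have := labD.2 i j => /= ->.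
rewrite (key S SD iso); case oS: (odd #|S|) => //=.
by case: nrev; exists S.
Qed.

Section MissingEdge.
Variables (C : ograph) (m : nat) (f : 'I_m.+1 -> C).
Hypotheses (m2 : (2 < m.+1)%N) (lab : labelled f xpredT).

Lemma labelled_spanning (F : {set C * C}) : F \subset arcs C ->
  labelled (H := spanning F) f (fun i => label_edge f i \in F).
Proof.
move=> FC; have [bf adj] := lab; split=> // i j.
rewrite /= /spanning_rel; have := adj i j; rewrite /=.
have h (i' j' : 'I_m.+1) : j' = ordS i' ->
   Defs.arc (f i') (f j') && ((f i', f j') \in F) || Defs.arc (f j') (f i') && ((f j', f i') \in F)
   = (label_edge f i' \in F).
  move=> ->; rewrite /label_edge; have := adj i' (ordS i'); rewrite eqxx /=.
  case: ifP => [a _|_ /= -> //]; by rewrite (negbTE (Defs.arc_asym a)) /= orbF.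
case: (eqVneq j (ordS i)) => [ji _|ji].
  rewrite h// andbT; have -> : (i == ordS j) = false.
    by rewrite ji eq_sym (negbTE (ordS2_neq i m2)).
  by rewrite andbF orbF.
case: (eqVneq i (ordS j)) => [ij _|ij].
  by rewrite orbC h// andbF andbT.
by rewrite !andbF /= => /norP[/negbTE -> /negbTE ->].
Qed.

Lemma linear_of_missing (F : {set C * C}) : F \subset arcs C -> F != arcs C ->
  exists (g : 'I_m.+1 -> spanning F) (bs : pred 'I_m.+1),
    [/\ labelled g bs, ~~ bs ord_max & #|bs| = #|F|].
Proof.
move=> FC FneC; have labF := labelled_spanning FC.
have [i0 i0F] : exists i, label_edge f i \notin F.
  apply/existsP; apply: contraNT FneC; rewrite negb_exists => /forallP h.
  rewrite finset.eqEsubset FC /= (arcs_label_edge lab).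
  by apply/fintype.subsetP => p /imsetP[i _ ->]; have := h i; rewrite negbK.
have itE k (i : 'I_m.+1) : nat_of_ord (iter k (@ordS m.+1) i) = ((i + k) %% m.+1)%N.
  elim: k => [|k IHk]; first by rewrite addn0 modn_small.
  by rewrite iterS /= IHk -addn1 modnDml addn1 addnS.
(* Rotating by i0 + 1 places moves the missing edge to the closing position [ord_max], as the lemmas
   on linear labellings require. *)
have i0E : iter i0.+1 (@ordS m.+1) ord_max = i0.
  apply/val_inj; rewrite /= -[LHS]/(nat_of_ord (iter i0.+1 (@ordS m.+1) ord_max)) itE /=.
  by rewrite addnS -addSn modnDl modn_small.
have labG := labelled_iter_ordS i0.+1 labF.
exists (fun i => f (iter i0.+1 (@ordS m.+1) i)), (fun i => label_edge f (iter i0.+1 (@ordS m.+1) i) \in F).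
split=> //; first by rewrite i0E.
rewrite -(card_arcs_labelled m2 labG); apply: eq_card => -[x y].
rewrite inE /= /spanning_rel; case: (boolP ((x, y) \in F)) => h; rewrite ?andbF// andbT.
by have := fintype.subsetP FC _ h; rewrite inE.
Qed.

End MissingEdge.

End CycleClasses.

(** * Sums over partitions and their estimates *)

Section PartitionSums.
Context {R : realType}.
Variable l : nat.
Implicit Types (P Q : pred (seq nat)) (G : seq nat -> R).

Definition part_sum P G : R := \sum_(1 <= k < l.+1)
  \sum_(ns : k.-tuple 'I_l.+1 | P [seq val i | i <- ns]) G [seq val i | i <- ns].

Lemma part_sum_delta P G ns0 : P ns0 -> (0 < size ns0 <= l)%N ->
  all (fun n => (n <= l)%N) ns0 ->
  part_sum P (fun ns => if ns == ns0 then G ns else 0) = G ns0.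
Proof.
move=> P0 sz le0; rewrite /part_sum (bigD1_seq (size ns0)) ?iota_uniq//=; last first.
  by rewrite mem_index_iota ltnS.
rewrite [X in _ + X]big1 ?addr0 => [|k kn]; last first.
  apply: big1 => ns _; case: eqP => // e; move: kn.
  by rewrite -e size_map size_tuple eqxx.
pose t0 := map_tuple (@inord l) (in_tuple ns0).
have t0E : [seq val i | i <- t0] = ns0.
  rewrite /= -map_comp -[RHS]map_id; apply/eq_in_map => n /(allP le0) nl /=.
  by rewrite inordK.
rewrite (bigD1 t0) /= ?t0E// eqxx big1 ?addr0// => t /andP[_ tt0].
case: eqP => // e; case/eqP: tt0; apply: val_inj; apply: (inj_map val_inj).
by rewrite e t0E.
Qed.

Lemma part_sum_exchange P (T : finType) (A : pred T) (G : T -> seq nat -> R) :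
  \sum_(F | A F) part_sum P (G F) = part_sum P (fun ns => \sum_(F | A F) G F ns).
Proof.
by rewrite /part_sum exchange_big; apply: eq_bigr => k _; rewrite exchange_big.
Qed.

Lemma eq_part_sum P G G' : (forall ns, P ns -> (0 < size ns)%N -> G ns = G' ns) ->
  part_sum P G = part_sum P G'.
Proof.
move=> GG; rewrite /part_sum big_nat [RHS]big_nat; apply: eq_bigr => k /andP[k0 _].
by apply: eq_bigr => ns Pns; apply: GG => //; rewrite size_map size_tuple.
Qed.

Lemma le_part_sum P G G' : (forall ns, P ns -> (0 < size ns)%N -> G ns <= G' ns) ->
  part_sum P G <= part_sum P G'.
Proof.
move=> GG; rewrite /part_sum big_nat [leRHS]big_nat; apply: ler_sum => k /andP[k0 _].
by apply: ler_sum => ns Pns; apply: GG => //; rewrite size_map size_tuple.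
Qed.

Lemma part_sumID P Q G : part_sum P G =
  part_sum (fun ns => P ns && Q ns) G + part_sum (fun ns => P ns && ~~ Q ns) G.
Proof.
rewrite /part_sum -big_split /=; apply: eq_bigr => k _.
exact: (bigID (fun ns : k.-tuple 'I_l.+1 => Q [seq val i | i <- ns])).
Qed.

Lemma part_sumZ P G c : part_sum P (fun ns => c * G ns) = c * part_sum P G.
Proof.
rewrite /part_sum mulr_sumr; apply: eq_bigr => k _; by rewrite mulr_sumr.
Qed.

Lemma part_sum_eq0 P G : (forall ns, P ns -> (0 < size ns)%N -> G ns = 0) ->
  part_sum P G = 0.
Proof.
move=> G0; rewrite (eq_part_sum (G' := fun=> 0))//.
by rewrite /part_sum big1// => k _; rewrite big1.
Qed.

Lemma part_sum_point P G ns0 : P ns0 -> (0 < size ns0 <= l)%N ->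
  all (fun n => (n <= l)%N) ns0 ->
  part_sum (fun ns => P ns && (ns == ns0)) G = G ns0.
Proof.
move=> P0 s0 l0; rewrite -(part_sum_delta G P0 s0 l0) /part_sum.
by apply: eq_bigr => k _; rewrite big_mkcondr.
Qed.

(** Paths with 2 n_1, ..., 2 n_k edges have k + 2 (n_1 + ... + n_k) vertices in total, which must
    fit into the cycle. *)
Definition valid_part (ns : seq nat) : bool :=
  [&& sorted leq ns, all (leq 1) ns & (size ns + 2 * sumn ns <= l)%N].

Lemma mem_sorted_last ns x : sorted leq ns -> x \in ns -> (x <= last 0 ns)%N.
Proof.
case: ns => // a s /=; elim: s a x => [|b s IHs] a x /=; first by rewrite inE => _ /eqP->.
case/andP=> ab pb; rewrite inE => /predU1P[->|xs]; last exact: IHs.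
by apply: leq_trans ab _; apply: IHs => //; exact: mem_head.
Qed.

Lemma part_sum_ones G : part_sum (fun ns => valid_part ns && ~~ (2 <= last 0 ns)%N) G =
  \sum_(1 <= k < l.+1 | (k + 2 * sumn (nseq k 1%N) <= l)%N) G (nseq k 1%N).
Proof.
rewrite /part_sum [RHS]big_mkcond [LHS]big_nat [RHS]big_nat.
apply: eq_bigr => k /andP[k0 kl].
have allE (ns : k.-tuple 'I_l.+1) : valid_part [seq val i | i <- ns] ->
    ~~ (2 <= last 0 [seq val i | i <- ns])%N -> [seq val i | i <- ns] = nseq k 1%N.
  case/and3P=> so a1 _; rewrite -ltnNge ltnS => l1.
  have := @all_pred1P _ 1%N [seq val i | i <- ns].
  rewrite size_map size_tuple => h; apply/h/allP => x xs /=.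
  have := mem_sorted_last so xs; have := allP a1 _ xs; lia.
case: ifP => kk; last first.
  apply: big_pred0 => ns; apply/negP => /andP[v nl]; move/negP: kk; apply.
  have e := allE _ v nl; case/and3P: v => _ _; by rewrite e size_nseq.
have so1 : sorted leq (nseq k 1%N).
  by case: (k) => //= j; elim: j.
rewrite (big_pred1 [tuple of nseq k (inord 1)]) /=.
  rewrite map_nseq /= inordK//; lia.
move=> ns; apply/idP/eqP => [/andP[v nl]|->].
  apply: val_inj; apply: (inj_map val_inj); rewrite (allE _ v nl) /= map_nseq /= inordK//; lia.
rewrite /= map_nseq /= inordK; last by lia.
rewrite /valid_part so1 size_nseq kk andbT /=; apply/andP; split.
  by apply/allP => x; rewrite mem_nseq => /andP[_ /eqP ->].
by case: (k) => //= j; elim: j.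
Qed.

Variables (q : nat -> R) (beta : seq nat -> R).
Hypotheses (q0 : forall n, 0 <= q n) (q1 : q 1 <= 1 / 12).
Hypothesis qS : forall n, q n.+1 <= q n / pi ^+ 2.
Hypothesis l4 : (3 < l)%N.

Let pi2 : R := pi ^- 2.

Let pi2_gt0 : 0 < pi2.
Proof. by rewrite invr_gt0 exprn_gt0// pi_gt0. Qed.

Let q_geom m n : q (m + n)%N <= q m * pi2 ^+ n.
Proof.
elim: n => [|n IHn]; first by rewrite addn0 mulr1.
rewrite addnS exprSr mulrA; apply: le_trans (qS _) _.
by rewrite ler_wpM2r// ltW.
Qed.

Let prod_le1 s : all (leq 1) s ->
  \prod_(n <- s) q n <= 12 ^- size s * pi2 ^+ (sumn s - size s).
Proof.
elim: s => [|n s IHs] /=; first by rewrite big_nil mulr1 invr1.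
case/andP=> n1 a1; rewrite big_cons.
have := IHs a1; have ss : (size s <= sumn s)%N.
  by elim: (s) a1 => //= x u IHu /andP[x1 /IHu]; lia.
have -> : (n + sumn s - (size s).+1 = n.-1 + (sumn s - size s))%N by lia.
rewrite exprD exprS invfM => h.
rewrite mulrACA; apply: ler_pM => //; first by apply: prodr_ge0.
apply: le_trans (_ : q (1 + n.-1)%N <= _); first by rewrite add1n prednK.
apply: le_trans (q_geom _ _) _; apply: ler_wpM2r; first exact/exprn_ge0/ltW.
by rewrite -div1r.
Qed.

(** The largest part is charged to q_2 and each other part to q_1 <= 1/12. A factor pi^-2 is gained
    for every unit by which the largest part exceeds 2 and another part exceeds 1. *)
Let prod_le2 s : all (leq 1) s -> (2 <= last 0 s)%N ->
  \prod_(n <- s) q n <= q 2 / (12 ^+ (size s - 1) * pi ^+ (2 * sumn s - 2 * size s - 2)).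
Proof.
case: (lastP s) => // u x; rewrite last_rcons all_rcons => /andP[_ a1] x2.
rewrite -cats1 big_cat big_seq1 size_cat sumn_cat /= addn0 addn1 subn1 /=.
have ss : (size u <= sumn u)%N.
  by elim: (u) a1 => //= y v IHv /andP[y1 /IHv]; lia.
have -> : (2 * (sumn u + x) - 2 * (size u).+1 - 2 = 2 * ((sumn u - size u) + (x - 2)))%N by lia.
rewrite exprM exprD !invfM -!exprVn (exprVn pi 2) -/pi2.
have h2 : q x <= q 2 * pi2 ^+ (x - 2).
  by apply: le_trans (q_geom _ _); rewrite subnKC.
have h1 := prod_le1 a1; rewrite -exprVn in h1.
apply: le_trans (ler_pM _ _ h1 h2) _; rewrite ?prodr_ge0//.
by rewrite le_eqVlt; apply/orP; left; apply/eqP; ring.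
Qed.

(* A nonnegative weight v <= c v0 can only lower the term by c v0 min(0, beta). *)
Let min_le (v c b d : R) : 0 <= v -> v <= c -> 0 <= d -> c * Num.min 0 b * d <= v * d * b.
Proof.
move=> v0 vc d0; rewrite [leRHS]mulrAC ler_wpM2r//.
have [b0|b0] := leP 0 b; first by rewrite mulr0 mulr_ge0.
by rewrite ler_wnM2r// ltW.
Qed.

(** Split by whether the largest part is at least 2: one half is at least q_1 times the first
    assumption, the other at least q_2 times the second. The terms [1] and [2] match exactly, and
    [min_le] handles the rest. *)
Lemma part_sum_valid_ge0 :
  0 <= beta [:: 1%N] / 2 ^+ (l - 2) +
     \sum_(1 <= k < l.+1 | (3 < k + 2 * sumn (nseq k 1%N) <= l)%N)
       Num.min 0 (beta (nseq k 1%N)) /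
       (12 ^+ (k - 1) * 2 ^+ (l - 2 * sumn (nseq k 1%N))) ->
  0 <= beta [:: 2%N] / 2 ^+ (l - 4) +
     \sum_(1 <= k < l.+1)
       \sum_(ns : k.-tuple 'I_l.+1 |
             let n := map val ns in
             [&& sorted leq n, all (leq 1) n, (2 <= last 0 n)%N &
                 (5 < k + 2 * sumn n <= l)%N])
         (let n := map val ns in
          Num.min 0 (beta n) /
          (12 ^+ (k - 1) * pi ^+ (2 * sumn n - 2 * k - 2) *
           2 ^+ (l - 2 * sumn n))) ->
  0 <= part_sum valid_part (fun ns =>
    (\prod_(n <- ns) q n) / 2 ^+ (l - 2 * sumn ns) * beta ns).
Proof.
move=> H1 H2; pose G ns := (\prod_(n <- ns) q n) / 2 ^+ (l - 2 * sumn ns) * beta ns.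
rewrite -[part_sum _ _]/(part_sum valid_part G).
have v0 s : 0 <= \prod_(n <- s) q n by apply: prodr_ge0.
have d0 k : 0 <= 2 ^- k :> R by rewrite invr_ge0 exprn_ge0.
rewrite (part_sumID _ (fun ns => (2 <= last 0 ns)%N)); apply: addr_ge0.
(* A part of size at least 2 needs five vertices, so this half is empty when l = 4. *)
- have [l5|l5] := ltnP l 5.
    rewrite part_sum_eq0// => ns /andP[/and3P[_ _ sl] l2] s0.
    have := l2; have : (last 0 ns <= sumn ns)%N.
      by case: (lastP ns) => // u x; rewrite last_rcons -cats1 sumn_cat /=; lia.
    lia.
  rewrite (part_sumID _ (fun ns => ns == [:: 2%N])).
  have p2 : valid_part [:: 2%N] && (2 <= last 0 [:: 2%N])%N by rewrite /valid_part /=; lia.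
  have s2 : (0 < size [:: 2%N] <= l)%N by rewrite /=; lia.
  have a2 : all (fun n => (n <= l)%N) [:: 2%N] by rewrite /=; lia.
  rewrite (@part_sum_point (fun ns => valid_part ns && (2 <= last 0 ns)%N) G _ p2 s2 a2).
  have := mulr_ge0 (q0 2) H2; rewrite mulrDr => /le_trans; apply; apply: lerD.
    by rewrite /G big_seq1 /= le_eqVlt; apply/orP; left; apply/eqP; ring.
  set T := \sum_(1 <= k < l.+1) _.
  (* The strict bound 5 < k + 2 (n_1 + ... + n_k) excludes precisely the sequence [2]. *)
  have -> : T = part_sum (fun ns => (valid_part ns && (2 <= last 0 ns)%N) && (ns != [:: 2%N]))
    (fun ns => Num.min 0 (beta ns) / (12 ^+ (size ns - 1) *
       pi ^+ (2 * sumn ns - 2 * size ns - 2) * 2 ^+ (l - 2 * sumn ns))).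
    rewrite /T /part_sum big_nat [RHS]big_nat; apply: eq_bigr => k /andP[k0 _].
    apply: eq_big => [ns|ns _] /=; last by rewrite size_map size_tuple.
    rewrite /valid_part size_map size_tuple.
    set n := [seq _ | i <- _]; have sn : size n = k by rewrite size_map size_tuple.
    case: (sorted leq n) => //=; case: (boolP (all (leq 1) n)) => //= a1.
    case: (boolP (2 <= last 0 n)%N) => //= l2; last by rewrite andbF.
    rewrite andbT andbC; congr (_ && _).
    have ss : (size n <= sumn n)%N.
      by elim: (n) a1 => //= y v IHv /andP[y1 /IHv]; lia.
    clearbody n; rewrite -sn; apply/idP/idP => [h|h].
      by apply/eqP => e; move: h; rewrite e.
    move: a1 l2 ss h; case: n {sn} => [|x [|y n]] //=; last by lia.
    move=> _ x2 _ h; have : x != 2%N by apply: contraNneq h => ->.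
    lia.
  rewrite -part_sumZ; apply: le_part_sum => ns /andP[/andP[/and3P[_ a1 _] l2] _] _.
  rewrite /G invfM mulrA mulrA -[q 2 * _ * _]mulrAC.
  by apply: min_le => //; exact: prod_le2.
- rewrite part_sum_ones.
  have sE k : sumn (nseq k 1%N) = k by rewrite sumn_nseq mul1n.
  have E1 : \sum_(1 <= k < l.+1 | (k + 2 * sumn (nseq k 1%N) <= l)%N) G (nseq k 1%N) =
      G [:: 1%N] + \sum_(2 <= k < l.+1 | (k + 2 * sumn (nseq k 1%N) <= l)%N) G (nseq k 1%N).
    by rewrite big_ltn_cond; [rewrite ifT//= | ]; lia.
  move: H1; rewrite [X in _ + X]big_ltn_cond; last by lia.
  (* Likewise the strict bound 3 < k + 2k excludes precisely k = 1. *)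
  have -> : (3 < 1 + 2 * sumn (nseq 1 1%N) <= l)%N = false by rewrite sE; lia.
  cbv match => H1; rewrite E1.
  have := mulr_ge0 (q0 1) H1; rewrite mulrDr => /le_trans; apply.
  apply: lerD.
    by rewrite /G big_seq1 /= le_eqVlt; apply/orP; left; apply/eqP; ring.
  rewrite mulr_sumr.
  rewrite big_nat_cond [leRHS]big_nat_cond (eq_bigl (fun k => ((1 < k)%N && (k < l.+1)%N) &&
    (k + 2 * sumn (nseq k 1) <= l)%N)); last by move=> k; rewrite sE; lia.
  apply: ler_sum => k /andP[/andP[k1 _] _]; have k0 := ltnW k1.
  rewrite /G invfM mulrA mulrA -[q 1 * _ * _]mulrAC; apply: min_le => //.
  have -> : nseq k 1%N = 1%N :: nseq (k - 1) 1 by rewrite subn1; case: (k) k0.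
  have a1 : all (leq 1) (nseq (k - 1) 1%N) by apply/allP => x; rewrite mem_nseq => /andP[_ /eqP ->].
  rewrite big_cons ler_wpM2l//.
  by have := prod_le1 a1; rewrite sE size_nseq subnn mulr1.
Qed.

End PartitionSums.

(** * The contribution of each set of arcs *)

Section Terms.
Context {R : realType}.
Local Notation I := (measurableTypeR R).
Variable U : I * I -> R.
Hypothesis bU : bmfun U.
Hypothesis aU : forall x y, U (y, x) = - U (x, y).

Variables (C : ograph) (m : nat) (f : 'I_m.+1 -> C).
Hypotheses (m2 : (2 < m.+1)%N) (lab : labelled f xpredT).

Definition class_sign (ns : seq nat) (F : {set C * C}) : int :=
  `[< in_class ns false (spanning F) >]%:R - `[< in_class ns true (spanning F) >]%:R.

Lemma alphaE ns : alpha C ns = \sum_(F : {set C * C} | F \subset arcs C) class_sign ns F.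
Proof.
rewrite /alpha /alpha_count /class_sign sumrB; congr (_ - _).
  rewrite -sum1_card (eq_bigl (fun F : {set C * C} => (F \subset arcs C) &&
    `[< in_class ns false (spanning F) >])); last by move=> F; rewrite inE.
  rewrite big_mkcondr -natz natr_sum; apply: eq_bigr => F _; by case: asbool.
rewrite -sum1_card (eq_bigl (fun F : {set C * C} => (F \subset arcs C) &&
  `[< in_class ns true (spanning F) >])); last by move=> F; rewrite inE.
rewrite big_mkcondr -natz natr_sum; apply: eq_bigr => F _; by case: asbool.
Qed.

(* Only the class of the partition read off the lengths of the runs matters,
   and an odd run kills both the mean and the class. *)
Lemma term_spec (F : {set C * C}) : F \subset arcs C -> F != arcs C ->
  exists (ns0 : seq nat) (eps : int),
    [/\ sorted leq ns0, all (leq 1) ns0,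
        eps != 0 -> #|F| = (2 * sumn ns0)%N /\ (size ns0 + 2 * sumn ns0 <= m.+1)%N,
        arc_mean U (spanning F) = eps%:~R * \prod_(n <- ns0) qval U n &
        forall ns, sorted leq ns -> all (leq 1) ns ->
          class_sign ns F = if ns == ns0 then eps else 0].
Proof.
move=> FC FneC; have [g [bs [labg b0 cF]]] := linear_of_missing m2 lab FC FneC.
have mean := arc_mean_linear bU aU m2 labg b0.
have cls ns b := class_runs m2 labg b0 (ns := ns) (b := b).
set rs := label_runs bs in mean.
have [/allP ev|/allPn[k krs kodd]] := boolP (all (fun k => ~~ odd k) rs); last first.
  exists [::], 0; split=> //.
    by rewrite mean (big_rem k) //= (walk_odd bU aU (negbNE kodd)) !mul0r mulr0.
  move=> ns _ a1; rewrite if_same /class_sign.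
  suff no b : `[< in_class ns b (spanning F) >] = false by rewrite !no.
  apply/asboolP => /(cls _ _ a1)[[j pj] _].
  move: krs; rewrite -/rs (perm_mem pj) mem_cat => /orP[/mapP[n _ e]|].
    by move: kodd; rewrite e odd_double.
  by rewrite mem_nseq => /andP[_ /eqP e]; move: kodd; rewrite e.
pose hs := [seq k./2 | k <- rs & k != 0%N].
pose ns0 := sort leq hs.
have hsP : [seq n.*2 | n <- hs] = [seq k <- rs | k != 0%N].
  rewrite -map_comp -[RHS]map_id; apply/eq_in_map => k; rewrite mem_filter => /andP[_ krs] /=.
  by have := ev k krs; lia.
have so : sorted leq ns0 by apply: sort_sorted; exact: leq_total.
have ph : perm_eq ns0 hs by rewrite perm_sort.
have a1 : all (leq 1) ns0.
  rewrite (perm_all _ ph); apply/allP => n /mapP[k]; rewrite mem_filter => /andP[k0 krs] ->.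
  by have := ev k krs; lia.
have pd : perm_eq [seq n.*2 | n <- ns0] [seq k <- rs | k != 0%N].
  by rewrite -hsP; exact: perm_map.
have sumrs : sumn rs = (2 * sumn ns0)%N.
  have -> : sumn rs = sumn [seq k <- rs | k != 0%N].
    by elim: (rs) => //= k u ->; case: eqP => [->|].
  rewrite -(perm_sumn pd); elim: (ns0) => //= n u ->; lia.
have szrs : (size rs + sumn rs = m.+1)%N.
  by rewrite /rs /label_runs sumn_runs size_runs size_map size_enum_ord.
have szns : (size ns0 <= size rs)%N.
  rewrite (perm_size ph) size_map size_filter; exact: count_size.
have cardF : #|F| = sumn rs.
  rewrite -cF /rs /label_runs sumn_runs count_map -sum1_count -sum1_card.
  rewrite big_mkcond big_ord_recr /= -topredE /= (negbTE b0) addn0 big_enum_cond /=.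
  by rewrite [RHS]big_mkcond; apply: eq_bigr => i _.
have prodE : \prod_(k <- rs) walk U k = (-1) ^+ sumn ns0 * \prod_(n <- ns0) qval U n.
  have -> : \prod_(k <- rs) walk U k = \prod_(k <- [seq k <- rs | k != 0%N]) walk U k.
    rewrite big_filter [RHS]big_mkcond; apply: eq_bigr => k _.
    by case: eqP => // ->; rewrite walk0.
  rewrite -(perm_big _ pd) big_map; elim: (ns0) => [|n u IHu]; first by rewrite !big_nil mulr1.
  by rewrite !big_cons IHu (walk_even bU aU) /= exprD; ring.
have cls0 ns b : sorted leq ns -> all (leq 1) ns -> in_class ns b (spanning F) ->
    ns = ns0 /\ b = odd (backward g bs + sumn ns).
  move=> sns ans /(cls _ _ ans)[[j pj] bE]; split=> //.
  apply: (sorted_eq leq_trans anti_leq sns so).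
  have : perm_eq [seq n.*2 | n <- ns] [seq n.*2 | n <- ns0].
    rewrite perm_sym; apply: perm_trans pd _.
    rewrite (permPl (perm_filter _ pj)) filter_cat.
    have -> : [seq x <- nseq j 0%N | x != 0%N] = [::] by elim: (j).
    rewrite cats0 (_ : [seq x <- [seq n.*2 | n <- ns] | x != 0%N] = [seq n.*2 | n <- ns])//.
    apply/all_filterP/allP => x /mapP[n /(allP ans) n1 ->].
    by rewrite double_eq0 -lt0n.
  by apply: perm_map_inj => x y /double_inj.
have [b inb] := class_exists m2 labg b0 a1 pd.
have [_ bE] := cls0 _ _ so a1 inb.
(* One sign serves both purposes: [walk_even] gives (-1)^n for each path of length 2n, and n is also
   the number of backward arcs of Q_{2n}, from which reversals are counted. *)
exists ns0, ((-1) ^+ (backward g bs + sumn ns0)); split=> //.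
- by move=> _; rewrite cardF sumrs; split=> //; rewrite -sumrs; lia.
- by rewrite mean prodE mulrA rmorphXn /= rmorphN1 -exprD.
move=> ns sns ans; rewrite /class_sign; case: eqP => [->|ne].
  rewrite -signr_odd -bE; case: b inb bE => inb bE.
    have -> : `[< in_class ns0 true (spanning F) >] = true by apply/asboolP.
    have -> : `[< in_class ns0 false (spanning F) >] = false.
      by apply/asboolP => /(cls0 _ _ so a1)[_]; rewrite -bE.
    by [].
  have -> : `[< in_class ns0 false (spanning F) >] = true by apply/asboolP.
  have -> : `[< in_class ns0 true (spanning F) >] = false.
    by apply/asboolP => /(cls0 _ _ so a1)[_]; rewrite -bE.
  by [].
suff no b' : `[< in_class ns b' (spanning F) >] = false by rewrite !no.
by apply/asboolP => /(cls0 _ _ sns ans)[].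
Qed.

Let cardC : #|C| = m.+1.
Proof. by rewrite -(bij_eq_card lab.1) card_ord. Qed.

Let arcsC : #|arcs C| = m.+1.
Proof.
by rewrite (card_arcs_labelled m2 lab) (eq_card (B := 'I_m.+1))// card_ord.
Qed.

Lemma class_sign_full ns : ns <> [::] -> all (leq 1) ns -> class_sign ns (arcs C) = 0.
Proof.
move=> ns0 a1; rewrite /class_sign.
suff no b : `[< in_class ns b (spanning (arcs C)) >] = false by rewrite !no.
apply/asboolP; apply: cycle_no_class => //.
by rewrite arcs_spanning//= arcsC -cardC.
Qed.

Lemma arc_mean_full : arc_mean U (spanning (arcs C)) = arc_mean U C.
Proof.
by rewrite /arc_mean; apply: eq_Ex => t; rewrite (arcs_spanning (subxx _)).
Qed.

Lemma arc_mean_edgeless : arc_mean U (spanning (finset.set0 : {set C * C})) = 1.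
Proof.
rewrite -[RHS](Ex_cst (cube_measure #|C|)); apply: eq_Ex => t.
by rewrite (arcs_spanning (finset.sub0set _)) finset.big_set0.
Qed.

Local Notation l := m.+1.
Local Notation v ns := ((\prod_(n <- ns) qval U n) / 2 ^+ (l - 2 * sumn ns)).

Lemma proper_termE (F : {set C * C}) : F \subset arcs C -> F != arcs C ->
  (1 / 2) ^+ (l - #|F|) * arc_mean U (spanning F) =
  (if F == finset.set0 then 2 ^- l else 0) +
  part_sum l (valid_part l) (fun ns => v ns * (class_sign ns F)%:~R).
Proof.
move=> FC FneC; have [ns0 [eps [so a1 cF mean cls]]] := term_spec FC FneC.
have -> : part_sum l (valid_part l) (fun ns => v ns * (class_sign ns F)%:~R) =
  part_sum l (valid_part l) (fun ns => if ns == ns0 then v ns * eps%:~R else 0).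
  apply: eq_part_sum => ns /and3P[sns ans _] _; rewrite cls//.
  by case: ifP => //; rewrite mulr0.
have half j : (1 / 2) ^+ j = 2 ^- j :> R by rewrite div1r exprVn.
have [e0|e0] := eqVneq eps 0.
  rewrite mean e0 /= mul0r mulr0 part_sum_eq0 => [|ns _ _]; last first.
    by case: ifP => //; rewrite mulr0.
  case: eqP => [F0|]; last by rewrite addr0.
  move: mean; rewrite F0 arc_mean_edgeless e0 mul0r => /eqP.
  by rewrite oner_eq0.
have [cFE szl] := cF e0.
(* The empty partition comes only from the empty F; it yields the main term 2^-l, which [part_sum]
   omits because there k >= 1. *)
have [n0|n0] := eqVneq ns0 [::].
  have F0 : F = finset.set0 by apply/eqP; rewrite -cards_eq0 cFE n0.
  rewrite F0 eqxx cards0 subn0 arc_mean_edgeless mulr1 half part_sum_eq0 ?addr0//.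
  by move=> ns _ s0; case: eqP => // e; move: s0; rewrite e n0.
have sz0 : (0 < size ns0)%N by rewrite lt0n size_eq0.
rewrite part_sum_delta.
- have -> : (F == finset.set0) = false.
    rewrite -cards_eq0 cFE; case: (ns0) n0 a1 => //= n u _ /andP[n1 _]; lia.
  by rewrite add0r mean half cFE; ring.
- by rewrite /valid_part so a1.
- by rewrite sz0; lia.
- apply/allP => n nin; have : (n <= sumn ns0)%N; last by lia.
  by elim: (ns0) nin => //= x u IHu; rewrite inE => /predU1P[->|/IHu]; lia.
Qed.

Lemma density_decomposition :
  \sum_(F : {set C * C} | F \subset arcs C)
     (1 / 2) ^+ (#|arcs C| - #|F|) * arc_mean U (spanning F) =
  2 ^- l + part_sum l (valid_part l) (fun ns => v ns * (alpha C ns)%:~R) +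
  arc_mean U C.
Proof.
rewrite arcsC (bigD1 (arcs C)) //= arcsC subnn expr0 [1 * arc_mean _ _]mul1r.
rewrite arc_mean_full addrC.
congr (_ + _).
rewrite (eq_bigr (fun F : {set C * C} => (if F == finset.set0 then 2 ^- l else 0) +
  part_sum l (valid_part l) (fun ns => v ns * (class_sign ns F)%:~R))); last first.
  by move=> F /andP[FC FneC]; exact: proper_termE.
rewrite big_split /=; congr (_ + _).
  rewrite (bigD1 finset.set0) /= ?eqxx ?big1 ?addr0//.
    by move=> F /andP[_ /negbTE ->].
  by rewrite finset.sub0set eq_sym -cards_eq0 arcsC.
rewrite part_sum_exchange; apply: eq_part_sum => ns /and3P[_ a1 _] s0.
rewrite -mulr_sumr; congr (_ * _); rewrite alphaE rmorph_sum /=.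
(* [alpha] also ranges over the full arc set, but that set lies in no class. *)
rewrite [RHS](bigD1 (arcs C)) //= class_sign_full ?add0r//.
by move=> e; rewrite e in s0.
Qed.

End Terms.

(** * Tournamentons and their deviation from 1/2 *)

Section QuasirandomForcing.
Local Open Scope classical_set_scope.
Context {R : realType}.
Local Notation I := (measurableTypeR R).
Variable W : R * R -> R.
Hypothesis tW : tournamenton W.

(** Extending by 0 outside the unit square makes the bound 1/2, antisymmetry and measurability hold
    on the whole plane. *)
Definition deviation : I * I -> R := (fun p => W p - 1 / 2) \_ unit_square.

Lemma measurable_unit_square : measurable (@unit_square R : set (I * I)).
Proof. by apply: measurableX; exact: measurable_itv. Qed.

Let W01 p : unit_square p -> 0 <= W p <= 1.
Proof.
case: p => x y sq; have [_ W0 WW] := tW; rewrite W0//=.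
have sq' : unit_square (y, x) by case: sq.
by have := WW _ _ sq; have := W0 _ sq'; lra.
Qed.

Lemma deviation_le p : `|deviation p| <= 1 / 2.
Proof.
rewrite /deviation patchE; case: ifPn => [|_]; last by rewrite normr0; lra.
by rewrite inE => /W01 /andP[W0 W1]; rewrite ler_norml; apply/andP; split; lra.
Qed.

Lemma bmfun_deviation : bmfun deviation.
Proof.
split; last by exists (1 / 2); exact: deviation_le.
have [[mW _] _ _] := tW.
apply/(measurable_restrictT _ measurable_unit_square).
by apply: measurable_funB => //; exact: measurable_cst.
Qed.

Lemma deviation_asym x y : deviation (y, x) = - deviation (x, y).
Proof.
rewrite /deviation !patchE.
have e : ((y, x) \in (@unit_square R)) = ((x, y) \in (@unit_square R)).
  by apply/idP/idP; rewrite !inE => -[].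
rewrite e; case: ifPn => [|_]; last by rewrite oppr0.
by rewrite inE => sq; have [_ _ /(_ _ _ sq)] := tW; lra.
Qed.

Lemma density_deviation (H : ograph) : density H W =
  Ex (cube_measure #|H|) (fun t => \prod_(p in arcs H)
     (1 / 2 + deviation (tnth t (enum_rank p.1), tnth t (enum_rank p.2)))).
Proof.
rewrite -Rintegral_unit_cube; last first.
  apply: bmfun_prod => p; apply: bmfunD; first exact: bmfun_cst.
  exact: (bmfun_tnth2 bmfun_deviation).
apply: eq_Rintegral => t /[!inE] tc; apply: eq_bigr => p _.
rewrite /deviation patchE ifT; first by ring.
by rewrite inE; split; rewrite /= in_itv; exact: tc.
Qed.

Lemma deviation_null (a : nat) :
  Ex (@unif R \x @unif R)%E (fun p => kernel_pow deviation a p ^+ 2) = 0 ->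
  {ae (@lebesgue_measure R \x @lebesgue_measure R)%E,
      forall p, unit_square p -> W p = 1 / 2}.
Proof.
move=> K0; have bD := bmfun_deviation.
have N0 := null_of_rectangles bD deviation_le (kernel_pow_null bD deviation_asym K0).
set N := [set p | deviation p != 0] in N0.
have mN : measurable N.
  have -> : N = ~` (deviation @^-1` [set 0]).
    by apply/seteqP; split=> p /= /eqP.
  by apply: measurableC; rewrite -[X in measurable X]setTI; exact: bD.1.
exists N; split=> //.
  apply: lebesgue_null_square => // p; rewrite /N /= /deviation patchE.
  by case: ifPn => [|_]; [rewrite inE|rewrite eqxx].
move=> p /= /not_implyP[sq Wp]; rewrite /N /= /deviation patchE ifT ?inE//.
by apply/eqP => h; apply: Wp; lra.
Qed.

End QuasirandomForcing.

(* With s = gamma C, s * (t(C, W) - 2^-l) is a nonnegative partition sum plus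
   the square of the Hilbert-Schmidt norm of the l/2-th power of the kernel. *)
Lemma forcing_of_signed_sums (R : realType) (C : ograph) (l : nat) (s : R) :
  cycle_orientation C l -> ~~ odd l ->
  (s = 1 /\ gamma C = 1) \/ (s = -1 /\ gamma C = -1) ->
  0 <= s * (alpha C [:: 1%N])%:~R / 2 ^+ (l - 2) +
     \sum_(1 <= k < l.+1 | (3 < k + 2 * sumn (nseq k 1%N) <= l)%N)
       Num.min 0 (s * (alpha C (nseq k 1%N))%:~R) /
       (12 ^+ (k - 1) * 2 ^+ (l - 2 * sumn (nseq k 1%N))) ->
  0 <= s * (alpha C [:: 2%N])%:~R / 2 ^+ (l - 4) +
     \sum_(1 <= k < l.+1)
       \sum_(ns : k.-tuple 'I_l.+1 |
             let n := map val ns in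
             [&& sorted leq n, all (leq 1) n, (2 <= last 0 n)%N &
                 (5 < k + 2 * sumn n <= l)%N])
         (let n := map val ns in
          Num.min 0 (s * (alpha C n)%:~R) /
          (12 ^+ (k - 1) * pi ^+ (2 * sumn n - 2 * k - 2) *
           2 ^+ (l - 2 * sumn n))) ->
  quasirandom_forcing R C.
Proof.
move=> [l2 [f bf fE]] le hs H1 H2 W tW.
have [n ln] : exists n, l = n.*2 by exists l./2; rewrite even_halfK.
case: n ln => [|[|b]] ln; [lia|lia|].
(* Here l = 2 (a + 1), so [kernel_pow] at index a is the kernel of A^(l/2). *)
set a := b.+1 in ln; have a0 : (0 < a)%N by [].
subst l.
have lab : labelled (l := a.+1.*2) f xpredT.
  by split=> // i j; rewrite fE.
have bD := bmfun_deviation tW; have aD := deviation_asym tW; have hD := deviation_le tW.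
set D := deviation W in bD aD hD.
have m2 : (2 < a.*2.+2)%N by lia.
have cardA : #|arcs C| = a.*2.+2.
  by rewrite (card_arcs_labelled m2 lab) (eq_card (B := 'I_a.*2.+2))// card_ord.
rewrite (density_deviation tW) (arc_mean_expand bD) (density_decomposition bD aD (m := a.*2.+1) m2 lab).
rewrite cardA (arc_mean_cycle bD aD (m := a.*2.+1) (a := a) m2 lab) ?addnn//.
set K := Ex _ _; set S := part_sum _ _ _ => dens.
have K0 : 0 <= K by apply: Ex_ge0 => p; exact: sqr_ge0.
have S0 : 0 <= s * S.
  have qS n : qval D n.+1 <= qval D n / pi ^+ 2 by exact: qvalS_le.
  have q1 : qval D 1 <= 1 / 12 by exact: qval1_le.
  have l4 : (3 < a.+1.*2)%N by lia.
  have := part_sum_valid_ge0 (l := a.+1.*2) (q := qval D)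
    (beta := fun ns => s * (alpha C ns)%:~R) (qval_ge0 D) q1 qS l4 H1 H2.
  rewrite /S -part_sumZ; congr (0 <= _); apply: eq_part_sum => ns _ _.
  exact: mulrCA.
(* The exponent adds to the backward edges of C the number l/2 = a + 1 of backward edges of D_l, so
   its parity decides gamma. *)
have sgn : (-1) ^+ (backward f xpredT + a.+1) = s.
  have [g1 g2] := gamma_backward (n := a.+1) (f := f) a0 lab.
  rewrite -signr_odd oddD; case: hs => -[-> /[dup] _]; [move/g1|move/g2] => ->.
    by rewrite addbb.
  by case: (odd a.+1).
have : S + s * K = 0 by move: dens; rewrite sgn; lra.
move=> SK; apply: (deviation_null tW (a := a)); rewrite -/D -/K.
apply/eqP; rewrite eq_le K0 andbT.
have ss : s * s = 1 by case: hs => -[-> _]; ring.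
have : s * S + K = 0 by rewrite -[K]mul1r -ss -mulrA -mulrDr SK mulr0.
lra.
Qed.

(* [ns] runs over the sequences n_1, ..., n_k (a single one, 1, ..., 1, in the
   first and third sums); bounding k and the n_i by l loses no term. *)
Theorem theorem11 (R : realType) (C : ograph) (l : nat)
    (hC : cycle_orientation C l) (hl : ~~ odd l) :
  (gamma C = 1 ->
   0 <= (alpha C [:: 1%N])%:~R / 2 ^+ (l - 2) +
     \sum_(1 <= k < l.+1 |
           (3 < k + 2 * sumn (nseq k 1%N) <= l)%N)
       Num.min 0 (alpha C (nseq k 1%N))%:~R /
       (12 ^+ (k - 1) * 2 ^+ (l - 2 * sumn (nseq k 1%N))) :> R ->
   0 <= (alpha C [:: 2%N])%:~R / 2 ^+ (l - 4) +
     \sum_(1 <= k < l.+1)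
       \sum_(ns : k.-tuple 'I_l.+1 |
             let n := map val ns in
             [&& sorted leq n, all (leq 1) n, (2 <= last 0 n)%N &
                 (5 < k + 2 * sumn n <= l)%N])
         (let n := map val ns in
          Num.min 0 (alpha C n)%:~R /
          (12 ^+ (k - 1) * pi ^+ (2 * sumn n - 2 * k - 2) *
           2 ^+ (l - 2 * sumn n))) :> R ->
   quasirandom_forcing R C) /\
  (gamma C = -1 ->
   (alpha C [:: 1%N])%:~R / 2 ^+ (l - 2) +
     \sum_(1 <= k < l.+1 |
           (3 < k + 2 * sumn (nseq k 1%N) <= l)%N)
       Num.max 0 (alpha C (nseq k 1%N))%:~R /
       (12 ^+ (k - 1) * 2 ^+ (l - 2 * sumn (nseq k 1%N))) <= 0 :> R ->
   (alpha C [:: 2%N])%:~R / 2 ^+ (l - 4) +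
     \sum_(1 <= k < l.+1)
       \sum_(ns : k.-tuple 'I_l.+1 |
             let n := map val ns in
             [&& sorted leq n, all (leq 1) n, (2 <= last 0 n)%N &
                 (5 < k + 2 * sumn n <= l)%N])
         (let n := map val ns in
          Num.max 0 (alpha C n)%:~R /
          (12 ^+ (k - 1) * pi ^+ (2 * sumn n - 2 * k - 2) *
           2 ^+ (l - 2 * sumn n))) <= 0 :> R ->
   quasirandom_forcing R C).
Proof.
split=> hg H1 H2.
  apply: (@forcing_of_signed_sums R C l 1 hC hl); first by left.
    move: H1; congr (0 <= _ + _); first by rewrite mul1r.
    by apply: eq_bigr => k _; rewrite mul1r.
  move: H2; congr (0 <= _ + _); first by rewrite mul1r.
  by apply: eq_bigr => k _; apply: eq_bigr => ns _; rewrite /= mul1r.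
(* Negating the inequalities turns max into min, which reduces this half to s = -1. *)
have minN (z : R) : Num.min 0 (-1 * z) = - Num.max 0 z.
  by rewrite mulN1r -[in LHS]oppr0 -oppr_max.
apply: (@forcing_of_signed_sums R C l (-1) hC hl); first by right.
  move: H1; rewrite -oppr_ge0 opprD; congr (0 <= _ + _); first by rewrite mulN1r mulNr.
  by rewrite -sumrN; apply: eq_bigr => k _; rewrite minN mulNr.
move: H2; rewrite -oppr_ge0 opprD; congr (0 <= _ + _); first by rewrite mulN1r mulNr.
rewrite -sumrN; apply: eq_bigr => k _; rewrite -sumrN; apply: eq_bigr => ns _.
by rewrite /= minN mulNr.
Qed.
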